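(* Let $\mathsf{X}$ be an $\mathsf{L}_2$-sentence such that $\mathsf{ACA}_0\to\mathsf{X}\to\mathsf{WKL}_0$ (i.e. $\mathsf{ACA}_0$ proves $\mathsf{X}$ and $\mathsf{RCA}_0+\mathsf{X}$ proves $\mathsf{WKL}$). (a) The system $\mathsf{RCA}_0^\omega+\mathsf{QF\text{-}AC}^{0,1}$ proves $\mathsf{LIN}\leftrightarrow[\mathsf{HBU}\vee\neg\mathsf{WKL}]\leftrightarrow[\mathsf{HBU}\vee\neg\mathsf{X}]$. (b) If $\mathsf{Y}$ is an $\mathsf{L}_2$-sentence provable in $\mathsf{ACA}_0$ but not in $\mathsf{RCA}_0$, then $\mathsf{RCA}_0^\omega$ proves $\mathsf{Y}\vee\mathsf{LIN}$, as well as $\Pi^1_1\text{-}\mathsf{CA}_0\vee(\exists^2)\vee\mathsf{LIN}$.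
   Context: Work in the language $\mathsf{L}_\omega$ of higher-order arithmetic with variables of all finite types: $0$ is the type of natural numbers and $\sigma\to\tau$ the type of mappings; $1=0\to0$, $2=1\to0$. $\mathsf{L}_2$ is the sublanguage of second-order arithmetic (types $0$ and $1$ only). Equality at higher types is pointwise; $\le_\tau$ pointwise via $\le_0$. $\mathsf{RCA}_0^\omega$ is Kohlenbach's base theory: basic axioms making $0,1,<,+,\times$ an ordered semiring, the combinators $K,S$, the recursor $\mathbf{R}_0$ ($\mathbf{R}_0(f,m,0)=m$, $\mathbf{R}_0(f,m,n+1)=f(\mathbf{R}_0(f,m,n))$), extensionality at all types, quantifier-free induction, and $\mathsf{QF\text{-}AC}^{1,0}$. $\mathsf{QF\text{-}AC}^{\sigma,\tau}$ is the schema $(\forall x^\sigma)(\exists y^\tau)A(x,y)\to(\exists Y^{\sigma\to\tau})(\forall x^\sigma)A(x,Y(x))$ for quantifier-free $A$. $\mathsf{RCA}_0,\mathsf{WKL}_0,\mathsf{ACA}_0$ are the usual second-order systems; $\mathsf{WKL}$ is ''every infinite binary tree has a path''; $\Pi^1_1\text{-}\mathsf{CA}_0$ as a disjunct denotes the $\Pi^1_1$-comprehension axiom. Reals are represented by type-1 objects coding fast-converging Cauchy sequences of rationals with equality $=_{\mathbb R}$; a function $\Psi:\mathbb R\to\mathbb R^+$ is a type $1\to1$ object mapping reals to positive reals and respecting $=_{\mathbb R}$. $I=[0,1]$, $I^\Psi_x=(x-\Psi(x),x+\Psi(x))$. A chain $A_1\leftrightarrow A_2\leftrightarrow\cdots$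 means each consecutive equivalence. $(\exists^2)$: $(\exists\varphi^2\le_2 1)(\forall f^1)\big[(\exists n^0)(f(n)=0)\leftrightarrow\varphi(f)=0\big]$. $\mathsf{HBU}$: $(\forall\Psi:\mathbb R\to\mathbb R^+)(\exists\langle y_1,\dots,y_k\rangle)(\forall x\in I)(\exists i\le k)(x\in I^\Psi_{y_i})$. $\mathsf{LIN}$: for every $\Psi:\mathbb R\to\mathbb R^+$ there is a sequence of open intervals $(a_n,b_n)_{n\in\mathbb N}$ with $\bigcup_n(a_n,b_n)$ covering $\mathbb R$ such that $(\forall n\in\mathbb N)(\exists x\in\mathbb R)[(a_n,b_n)=I^\Psi_x]$. *)

(* Defs.v *)
From Stdlib Require Import List.
Import ListNotations.

Set Implicit Arguments.
Unset Strict Implicit.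
Unset Printing Implicit Defensive.

Inductive ty : Type :=
| tN : ty
| Arr : ty -> ty -> ty.

Declare Scope ty_scope.
Delimit Scope ty_scope with ty.
Bind Scope ty_scope with ty.
Notation "σ ⟶ τ" := (Arr σ τ) (at level 55, right associativity) : ty_scope.

Definition t1 : ty := (tN ⟶ tN)%ty.
Definition t2 : ty := (t1 ⟶ tN)%ty.

Definition ctx := list ty.

(* Typed de Bruijn indices. *)
Inductive var : ctx -> ty -> Type :=
| vz (Γ : ctx) (τ : ty) : var (τ :: Γ) τ
| vs (Γ : ctx) (σ τ : ty) : var Γ τ -> var (σ :: Γ) τ.

Arguments vz {Γ τ}.
Arguments vs {Γ} σ {τ} v.

Inductive tm (Γ : ctx) : ty -> Type :=
| Var (τ : ty) : var Γ τ -> tm Γ τ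
| Zero : tm Γ tN
| One : tm Γ tN
| Plus : tm Γ (tN ⟶ tN ⟶ tN)
| Times : tm Γ (tN ⟶ tN ⟶ tN)
| Kc (σ τ : ty) : tm Γ (σ ⟶ τ ⟶ σ)
| Sc (ρ σ τ : ty) : tm Γ ((ρ ⟶ σ ⟶ τ) ⟶ (ρ ⟶ σ) ⟶ ρ ⟶ τ)
| R0 : tm Γ ((tN ⟶ tN) ⟶ tN ⟶ tN ⟶ tN)
| App (σ τ : ty) : tm Γ (σ ⟶ τ) -> tm Γ σ -> tm Γ τ.

Arguments Zero {Γ}.
Arguments One {Γ}.
Arguments Plus {Γ}.
Arguments Times {Γ}.
Arguments Kc {Γ} σ τ.
Arguments Sc {Γ} ρ σ τ.
Arguments R0 {Γ}.

(* The prime formulas are equations and inequalities between terms of type 0;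
   equality at higher types is the defined notion [eqT] below. *)
Inductive form : ctx -> Type :=
| Eq (Γ : ctx) : tm Γ tN -> tm Γ tN -> form Γ
| Lt (Γ : ctx) : tm Γ tN -> tm Γ tN -> form Γ
| Bot (Γ : ctx) : form Γ
| Imp (Γ : ctx) : form Γ -> form Γ -> form Γ
| And (Γ : ctx) : form Γ -> form Γ -> form Γ
| Or (Γ : ctx) : form Γ -> form Γ -> form Γ
| All (Γ : ctx) (τ : ty) : form (τ :: Γ) -> form Γ
| Ex (Γ : ctx) (τ : ty) : form (τ :: Γ) -> form Γ.

Arguments Bot {Γ}.

Definition sentence := form nil.

Definition Not Γ (A : form Γ) : form Γ := Imp A Bot.
Definition Iff Γ (A B : form Γ) : form Γ := And (Imp A B) (Imp B A).

Definition ren (Γ Γ' : ctx) := forall τ, var Γ τ -> var Γ' τ.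
Definition sub (Γ Γ' : ctx) := forall τ, var Γ τ -> tm Γ' τ.

Fixpoint ren_tm Γ Γ' (r : ren Γ Γ') τ (t : tm Γ τ) : tm Γ' τ :=
  match t with
  | Var v => Var (r _ v)
  | Zero => Zero
  | One => One
  | Plus => Plus
  | Times => Times
  | Kc σ τ => Kc σ τ
  | Sc ρ σ τ => Sc ρ σ τ
  | R0 => R0
  | App t u => App (ren_tm r t) (ren_tm r u)
  end.

Fixpoint sub_tm Γ Γ' (s : sub Γ Γ') τ (t : tm Γ τ) : tm Γ' τ :=
  match t with
  | Var v => s _ v
  | Zero => Zero
  | One => One
  | Plus => Plus
  | Times => Times
  | Kc σ τ => Kc σ τ
  | Sc ρ σ τ => Sc ρ σ τ
  | R0 => R0
  | App t u => App (sub_tm s t) (sub_tm s u)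
  end.

Definition scons Γ Γ' σ (t : tm Γ' σ) (s : sub Γ Γ') : sub (σ :: Γ) Γ' :=
  fun τ (v : var (σ :: Γ) τ) =>
    match v in var Δ τ
          return match Δ with
                 | nil => unit
                 | σ0 :: Δ0 => tm Γ' σ0 -> sub Δ0 Γ' -> tm Γ' τ
                 end with
    | vz => fun t _ => t
    | vs _ w => fun _ s => s _ w
    end t s.

Definition up Γ Γ' σ (s : sub Γ Γ') : sub (σ :: Γ) (σ :: Γ') :=
  scons (Var vz) (fun τ v => ren_tm (fun τ w => vs σ w) (s τ v)).

Fixpoint sub_fm Γ (A : form Γ) : forall Γ', sub Γ Γ' -> form Γ' :=
  match A with
  | Eq t u => fun _ s => Eq (sub_tm s t) (sub_tm s u)
  | Lt t u => fun _ s => Lt (sub_tm s t) (sub_tm s u)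
  | Bot => fun _ _ => Bot
  | Imp A B => fun _ s => Imp (sub_fm A s) (sub_fm B s)
  | And A B => fun _ s => And (sub_fm A s) (sub_fm B s)
  | Or A B => fun _ s => Or (sub_fm A s) (sub_fm B s)
  | All A => fun _ s => All (sub_fm A (up s))
  | Ex A => fun _ s => Ex (sub_fm A (up s))
  end.

Definition ids Γ : sub Γ Γ := fun _ v => Var v.

Definition wk_tm Γ σ τ (t : tm Γ τ) : tm (σ :: Γ) τ :=
  ren_tm (fun _ v => vs σ v) t.
Definition wk_fm Γ σ (A : form Γ) : form (σ :: Γ) :=
  sub_fm A (fun _ v => Var (vs σ v)).
Definition inst Γ σ (A : form (σ :: Γ)) (t : tm Γ σ) : form Γ :=
  sub_fm A (scons t (@ids Γ)).

(* [ext Γ Γ'] is inferred when Γ' is Γ with further variables pushed on top.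
   A bound variable [x] of [∀ x : τ, A] or [∃ x : τ, A] is a term of the
   context at its binder, and [↑ x] moves it, or any other term, to the context
   in which it is used. *)

Class ext (Γ Γ' : ctx) := ext_ren : ren Γ Γ'.
#[export] Instance ext_refl Γ : ext Γ Γ | 0 := fun _ v => v.
#[export] Instance ext_step Γ Γ' σ (e : ext Γ Γ') : ext Γ (σ :: Γ') | 1 :=
  fun τ v => vs σ (e τ v).

Definition lift Γ Γ' {e : ext Γ Γ'} τ (t : tm Γ τ) : tm Γ' τ :=
  ren_tm (@ext_ren _ _ e) t.

Definition fall Γ τ (F : tm (τ :: Γ) τ -> form (τ :: Γ)) : form Γ :=
  All (F (Var vz)).
Definition fex Γ τ (F : tm (τ :: Γ) τ -> form (τ :: Γ)) : form Γ :=
  Ex (F (Var vz)).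

Declare Scope fm_scope.
Delimit Scope fm_scope with fm.
Bind Scope fm_scope with form.
Bind Scope fm_scope with tm.
Notation "↑ t" := (lift t) (at level 9, t at level 9, format "↑ t") : fm_scope.
Notation "f · t" := (App f t) (at level 36, left associativity) : fm_scope.
Notation "t ⊗ u" := (Times · t · u)%fm (at level 40, left associativity) : fm_scope.
Notation "t ⊕ u" := (Plus · t · u)%fm (at level 50, left associativity) : fm_scope.
Notation "t ≐ u" := (Eq t u) (at level 70, no associativity) : fm_scope.
Notation "t ≺ u" := (Lt t u) (at level 70, no associativity) : fm_scope.
Notation "¬ A" := (Not A) (at level 75, right associativity) : fm_scope.
Notation "A ∧ B" := (And A B) (at level 80, right associativity) : fm_scope.
Notation "A ∨ B" := (Or A B) (at level 85, right associativity) : fm_scope.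
Notation "A ⇒ B" := (Imp A B) (at level 90, right associativity) : fm_scope.
Notation "A ⇔ B" := (Iff A B) (at level 95, no associativity) : fm_scope.
Notation "∀ x : τ , A" := (@fall _ τ%ty (fun x => A%fm))
  (at level 200, x name, τ at level 60, A at level 200) : fm_scope.
Notation "∃ x : τ , A" := (@fex _ τ%ty (fun x => A%fm))
  (at level 200, x name, τ at level 60, A at level 200) : fm_scope.

Local Open Scope fm_scope.

Definition Two Γ : tm Γ tN := One ⊕ One.
Arguments Two {Γ}.

Definition Le Γ (t u : tm Γ tN) : form Γ := t ≺ u ∨ t ≐ u.
Notation "t ⪯ u" := (Le t u) (at level 70, no associativity) : fm_scope.

Fixpoint eqT (τ : ty) : forall Γ, tm Γ τ -> tm Γ τ -> form Γ :=
  match τ with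
  | tN => fun _ t u => t ≐ u
  | Arr σ τ => fun _ f g => ∀ x : σ, eqT (↑f · x) (↑g · x)
  end.

(* Substitution into a schematic formula whose parameters live in Γ, the result
   being used in an extension Γ' of Γ. *)
Definition at1 Γ Γ' {e : ext Γ Γ'} σ (A : form (σ :: Γ)) (t : tm Γ' σ) :
    form Γ' :=
  sub_fm A (scons t (fun _ v => Var (@ext_ren _ _ e _ v))).
Definition at2 Γ Γ' {e : ext Γ Γ'} σ τ (A : form (τ :: σ :: Γ))
    (t : tm Γ' σ) (u : tm Γ' τ) : form Γ' :=
  sub_fm A (scons u (scons t (fun _ v => Var (@ext_ren _ _ e _ v)))).

Fixpoint closure (Γ : ctx) : form Γ -> sentence :=
  match Γ with
  | nil => fun A => A
  | τ :: Γ => fun A => closure (All A)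
  end.

Inductive L2_sort : ty -> Prop :=
| L2_s0 : L2_sort tN
| L2_s1 : L2_sort t1.

(* In L_2, + and × only occur applied to two arguments of type 0. *)
Inductive L2_tm Γ : forall τ, tm Γ τ -> Prop :=
| L2_var τ (v : var Γ τ) : L2_sort τ -> L2_tm (Var v)
| L2_zero : L2_tm Zero
| L2_one : L2_tm One
| L2_plus (t u : tm Γ tN) : L2_tm t -> L2_tm u -> L2_tm (t ⊕ u)
| L2_times (t u : tm Γ tN) : L2_tm t -> L2_tm u -> L2_tm (t ⊗ u)
| L2_app (f : tm Γ t1) (t : tm Γ tN) : L2_tm f -> L2_tm t -> L2_tm (f · t).

Fixpoint L2_fm Γ (A : form Γ) : Prop :=
  match A with
  | Eq t u | Lt t u => L2_tm t /\ L2_tm u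
  | Bot => True
  | Imp A B | And A B | Or A B => L2_fm A /\ L2_fm B
  | @All _ τ A | @Ex _ τ A => L2_sort τ /\ L2_fm A
  end.

Fixpoint qfree Γ (A : form Γ) : Prop :=
  match A with
  | Eq _ _ | Lt _ _ | Bot => True
  | Imp A B | And A B | Or A B => qfree A /\ qfree B
  | All _ | Ex _ => False
  end.

Inductive bounded : forall Γ, form Γ -> Prop :=
| bd_eq Γ (t u : tm Γ tN) : bounded (t ≐ u)
| bd_lt Γ (t u : tm Γ tN) : bounded (t ≺ u)
| bd_bot Γ : bounded (@Bot Γ)
| bd_imp Γ (A B : form Γ) : bounded A -> bounded B -> bounded (A ⇒ B)
| bd_and Γ (A B : form Γ) : bounded A -> bounded B -> bounded (A ∧ B)
| bd_or Γ (A B : form Γ) : bounded A -> bounded B -> bounded (A ∨ B)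
| bd_all Γ (t : tm Γ tN) (A : form (tN :: Γ)) :
    bounded A -> bounded (All (Var vz ≺ wk_tm tN t ⇒ A))
| bd_ex Γ (t : tm Γ tN) (A : form (tN :: Γ)) :
    bounded A -> bounded (Ex (Var vz ≺ wk_tm tN t ∧ A)).

Definition Sigma01 Γ (A : form Γ) : Prop :=
  exists B : form (tN :: Γ), L2_fm B /\ bounded B /\ A = Ex B.
Definition Pi01 Γ (A : form Γ) : Prop :=
  exists B : form (tN :: Γ), L2_fm B /\ bounded B /\ A = All B.

Fixpoint numerical Γ (A : form Γ) : Prop :=
  match A with
  | Eq _ _ | Lt _ _ | Bot => True
  | Imp A B | And A B | Or A B => numerical A /\ numerical B
  | @All _ τ A | @Ex _ τ A => τ = tN /\ numerical A
  end.

Definition arithmetical Γ (A : form Γ) : Prop := L2_fm A /\ numerical A.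

Definition Pi11 Γ (A : form Γ) : Prop :=
  exists B : form (t1 :: Γ), arithmetical B /\ A = All B.

(* Classical natural deduction with equality at type 0. All formulas of a
   derivation belong to the fragment L. Axioms may have free variables, for
   which arbitrary terms can be substituted. *)

Definition fragment := forall Γ, form Γ -> Prop.
Definition theory := forall Γ, form Γ -> Prop.

Inductive prv (L : fragment) (T : theory) :
    forall Γ, list (form Γ) -> form Γ -> Prop :=
| p_ax Γ (Δ : list (form Γ)) A : L Γ A -> T Γ A -> prv L T Δ A
| p_hyp Γ (Δ : list (form Γ)) A : L Γ A -> In A Δ -> prv L T Δ A
| p_impI Γ (Δ : list (form Γ)) A B :
    L Γ A -> prv L T (A :: Δ) B -> prv L T Δ (A ⇒ B)
| p_impE Γ (Δ : list (form Γ)) A B :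
    prv L T Δ (A ⇒ B) -> prv L T Δ A -> prv L T Δ B
| p_raa Γ (Δ : list (form Γ)) A :
    L Γ A -> prv L T ((¬ A) :: Δ) Bot -> prv L T Δ A
| p_andI Γ (Δ : list (form Γ)) A B :
    prv L T Δ A -> prv L T Δ B -> prv L T Δ (A ∧ B)
| p_andE1 Γ (Δ : list (form Γ)) A B : prv L T Δ (A ∧ B) -> prv L T Δ A
| p_andE2 Γ (Δ : list (form Γ)) A B : prv L T Δ (A ∧ B) -> prv L T Δ B
| p_orI1 Γ (Δ : list (form Γ)) A B :
    L Γ B -> prv L T Δ A -> prv L T Δ (A ∨ B)
| p_orI2 Γ (Δ : list (form Γ)) A B :
    L Γ A -> prv L T Δ B -> prv L T Δ (A ∨ B)
| p_orE Γ (Δ : list (form Γ)) A B C :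
    prv L T Δ (A ∨ B) -> prv L T (A :: Δ) C -> prv L T (B :: Δ) C ->
    prv L T Δ C
| p_allI Γ (Δ : list (form Γ)) τ (A : form (τ :: Γ)) :
    L Γ (All A) -> prv L T (map (@wk_fm Γ τ) Δ) A -> prv L T Δ (All A)
| p_allE Γ (Δ : list (form Γ)) τ (A : form (τ :: Γ)) (t : tm Γ τ) :
    L Γ (inst A t) -> prv L T Δ (All A) -> prv L T Δ (inst A t)
| p_exI Γ (Δ : list (form Γ)) τ (A : form (τ :: Γ)) (t : tm Γ τ) :
    L Γ (Ex A) -> prv L T Δ (inst A t) -> prv L T Δ (Ex A)
| p_exE Γ (Δ : list (form Γ)) τ (A : form (τ :: Γ)) C :
    prv L T Δ (Ex A) ->
    prv L T (A :: map (@wk_fm Γ τ) Δ) (wk_fm τ C) -> prv L T Δ C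
| p_eqI Γ (Δ : list (form Γ)) (t : tm Γ tN) :
    L Γ (t ≐ t) -> prv L T Δ (t ≐ t)
| p_eqE Γ (Δ : list (form Γ)) (A : form (tN :: Γ)) (t u : tm Γ tN) :
    L Γ (inst A u) -> prv L T Δ (t ≐ u) -> prv L T Δ (inst A t) ->
    prv L T Δ (inst A u).

Definition Lomega : fragment := fun _ _ => True.
Definition L2 : fragment := L2_fm.

(* Provability in L_omega and in L_2, the latter also from extra axioms Δ. *)
Definition proves (T : theory) (A : sentence) : Prop := prv Lomega T nil A.
Definition proves2 (T : theory) (Δ : list sentence) (A : sentence) : Prop :=
  prv L2 T Δ A.

Definition union (T U : theory) : theory := fun Γ A => T Γ A \/ U Γ A.

(* L_2 has function variables. A set is given by its characteristic function,
   so the axioms below are the usual ones for sets plus [ax_graph], by which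
   sets that are graphs of functions yield functions. *)

Definition is_set Γ (X : tm Γ t1) : form Γ := ∀ n : tN, ↑X · n ⪯ One.
Definition mem Γ (n : tm Γ tN) (X : tm Γ t1) : form Γ := X · n ≐ One.
Notation "n ∈ X" := (mem n X) (at level 70, no associativity) : fm_scope.

(* The (injective) pairing (i+j)^2+i *)
Definition npair Γ (i j : tm Γ tN) : tm Γ tN := (i ⊕ j) ⊗ (i ⊕ j) ⊕ i.

Inductive basic_Z2 : theory :=
| z_S0 Γ : @basic_Z2 Γ (∀ n : tN, ¬ n ⊕ One ≐ Zero)
| z_Sinj Γ : @basic_Z2 Γ (∀ m : tN, ∀ n : tN, ↑m ⊕ One ≐ n ⊕ One ⇒ ↑m ≐ n)
| z_add0 Γ : @basic_Z2 Γ (∀ m : tN, m ⊕ Zero ≐ m)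
| z_addS Γ : @basic_Z2 Γ
    (∀ m : tN, ∀ n : tN, ↑m ⊕ (n ⊕ One) ≐ (↑m ⊕ n) ⊕ One)
| z_mul0 Γ : @basic_Z2 Γ (∀ m : tN, m ⊗ Zero ≐ Zero)
| z_mulS Γ : @basic_Z2 Γ
    (∀ m : tN, ∀ n : tN, ↑m ⊗ (n ⊕ One) ≐ ↑m ⊗ n ⊕ ↑m)
| z_lt0 Γ : @basic_Z2 Γ (∀ m : tN, ¬ m ≺ Zero)
| z_ltS Γ : @basic_Z2 Γ
    (∀ m : tN, ∀ n : tN, ↑m ≺ n ⊕ One ⇔ (↑m ≺ n ∨ ↑m ≐ n)).

Definition ind_axiom Γ (A : form (tN :: Γ)) : form Γ :=
  at1 A Zero ⇒ (∀ n : tN, at1 A n ⇒ at1 A (n ⊕ One)) ⇒ ∀ n : tN, at1 A n.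

Definition comprehension Γ (A : form (tN :: Γ)) : form Γ :=
  ∃ X : t1, is_set X ∧ ∀ n : tN, n ∈ ↑X ⇔ at1 A n.

Definition graph Γ : form Γ :=
  ∀ X : t1,
    is_set X ⇒
    (∀ n : tN, ∃ m : tN,
       npair ↑n m ∈ ↑X ∧ ∀ k : tN, npair ↑n k ∈ ↑X ⇒ k ≐ ↑m) ⇒
    ∃ f : t1, ∀ n : tN, npair n (↑f · n) ∈ ↑X.

Inductive RCA0 : theory :=
| ax_basic Γ (A : form Γ) : basic_Z2 A -> RCA0 A
| ax_Sigma01_ind Γ (A : form (tN :: Γ)) : Sigma01 A -> RCA0 (ind_axiom A)
| ax_Delta01_CA Γ (A B : form (tN :: Γ)) :
    Sigma01 A -> Pi01 B ->
    RCA0 ((∀ n : tN, at1 A n ⇔ at1 B n) ⇒ comprehension A)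
| ax_graph Γ : RCA0 (graph Γ).

Inductive arith_CA : theory :=
| ax_arith_CA Γ (A : form (tN :: Γ)) :
    arithmetical A -> arith_CA (comprehension A).

Definition ACA0 : theory := union RCA0 arith_CA.

(* Finite binary sequences are coded bijectively by numbers: the empty sequence
   by 0, and s extended by the bit i by 2s+1+i. *)
Definition snoc Γ (s i : tm Γ tN) : tm Γ tN := Two ⊗ s ⊕ One ⊕ i.

Definition is_tree Γ (T : tm Γ t1) : form Γ :=
  is_set T ∧
  ∀ s : tN, ∀ i : tN, i ⪯ One ⇒ snoc ↑s i ∈ ↑T ⇒ ↑s ∈ ↑T.

Definition infinite Γ (T : tm Γ t1) : form Γ :=
  ∀ n : tN, ∃ s : tN, ↑n ≺ s ∧ s ∈ ↑T.

(* g(n) codes the initial segment of length n of f *)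
Definition initial_segments Γ (f g : tm Γ t1) : form Γ :=
  g · Zero ≐ Zero ∧
  ∀ n : tN, ↑g · (n ⊕ One) ≐ snoc (↑g · n) (↑f · n).

Definition WKL : sentence :=
  ∀ T : t1, is_tree T ⇒ infinite T ⇒
    ∃ f : t1, is_set f ∧
    ∃ g : t1, initial_segments ↑f g ∧ ∀ n : tN, ↑g · n ∈ ↑T.

Inductive basic_omega : theory :=
| s_addA Γ : @basic_omega Γ (∀ x : tN, ∀ y : tN, ∀ z : tN,
    (↑x ⊕ ↑y) ⊕ z ≐ ↑x ⊕ (↑y ⊕ z))
| s_addC Γ : @basic_omega Γ (∀ x : tN, ∀ y : tN, ↑x ⊕ y ≐ y ⊕ ↑x)
| s_add0 Γ : @basic_omega Γ (∀ x : tN, x ⊕ Zero ≐ x)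
| s_mulA Γ : @basic_omega Γ (∀ x : tN, ∀ y : tN, ∀ z : tN,
    (↑x ⊗ ↑y) ⊗ z ≐ ↑x ⊗ (↑y ⊗ z))
| s_mulC Γ : @basic_omega Γ (∀ x : tN, ∀ y : tN, ↑x ⊗ y ≐ y ⊗ ↑x)
| s_mul1 Γ : @basic_omega Γ (∀ x : tN, x ⊗ One ≐ x)
| s_mul0 Γ : @basic_omega Γ (∀ x : tN, x ⊗ Zero ≐ Zero)
| s_mulD Γ : @basic_omega Γ (∀ x : tN, ∀ y : tN, ∀ z : tN,
    ↑x ⊗ (↑y ⊕ z) ≐ ↑x ⊗ ↑y ⊕ ↑x ⊗ z)
| s_irr Γ : @basic_omega Γ (∀ x : tN, ¬ x ≺ x)
| s_trans Γ : @basic_omega Γ (∀ x : tN, ∀ y : tN, ∀ z : tN,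
    ↑x ≺ ↑y ⇒ ↑y ≺ z ⇒ ↑x ≺ z)
| s_total Γ : @basic_omega Γ (∀ x : tN, ∀ y : tN,
    ↑x ≺ y ∨ ↑x ≐ y ∨ y ≺ ↑x)
| s_ltD Γ : @basic_omega Γ (∀ x : tN, ∀ y : tN, ∀ z : tN,
    ↑x ≺ ↑y ⇒ ↑x ⊕ z ≺ ↑y ⊕ z)
| s_ltM Γ : @basic_omega Γ (∀ x : tN, ∀ y : tN, ∀ z : tN,
    Zero ≺ z ⇒ ↑x ≺ ↑y ⇒ ↑x ⊗ z ≺ ↑y ⊗ z)
| s_pos Γ : @basic_omega Γ (∀ x : tN, ¬ x ≺ Zero)
| s_discrete Γ : @basic_omega Γ (∀ x : tN, ∀ y : tN,
    ↑x ≺ y ⊕ One ⇔ ↑x ⪯ y).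

Definition choice Γ (σ τ : ty) (A : form (τ :: σ :: Γ)) : form Γ :=
  (∀ x : σ, ∃ y : τ, at2 A ↑x y) ⇒
  ∃ Y : σ ⟶ τ, ∀ x : σ, at2 A x (↑Y · x).

Inductive QF_AC (σ τ : ty) : theory :=
| ax_QF_AC Γ (A : form (τ :: σ :: Γ)) : qfree A -> QF_AC σ τ (choice A).

Inductive RCA0omega : theory :=
| ax_semiring Γ (A : form Γ) : basic_omega A -> RCA0omega A
| ax_K Γ (σ τ : ty) : @RCA0omega Γ
    (∀ x : σ, ∀ y : τ, eqT (Kc σ τ · ↑x · y) ↑x)
| ax_S Γ (ρ σ τ : ty) : @RCA0omega Γ
    (∀ x : ρ ⟶ σ ⟶ τ, ∀ y : ρ ⟶ σ, ∀ z : ρ,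
       eqT (Sc ρ σ τ · ↑x · ↑y · z) (↑x · z · (↑y · z)))
| ax_R0_0 Γ : @RCA0omega Γ
    (∀ f : t1, ∀ m : tN, R0 · ↑f · m · Zero ≐ m)
| ax_R0_S Γ : @RCA0omega Γ
    (∀ f : t1, ∀ m : tN, ∀ n : tN,
       R0 · ↑f · ↑m · (n ⊕ One) ≐ ↑f · (R0 · ↑f · ↑m · n))
| ax_extensionality Γ (ρ τ : ty) : @RCA0omega Γ
    (∀ x : ρ, ∀ y : ρ, ∀ φ : ρ ⟶ τ,
       eqT ↑x ↑y ⇒ eqT (φ · ↑x) (φ · ↑y))
| ax_QF_ind Γ (A : form (tN :: Γ)) : qfree A -> RCA0omega (ind_axiom A)
| ax_QF_AC10 Γ (A : form Γ) : QF_AC t1 tN A -> RCA0omega A.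

(* A type-1 object x codes the sequence of rationals
   [x](n) = (x(3n) - x(3n+1)) / (x(3n+2) + 1). Rational expressions are handled
   as triples of terms of type 0, (p, m, d) standing for (p - m) / d with
   d > 0. *)

Record rat (Γ : ctx) := Rat { rpos : tm Γ tN; rneg : tm Γ tN; rden : tm Γ tN }.

Definition ratD Γ (q r : rat Γ) : rat Γ :=
  Rat (rpos q ⊗ rden r ⊕ rpos r ⊗ rden q)
      (rneg q ⊗ rden r ⊕ rneg r ⊗ rden q)
      (rden q ⊗ rden r).
Definition ratB Γ (q r : rat Γ) : rat Γ :=
  ratD q (Rat (rneg r) (rpos r) (rden r)).

Definition rat_lt Γ (q r : rat Γ) : form Γ :=
  rpos q ⊗ rden r ⊕ rneg r ⊗ rden q ≺ rpos r ⊗ rden q ⊕ rneg q ⊗ rden r.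
Definition rat_le Γ (q r : rat Γ) : form Γ :=
  rpos q ⊗ rden r ⊕ rneg r ⊗ rden q ⪯ rpos r ⊗ rden q ⊕ rneg q ⊗ rden r.

Definition pow2 Γ (n : tm Γ tN) : tm Γ tN := R0 · (Times · Two) · One · n.
(* 2^-n and 2^(-n+1) *)
Definition eps Γ (n : tm Γ tN) : rat Γ := Rat One Zero (pow2 n).
Definition eps2 Γ (n : tm Γ tN) : rat Γ := Rat Two Zero (pow2 n).

Definition approx Γ (x : tm Γ t1) (n : tm Γ tN) : rat Γ :=
  let n3 := n ⊕ n ⊕ n in
  Rat (x · n3) (x · (n3 ⊕ One)) (x · (n3 ⊕ Two) ⊕ One).

Definition is_real Γ (x : tm Γ t1) : form Γ :=
  ∀ n : tN, ∀ i : tN,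
    rat_lt (ratB (approx ↑x ↑n) (approx ↑x (↑n ⊕ i))) (eps ↑n) ∧
    rat_lt (ratB (approx ↑x (↑n ⊕ i)) (approx ↑x ↑n)) (eps ↑n).

(* Real expressions, with [x ± y](n) = [x](n+1) ± [y](n+1) *)
Inductive rexp (Γ : ctx) : Type :=
| RVar : tm Γ t1 -> rexp Γ
| RZero : rexp Γ
| ROne : rexp Γ
| RAdd : rexp Γ -> rexp Γ -> rexp Γ
| RSub : rexp Γ -> rexp Γ -> rexp Γ.

Arguments RZero {Γ}.
Arguments ROne {Γ}.

Fixpoint rapprox Γ (x : rexp Γ) (n : tm Γ tN) : rat Γ :=
  match x with
  | RVar t => approx t n
  | RZero => Rat Zero Zero One
  | ROne => Rat One Zero One
  | RAdd x y => ratD (rapprox x (n ⊕ One)) (rapprox y (n ⊕ One))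
  | RSub x y => ratB (rapprox x (n ⊕ One)) (rapprox y (n ⊕ One))
  end.

Fixpoint rlift Γ Γ' {e : ext Γ Γ'} (x : rexp Γ) : rexp Γ' :=
  match x with
  | RVar t => RVar ↑t
  | RZero => RZero
  | ROne => ROne
  | RAdd x y => RAdd (rlift x) (rlift y)
  | RSub x y => RSub (rlift x) (rlift y)
  end.

Definition real_le Γ (x y : rexp Γ) : form Γ :=
  ∀ n : tN,
    rat_le (rapprox (rlift x) n) (ratD (rapprox (rlift y) n) (eps2 n)).
Definition real_lt Γ (x y : rexp Γ) : form Γ :=
  ∃ n : tN,
    rat_lt (ratD (rapprox (rlift x) n) (eps2 n)) (rapprox (rlift y) n).
Definition real_eq Γ (x y : rexp Γ) : form Γ :=
  ∀ n : tN,
    rat_le (ratB (rapprox (rlift x) n) (rapprox (rlift y) n)) (eps2 n) ∧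
    rat_le (ratB (rapprox (rlift y) n) (rapprox (rlift x) n)) (eps2 n).

Definition in_unit Γ (x : tm Γ t1) : form Γ :=
  is_real x ∧ real_le RZero (RVar x) ∧ real_le (RVar x) ROne.

Definition in_interval Γ (z : tm Γ t1) (a b : rexp Γ) : form Γ :=
  real_lt a (RVar z) ∧ real_lt (RVar z) b.

Definition in_ball Γ (Ψ : tm Γ (t1 ⟶ t1)) (x z : tm Γ t1) : form Γ :=
  in_interval z (RSub (RVar x) (RVar (Ψ · x))) (RAdd (RVar x) (RVar (Ψ · x))).

Definition pos_real_fun Γ (Ψ : tm Γ (t1 ⟶ t1)) : form Γ :=
  (∀ x : t1, is_real x ⇒
     is_real (↑Ψ · x) ∧ real_lt RZero (RVar (↑Ψ · x))) ∧
  (∀ x : t1, ∀ y : t1, is_real ↑x ⇒ is_real y ⇒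
     real_eq (RVar ↑x) (RVar y) ⇒
     real_eq (RVar (↑Ψ · ↑x)) (RVar (↑Ψ · y))).

Definition E2 : sentence :=
  ∃ φ : t2,
    (∀ f : t1, ↑φ · f ⪯ One) ∧
    ∀ f : t1, (∃ n : tN, ↑f · n ≐ Zero) ⇔ ↑φ · f ≐ Zero.

(* A finite sequence of reals is given by its length k and an object of type
   0 → 1 of which the first k values are used. *)
Definition HBU : sentence :=
  ∀ Ψ : t1 ⟶ t1, pos_real_fun Ψ ⇒
    ∃ k : tN, ∃ y : tN ⟶ t1,
      (∀ i : tN, i ≺ ↑k ⇒ is_real (↑y · i)) ∧
      ∀ x : t1, in_unit x ⇒
        ∃ i : tN, i ≺ ↑k ∧ in_ball ↑Ψ (↑y · i) ↑x.

Definition LIN : sentence :=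
  ∀ Ψ : t1 ⟶ t1, pos_real_fun Ψ ⇒
    ∃ a : tN ⟶ t1, ∃ b : tN ⟶ t1,
      (∀ n : tN, is_real (↑a · n) ∧ is_real (↑b · n)) ∧
      (∀ x : t1, is_real x ⇒
         ∃ n : tN, in_interval ↑x (RVar (↑a · n)) (RVar (↑b · n))) ∧
      ∀ n : tN, ∃ x : t1, is_real x ∧
        ∀ z : t1, is_real z ⇒
          (in_interval z (RVar (↑a · ↑n)) (RVar (↑b · ↑n)) ⇔
           in_ball ↑Ψ ↑x z).

(* Main.v *)
(** By completeness and soundness of the deduction system it suffices to argue in
    an arbitrary extensional model M of RCA0omega. If (exists^2) fails in M, then by
    Grilliot's trick the balls of any Psi around the rationals cover all reals; this
    is a countable subcover with known centres, so LIN holds, and WKL makes finitely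
    many of the balls cover the unit interval. If (exists^2) holds in M, then the
    second-order part of M is a model of ACA0, hence of X, Y and WKL; the centres
    whose existence LIN asserts, and the finite covers that HBU gives for the unit
    intervals between consecutive integers, can be selected by QF-AC^{0,1} once their
    defining property is put in arithmetical form. *)

From HB Require Import structures.
From mathcomp Require Import ssreflect ssrfun ssrbool eqtype ssrnat seq choice order ssralg ssrnum boolp zify ring lra.
From Stdlib Require Import List Cantor.
Require Import Defs.

Set Implicit Arguments.
Unset Strict Implicit.
Unset Printing Implicit Defensive.
Unset Asymmetric Patterns.

Local Open Scope fm_scope.

(** The numbers of a model M may be nonstandard, and its induction axiom covers only quantifier-free
    formulas. Arguments inside M therefore run through the predicates [dec], whose characteristic
    function is an element of M: induction, choice and comprehension apply to these, and under (∃²)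
    they include all arithmetical formulas. Rationals are formed outside M as an ordered field, so
    that estimates become linear arithmetic. LIN yields intervals without their centres. [SLIN],
    which asks for a sequence of centres, is the hub: it gives LIN outright, it gives HBU under WKL,
    and it follows from the failure of (∃²). Under (∃²) it has to be recovered from LIN or HBU by
    QF-AC^{0,1}, whose matrix must not quantify over reals. Inclusion of an interval in a ball is
    therefore tested on rational points, and covering [0,1] is replaced by the combinatorial
    [finite_cover]; WKL, which (∃²) supplies through X, passes from the former to the latter. A
    whole sequence of centres is packed into one object of type 1 so that it can be chosen. *)

(** * Substitution calculus for typed de Bruijn terms *)

Lemma var_case σ Γ (P : forall τ, var (σ :: Γ) τ -> Prop) :
  P σ vz -> (forall τ (v : var Γ τ), P τ (vs σ v)) -> forall τ v, P τ v.
Proof.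
move=> hz hs τ v.
refine (match v as v' in var Δ τ' return
  match Δ return var Δ τ' -> Prop with
  | nil => fun _ => True
  | σ0 :: Γ0 => fun v => forall P : (forall τ, var (σ0 :: Γ0) τ -> Prop),
     P σ0 vz -> (forall τ w, P τ (vs σ0 w)) -> P _ v end v'
  with vz => _ | vs _ _ => _ end P hz hs); by move=> Q.
Qed.

Lemma var_nil (P : forall τ, var nil τ -> Prop) : forall τ v, P τ v.
Proof.
move=> τ v.
by refine (match v as v' in var Δ τ' return
  match Δ return var Δ τ' -> Prop with
  | nil => fun v => P _ v | _ => fun _ => True end v'
  with vz => _ | vs _ _ => _ end).
Qed.

Lemma sub_ext Γ Γ' (s s' : sub Γ Γ') : (forall τ v, s τ v = s' τ v) -> s = s'.
Proof. by move=> h; apply/functional_extensionality_dep => τ; apply/functional_extensionality_dep => v. Qed.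

Definition comp Γ Γ' Γ'' (s : sub Γ Γ') (s' : sub Γ' Γ'') : sub Γ Γ'' :=
  fun τ v => sub_tm s' (s τ v).

Lemma sub_ren Γ Γ' Γ'' (r : ren Γ Γ') (s : sub Γ' Γ'') τ (t : tm Γ τ) :
  sub_tm s (ren_tm r t) = sub_tm (fun τ v => s τ (r τ v)) t.
Proof. by elim: t => //= σ τ' t -> u ->. Qed.

Lemma ren_sub Γ Γ' Γ'' (s : sub Γ Γ') (r : ren Γ' Γ'') τ (t : tm Γ τ) :
  ren_tm r (sub_tm s t) = sub_tm (fun τ v => ren_tm r (s τ v)) t.
Proof. by elim: t => //= σ τ' t -> u ->. Qed.

Lemma sub_sub Γ Γ' Γ'' (s : sub Γ Γ') (s' : sub Γ' Γ'') τ (t : tm Γ τ) :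
  sub_tm s' (sub_tm s t) = sub_tm (comp s s') t.
Proof. by elim: t => //= σ τ' t -> u ->. Qed.

Lemma ren_as_sub Γ Γ' (r : ren Γ Γ') τ (t : tm Γ τ) :
  ren_tm r t = sub_tm (fun τ v => Var (r τ v)) t.
Proof. by elim: t => //= σ τ' t -> u ->. Qed.

Lemma sub_ids Γ τ (t : tm Γ τ) : sub_tm (@ids Γ) t = t.
Proof. by elim: t => //= σ τ' t -> u ->. Qed.

Definition shift Γ σ : sub Γ (σ :: Γ) := fun _ v => Var (vs σ v).

Lemma wk_tmE Γ σ τ (t : tm Γ τ) : wk_tm σ t = sub_tm (@shift Γ σ) t.
Proof. exact: ren_as_sub. Qed.

Lemma scons_comp Γ Γ' Γ'' σ (t : tm Γ' σ) (s : sub Γ Γ') (s' : sub Γ' Γ'') :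
  comp (scons t s) s' = scons (sub_tm s' t) (comp s s').
Proof. by apply: sub_ext; apply: var_case. Qed.

Lemma up_comp Γ Γ' Γ'' σ (s : sub Γ Γ') (s' : sub Γ' Γ'') :
  comp (@up _ _ σ s) (up s') = up (comp s s').
Proof.
apply: sub_ext; apply: var_case => //= τ v.
by rewrite /comp /up /= sub_ren ren_sub.
Qed.

Lemma up_scons Γ Γ' Γ'' σ (s : sub Γ Γ') (t : tm Γ'' σ) (s' : sub Γ' Γ'') :
  comp (@up _ _ σ s) (scons t s') = scons t (comp s s').
Proof.
apply: sub_ext; apply: var_case => //= τ v.
by rewrite /comp /up /= sub_ren.
Qed.

Lemma shift_scons Γ Γ' σ (t : tm Γ' σ) (s : sub Γ Γ') :
  comp (@shift Γ σ) (scons t s) = s.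
Proof. by apply: sub_ext. Qed.

Lemma comp_ids Γ Γ' (s : sub Γ Γ') : comp s (@ids Γ') = s.
Proof. by apply: sub_ext => τ v; rewrite /comp sub_ids. Qed.

Lemma up_ids Γ σ : up (@ids Γ) = @ids (σ :: Γ).
Proof. by apply: sub_ext; apply: var_case. Qed.

Lemma sub_fm_comp Γ (A : form Γ) : forall Γ' Γ'' (s : sub Γ Γ') (s' : sub Γ' Γ''),
  sub_fm (sub_fm A s) s' = sub_fm A (comp s s').
Proof.
elim: A => //= {Γ}.
- by move=> Γ t u Γ' Γ'' s s'; rewrite !sub_sub.
- by move=> Γ t u Γ' Γ'' s s'; rewrite !sub_sub.
- by move=> Γ A IA B IB Γ' Γ'' s s'; rewrite IA IB.
- by move=> Γ A IA B IB Γ' Γ'' s s'; rewrite IA IB.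
- by move=> Γ A IA B IB Γ' Γ'' s s'; rewrite IA IB.
- by move=> Γ τ A IA Γ' Γ'' s s'; rewrite IA up_comp.
- by move=> Γ τ A IA Γ' Γ'' s s'; rewrite IA up_comp.
Qed.

Lemma sub_fm_ids Γ (A : form Γ) : sub_fm A (@ids Γ) = A.
Proof.
elim: A => //= {Γ}.
- by move=> Γ t u; rewrite !sub_ids.
- by move=> Γ t u; rewrite !sub_ids.
- by move=> Γ A -> B ->.
- by move=> Γ A -> B ->.
- by move=> Γ A -> B ->.
- by move=> Γ τ A IA; rewrite up_ids IA.
- by move=> Γ τ A IA; rewrite up_ids IA.
Qed.

(** The form in which quantifier rules meet environments: instantiating a body whose outer variables
    are already replaced amounts to a single extended substitution. *)
Lemma sub_fm_inst Γ Γ' σ (A : form (σ :: Γ)) (s : sub Γ Γ') (t : tm Γ' σ) :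
  inst (sub_fm A (up s)) t = sub_fm A (scons t s).
Proof. by rewrite /inst sub_fm_comp up_scons comp_ids. Qed.

Lemma sub_lift1 Γ Γ' σ τ (s : sub Γ Γ') (t : tm Γ τ) :
  sub_tm (@up _ _ σ s) (lift t) = lift (sub_tm s t).
Proof. by rewrite /lift sub_ren ren_sub. Qed.

Lemma sub_eqT τ : forall Γ Γ' (t u : tm Γ τ) (s : sub Γ Γ'),
  sub_fm (eqT t u) s = eqT (sub_tm s t) (sub_tm s u).
Proof.
elim: τ => //= σ _ τ IH Γ Γ' t u s.
by rewrite /fall /= IH /= !sub_lift1.
Qed.

(** * Extensional structures *)

(** Numbers may be nonstandard and function domains need not be full. Extensionality is part of the
    notion, so that the defined equality [eqT] means Leibniz equality at every type. *)
Record structure := Structure {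
  dom : ty -> Type;
  app : forall σ τ, dom (σ ⟶ τ) -> dom σ -> dom τ;
  zeroM : dom tN;
  oneM : dom tN;
  plusM : dom (tN ⟶ tN ⟶ tN);
  timesM : dom (tN ⟶ tN ⟶ tN);
  KM : forall σ τ, dom (σ ⟶ τ ⟶ σ);
  SM : forall ρ σ τ, dom ((ρ ⟶ σ ⟶ τ) ⟶ (ρ ⟶ σ) ⟶ ρ ⟶ τ);
  RM : dom ((tN ⟶ tN) ⟶ tN ⟶ tN ⟶ tN);
  ltM : dom tN -> dom tN -> Prop;
  app_ext : forall σ τ (f g : dom (σ ⟶ τ)),
    (forall x, app f x = app g x) -> f = g }.

Arguments app {s σ τ}.
Arguments zeroM {s}.
Arguments oneM {s}.
Arguments plusM {s}.
Arguments timesM {s}.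
Arguments KM {s}.
Arguments SM {s}.
Arguments RM {s}.
Arguments ltM {s}.

Section Semantics.
Variable M : structure.

(** Nested pairs rather than functions on indices: [sat] of a concrete sentence then unfolds by
    conversion to a statement about the domains. *)
Fixpoint env (Γ : ctx) : Type :=
  match Γ with nil => unit | τ :: Γ => (dom M τ * env Γ)%type end.

Fixpoint look Γ τ (v : var Γ τ) : env Γ -> dom M τ :=
  match v in var Γ τ return env Γ -> dom M τ with
  | vz => fun ρ => fst ρ
  | vs _ w => fun ρ => look w (snd ρ)
  end.

Fixpoint tab Γ : (forall τ, var Γ τ -> dom M τ) -> env Γ :=
  match Γ with
  | nil => fun _ => tt
  | τ :: Γ => fun f => (f τ vz, tab (fun τ v => f τ (vs _ v)))
  end.

Lemma look_tab Γ τ (v : var Γ τ) f : look v (tab f) = f τ v.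
Proof. by elim: v f => {Γ τ} //= Γ σ τ v IH f; rewrite IH. Qed.

Lemma env_ext Γ (ρ ρ' : env Γ) :
  (forall τ (v : var Γ τ), look v ρ = look v ρ') -> ρ = ρ'.
Proof.
elim: Γ ρ ρ' => [[] []//|σ Γ IH [x ρ] [y ρ'] h].
congr pair; first exact: (h σ vz).
by apply: IH => τ v; exact: (h τ (vs σ v)).
Qed.

Fixpoint eval Γ τ (t : tm Γ τ) (ρ : env Γ) : dom M τ :=
  match t with
  | Var v => look v ρ
  | Zero => zeroM
  | One => oneM
  | Plus => plusM
  | Times => timesM
  | Kc σ τ => KM σ τ
  | Sc ρ σ τ => SM ρ σ τ
  | R0 => RM
  | App t u => app (eval t ρ) (eval u ρ)
  end.

Fixpoint sat Γ (A : form Γ) : env Γ -> Prop :=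
  match A with
  | Eq t u => fun ρ => eval t ρ = eval u ρ
  | Lt t u => fun ρ => ltM (eval t ρ) (eval u ρ)
  | Bot => fun _ => False
  | Imp A B => fun ρ => sat A ρ -> sat B ρ
  | And A B => fun ρ => sat A ρ /\ sat B ρ
  | Or A B => fun ρ => sat A ρ \/ sat B ρ
  | All A => fun ρ => forall x, sat A (x, ρ)
  | Ex A => fun ρ => exists x, sat A (x, ρ)
  end.

Definition sub_env Γ Γ' (s : sub Γ Γ') (ρ : env Γ') : env Γ :=
  tab (fun τ v => eval (s τ v) ρ).

Lemma eval_ren Γ Γ' (r : ren Γ Γ') τ (t : tm Γ τ) ρ :
  eval (ren_tm r t) ρ = eval t (tab (fun τ v => look (r τ v) ρ)).
Proof.
elim: t => //= [τ' v|σ τ' t IHt u IHu]; first by rewrite look_tab.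
by rewrite IHt IHu.
Qed.

Lemma tab_look Γ (ρ : env Γ) : tab (fun τ v => look v ρ) = ρ.
Proof. by apply: env_ext => τ v; rewrite look_tab. Qed.

Lemma eval_wk Γ σ τ (t : tm Γ τ) (x : dom M σ) (ρ : env Γ) :
  eval (ren_tm (fun τ v => vs σ v) t) (x, ρ) = eval t ρ.
Proof. by rewrite eval_ren /= tab_look. Qed.

Lemma eval_sub Γ Γ' (s : sub Γ Γ') τ (t : tm Γ τ) ρ :
  eval (sub_tm s t) ρ = eval t (sub_env s ρ).
Proof.
elim: t => //= [τ' v|σ τ' t IHt u IHu]; first by rewrite look_tab.
by rewrite IHt IHu.
Qed.

Lemma sub_env_up Γ Γ' σ (s : sub Γ Γ') x (ρ : env Γ') :
  sub_env (@up _ _ σ s) (x, ρ) = (x, sub_env s ρ).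
Proof.
rewrite /sub_env /=; congr pair; apply: env_ext => τ v.
by rewrite !look_tab /up /= eval_wk.
Qed.

Lemma sub_env_scons Γ Γ' σ (t : tm Γ' σ) (s : sub Γ Γ') (ρ : env Γ') :
  sub_env (scons t s) ρ = (eval t ρ, sub_env s ρ).
Proof. by []. Qed.

Lemma sat_sub Γ (A : form Γ) : forall Γ' (s : sub Γ Γ') (ρ : env Γ'),
  sat (sub_fm A s) ρ = sat A (sub_env s ρ).
Proof.
elim: A => {Γ} //=.
- by move=> Γ t u Γ' s ρ; rewrite !eval_sub.
- by move=> Γ t u Γ' s ρ; rewrite !eval_sub.
- by move=> Γ A IA B IB Γ' s ρ; rewrite IA IB.
- by move=> Γ A IA B IB Γ' s ρ; rewrite IA IB.
- by move=> Γ A IA B IB Γ' s ρ; rewrite IA IB.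
- move=> Γ τ A IA Γ' s ρ; apply: propext.
  by split=> h x; have := h x; rewrite IA sub_env_up.
- move=> Γ τ A IA Γ' s ρ; apply: propext.
  by split=> -[x h]; exists x; move: h; rewrite IA sub_env_up.
Qed.

Lemma sub_env_ids Γ (ρ : env Γ) : sub_env (@ids Γ) ρ = ρ.
Proof. exact: tab_look. Qed.

Lemma sub_env_shift Γ σ (x : dom M σ) (ρ : env Γ) :
  sub_env (fun _ v => Var (vs σ v)) (x, ρ) = ρ.
Proof. exact: tab_look. Qed.

Lemma sat_wk Γ σ (A : form Γ) (x : dom M σ) (ρ : env Γ) :
  sat (wk_fm σ A) (x, ρ) = sat A ρ.
Proof. by rewrite sat_sub sub_env_shift. Qed.

Lemma sat_inst Γ σ (A : form (σ :: Γ)) (t : tm Γ σ) (ρ : env Γ) :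
  sat (inst A t) ρ = sat A (eval t ρ, ρ).
Proof. by rewrite sat_sub sub_env_scons sub_env_ids. Qed.

Lemma eval_lift1 Γ σ τ (t : tm Γ τ) (x : dom M σ) (ρ : env Γ) :
  eval (lift (Γ' := σ :: Γ) t) (x, ρ) = eval t ρ.
Proof. exact: eval_wk. Qed.

Lemma sat_eqT τ : forall Γ (t u : tm Γ τ) (ρ : env Γ),
  sat (eqT t u) ρ <-> eval t ρ = eval u ρ.
Proof.
elim: τ => //= σ _ τ IH Γ t u ρ; split.
  move=> h; apply: app_ext => x.
  by have /IH := h x; rewrite /= !eval_lift1.
by move=> h x; apply/IH; rewrite /= !eval_lift1 h.
Qed.

Definition models (T : theory) :=
  forall Γ (A : form Γ), T Γ A -> forall ρ, sat A ρ.

Theorem soundness (L : fragment) (T : theory) Γ (Δ : list (form Γ)) A :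
  (forall Γ (A : form Γ), L Γ A -> T Γ A -> forall ρ, sat A ρ) ->
  prv L T Δ A -> forall ρ, (forall B, In B Δ -> sat B ρ) -> sat A ρ.
Proof.
move=> HT; elim=> {Γ Δ A} /=.
- by move=> Γ Δ A hL hT ρ _; exact: HT.
- by move=> Γ Δ A _ hA ρ; apply.
- move=> Γ Δ A B _ _ IH ρ h hA; apply: IH => C /= [<-//|]; exact: h.
- by move=> Γ Δ A B _ IH _ IH' ρ h; apply: IH => //; apply: IH'.
- move=> Γ Δ A _ _ IH ρ h; apply: contrapT => nA.
  by apply: (IH ρ) => C /= [<-//|]; exact: h.
- by move=> Γ Δ A B _ IH _ IH' ρ h; split; [apply: IH|apply: IH'].
- by move=> Γ Δ A B _ IH ρ h; case: (IH ρ h).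
- by move=> Γ Δ A B _ IH ρ h; case: (IH ρ h).
- by move=> Γ Δ A B _ _ IH ρ h; left; apply: IH.
- by move=> Γ Δ A B _ _ IH ρ h; right; apply: IH.
- move=> Γ Δ A B C _ IH _ IA _ IB ρ h; case: (IH ρ h) => hh.
    by apply: IA => D /= [<-//|]; exact: h.
  by apply: IB => D /= [<-//|]; exact: h.
- move=> Γ Δ τ A _ _ IH ρ h x; apply: IH => B /in_map_iff [C [<- hC]].
  by rewrite sat_wk; apply: h.
- by move=> Γ Δ τ A t _ _ IH ρ h; rewrite sat_inst; apply: (IH ρ h).
- by move=> Γ Δ τ A t _ _ IH ρ h; have := IH ρ h; rewrite sat_inst; exists (eval t ρ).
- move=> Γ Δ τ A C _ IH _ IH' ρ h; case: (IH ρ h) => x hx.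
  rewrite -(sat_wk C x); apply: IH' => B /= [<-//|/in_map_iff [D [<- hD]]].
  by rewrite sat_wk; apply: h.
- by [].
- move=> Γ Δ A t u _ _ IH _ IH' ρ h; have := IH' ρ h.
  by rewrite !sat_inst (IH ρ h).
Qed.

End Semantics.
Arguments tab {M Γ}.

(** * Completeness *)

Section Enumeration.

Definition ty_eq_dec (σ τ : ty) : {σ = τ} + {σ <> τ}.
Proof. by decide equality. Defined.

Definition cast σ τ (e : σ = τ) Γ (t : tm Γ σ) : tm Γ τ :=
  match e in _ = τ return tm Γ τ with erefl => t end.

Lemma ty_eq_dec_refl σ : ty_eq_dec σ σ = left erefl.
Proof.
case: (ty_eq_dec σ σ) => // e; congr left.
exact: (Eqdep_dec.UIP_dec ty_eq_dec).
Qed.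

Fixpoint tys n : list ty :=
  match n with
  | 0 => nil
  | S n => tN :: List.map (fun p => Arr p.1 p.2) (list_prod (tys n) (tys n))
  end.

(** Eventual truth serves twice: for enumerations by finite lists of growing depth, and for terms
    over a growing context, which matter only from some stage on. Finitely many such conditions can
    be met at one stage. *)
Definition ev (P : nat -> Prop) := exists N, forall n, (N <= n)%nat -> P n.

Lemma ev_and P Q : ev P -> ev Q -> ev (fun n => P n /\ Q n).
Proof.
move=> [N1 h1] [N2 h2]; exists (maxn N1 N2) => n hn.
by split; [apply: h1|apply: h2]; lia.
Qed.

Lemma ev_imp (P Q : nat -> Prop) : (forall n, P n -> Q n) -> ev P -> ev Q.
Proof. by move=> h [N hN]; exists N => n /hN; apply: h. Qed.

Lemma ev_S (P : nat -> Prop) : ev (fun n => P (S n)) -> ev P.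
Proof. by move=> [N h]; exists (S N) => -[|n] hn; [lia|apply: h; lia]. Qed.

Lemma ev_ge N : ev (fun n => N <= n)%nat.
Proof. by exists N. Qed.

Lemma ev_all P : (forall n, P n) -> ev P.
Proof. by exists 0. Qed.

Lemma tysP τ : ev (fun n => In τ (tys n)).
Proof.
apply: ev_S; elim: τ => [|σ IHσ τ IHτ]; first by exists 0 => n _; left.
have {IHσ IHτ}[N h] := ev_and IHσ IHτ; exists (S N) => -[|n] hn; first lia.
case: (h n _) => [|h1 h2]; first lia.
by right; apply/in_map_iff; exists (σ, τ); split => //; apply/in_prod.
Qed.

Notation atm Γ := {τ & tm Γ τ}.

Fixpoint avars Γ : list {τ & var Γ τ} :=
  match Γ with
  | nil => nil
  | σ :: Γ => existT _ σ vz :: List.map (fun p => existT _ (projT1 p) (vs σ (projT2 p))) (avars Γ)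
  end.

Lemma avarsP Γ τ (v : var Γ τ) : In (existT _ τ v) (avars Γ).
Proof.
elim: v => {Γ τ} [Γ τ|Γ σ τ v IH]; first by left.
by right; apply/in_map_iff; exists (existT _ τ v).
Qed.

Definition mkapp Γ (p q : atm Γ) : list (atm Γ) :=
  match p with
  | existT _ (Arr σ τ) f =>
    match ty_eq_dec (projT1 q) σ with
    | left e => [:: existT _ τ (App f (cast e (projT2 q)))]
    | right _ => nil
    end
  | _ => nil
  end.

Fixpoint tms Γ n : list (atm Γ) :=
  match n with
  | 0 => nil
  | S n =>
    List.map (fun p => existT _ (projT1 p) (Var (projT2 p))) (avars Γ) ++
    [:: existT _ _ Zero; existT _ _ One; existT _ _ Plus; existT _ _ Times; existT _ _ R0] ++
    List.map (fun p => existT _ _ (Kc p.1 p.2)) (list_prod (tys n) (tys n)) ++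
    List.map (fun p => existT _ _ (Sc p.1.1 p.1.2 p.2)) (list_prod (list_prod (tys n) (tys n)) (tys n)) ++
    flat_map (fun p => mkapp p.1 p.2) (list_prod (tms Γ n) (tms Γ n))
  end%list.

Lemma tmsP Γ τ (t : tm Γ τ) : ev (fun n => In (existT _ τ t) (tms Γ n)).
Proof.
elim: t => {τ}.
- move=> τ v; apply: ev_S; apply: ev_all => n /=; apply/in_app_iff; left; apply/in_map_iff.
  by exists (existT _ τ v); split=> //; exact: avarsP.
- by apply: ev_S; apply: ev_all => n /=; apply/in_app_iff; right; left.
- by apply: ev_S; apply: ev_all => n /=; apply/in_app_iff; right; right; left.
- by apply: ev_S; apply: ev_all => n /=; apply/in_app_iff; right; do 2 right; left.
- by apply: ev_S; apply: ev_all => n /=; apply/in_app_iff; right; do 3 right; left.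
- move=> σ τ; apply: ev_S; apply: ev_imp (ev_and (tysP σ) (tysP τ)) => n /= [h1 h2].
  apply/in_app_iff; right; do 5 right; apply/in_app_iff; left; apply/in_map_iff.
  by exists (σ, τ); split=> //; apply/in_prod.
- move=> ρ σ τ; apply: ev_S; apply: ev_imp (ev_and (tysP ρ) (ev_and (tysP σ) (tysP τ))) => n /= [h1 [h2 h3]].
  apply/in_app_iff; right; do 5 right; apply/in_app_iff; right; apply/in_app_iff; left.
  apply/in_map_iff.
  by exists ((ρ, σ), τ); split=> //; apply/in_prod => //; apply/in_prod.
- by apply: ev_S; apply: ev_all => n /=; apply/in_app_iff; right; do 4 right; left.
move=> σ τ t IHt u IHu.
apply: ev_S; have := ev_and IHt IHu; apply: ev_imp => n /= [h1 h2].
apply/in_app_iff; right; do 5 right; do 2 (apply/in_app_iff; right).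
apply/in_flat_map; exists (existT _ _ t, existT _ _ u); split; first exact/in_prod.
by rewrite /mkapp /= ty_eq_dec_refl /=; left.
Qed.

Definition natural Γ (p : atm Γ) : list (tm Γ tN) :=
  match p with existT _ tN t => [:: t] | _ => nil end.

Definition ntms Γ n := flat_map (@natural Γ) (tms Γ n).

Lemma ntmsP Γ (t : tm Γ tN) : ev (fun n => In t (ntms Γ n)).
Proof.
apply: ev_imp (tmsP t) => n h; apply/in_flat_map; exists (existT _ _ t).
by split => //; left.
Qed.

Fixpoint fms n Γ : list (form Γ) :=
  match n with
  | 0 => nil
  | S n =>
    [:: Bot] ++
    List.map (fun p => Eq p.1 p.2) (list_prod (ntms Γ n) (ntms Γ n)) ++
    List.map (fun p => Lt p.1 p.2) (list_prod (ntms Γ n) (ntms Γ n)) ++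
    List.map (fun p => Imp p.1 p.2) (list_prod (fms n Γ) (fms n Γ)) ++
    List.map (fun p => And p.1 p.2) (list_prod (fms n Γ) (fms n Γ)) ++
    List.map (fun p => Or p.1 p.2) (list_prod (fms n Γ) (fms n Γ)) ++
    flat_map (fun τ => List.map (@All Γ τ) (fms n (τ :: Γ))) (tys n) ++
    flat_map (fun τ => List.map (@Ex Γ τ) (fms n (τ :: Γ))) (tys n)
  end%list.

Lemma fmsP Γ (A : form Γ) : ev (fun n => In A (fms n Γ)).
Proof.
elim: A => {Γ}.
- move=> Γ t u; apply: ev_S; apply: ev_imp (ev_and (ntmsP t) (ntmsP u)) => n /= [h1 h2].
  right; apply/in_app_iff; left.
  by apply/in_map_iff; exists (t, u); split=> //; apply/in_prod.
- move=> Γ t u; apply: ev_S; apply: ev_imp (ev_and (ntmsP t) (ntmsP u)) => n /= [h1 h2].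
  right; do 1 (apply/in_app_iff; right); apply/in_app_iff; left.
  by apply/in_map_iff; exists (t, u); split=> //; apply/in_prod.
- by move=> Γ; apply: ev_S; apply: ev_all => n /=; left.
- move=> Γ A IA B IB; apply: ev_S; have := ev_and IA IB; apply: ev_imp => n /= [h1 h2].
  right; do 2 (apply/in_app_iff; right); apply/in_app_iff; left.
  by apply/in_map_iff; exists (A, B); split=> //; apply/in_prod.
- move=> Γ A IA B IB; apply: ev_S; have := ev_and IA IB; apply: ev_imp => n /= [h1 h2].
  right; do 3 (apply/in_app_iff; right); apply/in_app_iff; left.
  by apply/in_map_iff; exists (A, B); split=> //; apply/in_prod.
- move=> Γ A IA B IB; apply: ev_S; have := ev_and IA IB; apply: ev_imp => n /= [h1 h2].
  right; do 4 (apply/in_app_iff; right); apply/in_app_iff; left.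
  by apply/in_map_iff; exists (A, B); split=> //; apply/in_prod.
- move=> Γ τ A IA; apply: ev_S; have := ev_and (tysP τ) IA; apply: ev_imp => n /= [h1 h2].
  right; do 5 (apply/in_app_iff; right); apply/in_app_iff; left.
  by apply/in_flat_map; exists τ; split=> //; apply/in_map_iff; exists A.
- move=> Γ τ A IA; apply: ev_S; have := ev_and (tysP τ) IA; apply: ev_imp => n /= [h1 h2].
  right; do 6 (apply/in_app_iff; right).
  by apply/in_flat_map; exists τ; split=> //; apply/in_map_iff; exists A.
Qed.

End Enumeration.

(** * Maximal consistent sets of formulas *)

(** The context may be empty, so inhabitants of all types have to be closed terms: the constantly
    zero functionals. *)
Fixpoint closed_term Γ (τ : ty) : tm Γ τ :=
  match τ with
  | tN => Zero
  | Arr σ τ => Kc τ σ · closed_term Γ τ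
  end.

Lemma prv_weaken L T Γ (Δ Δ' : list (form Γ)) A :
  prv L T Δ A -> incl Δ Δ' -> prv L T Δ' A.
Proof.
move=> h; elim: h Δ' => {Γ Δ A}.
- by move=> *; apply: p_ax.
- by move=> Γ Δ A hL hA Δ' hi; apply: p_hyp => //; apply: hi.
- move=> Γ Δ A B hL _ IH Δ' hi; apply: p_impI => //; apply: IH.
  by move=> C /= [|/hi]; [left|right].
- by move=> Γ Δ A B _ IH _ IH' Δ' hi; apply: p_impE (IH _ hi) (IH' _ hi).
- move=> Γ Δ A hL _ IH Δ' hi; apply: p_raa => //; apply: IH.
  by move=> C /= [|/hi]; [left|right].
- by move=> Γ Δ A B _ IH _ IH' Δ' hi; apply: p_andI (IH _ hi) (IH' _ hi).
- by move=> Γ Δ A B _ IH Δ' hi; apply: p_andE1 (IH _ hi).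
- by move=> Γ Δ A B _ IH Δ' hi; apply: p_andE2 (IH _ hi).
- by move=> Γ Δ A B hL _ IH Δ' hi; apply: p_orI1 => //; apply: IH.
- by move=> Γ Δ A B hL _ IH Δ' hi; apply: p_orI2 => //; apply: IH.
- move=> Γ Δ A B C _ IH _ IA _ IB Δ' hi; apply: p_orE (IH _ hi) _ _.
    by apply: IA => D /= [|/hi]; [left|right].
  by apply: IB => D /= [|/hi]; [left|right].
- move=> Γ Δ τ A hL _ IH Δ' hi; apply: p_allI => //; apply: IH.
  exact: incl_map.
- by move=> Γ Δ τ A t hL _ IH Δ' hi; apply: p_allE => //; apply: IH.
- by move=> Γ Δ τ A t hL _ IH Δ' hi; apply: (p_exI (t := t)) => //; apply: IH.
- move=> Γ Δ τ A C _ IH _ IH' Δ' hi; apply: p_exE (IH _ hi) _.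
  apply: IH' => D /= [|h]; [by left|right].
  exact: (incl_map _ hi).
- by move=> *; apply: p_eqI.
- by move=> Γ Δ A t u hL _ IH _ IH' Δ' hi; apply: p_eqE (IH _ hi) (IH' _ hi).
Qed.

Section Lindenbaum.
Variable T : theory.

Notation "Δ ⊢ A" := (prv Lomega T Δ A) (at level 99).

Definition Con Γ (P : form Γ -> Prop) :=
  ~ exists2 Δ, (forall A, In A Δ -> P A) & Δ ⊢ Bot.

Record mcs Γ (S : form Γ -> Prop) := Mcs {
  mcs_con : Con S;
  mcs_max : forall A, S A \/ S (¬ A) }.

Definition enum Γ n : form Γ :=
  let: (k, i) := Cantor.of_nat n in List.nth i (fms k Γ) Bot.

Lemma enumP Γ (A : form Γ) : exists n, enum Γ n = A.
Proof.
have [N /(_ N (leqnn N))] := fmsP A => /(In_nth _ _ Bot) [i [_ hi]].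
by exists (Cantor.to_nat (N, i)); rewrite /enum Cantor.cancel_of_to.
Qed.

Section One.
Variables (Γ : ctx) (P : form Γ -> Prop).
Hypothesis conP : Con P.

Fixpoint stage k (A : form Γ) : Prop :=
  match k with
  | 0 => P A
  | S k => stage k A \/ (A = enum Γ k /\ Con (fun B => stage k B \/ B = enum Γ k))
  end.

Definition Lind A := exists k, stage k A.

Lemma stage_mono k l A : (k <= l)%nat -> stage k A -> stage l A.
Proof.
elim: l => [|l IH] hk h; first by have <- : k = 0 by lia.
case: (ltnP l k) => hlk; first by have <- : k = l.+1 by lia.
by left; apply: IH.
Qed.

Lemma stage_con k : Con (stage k).
Proof.
elim: k => [//|k IH] [Δ hΔ hp].
case: (pselect (Con (fun B => stage k B \/ B = enum Γ k))) => hc.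
  by apply: hc; exists Δ => // A /hΔ /= [|[]]; [left|right].
by apply: IH; exists Δ => // A /hΔ /= [|[]].
Qed.

Lemma Lind_list Δ : (forall A, In A Δ -> Lind A) ->
  exists k, forall A, In A Δ -> stage k A.
Proof.
elim: Δ => [|A Δ IH] h; first by exists 0.
have [k hk] := IH (fun B hB => h B (or_intror hB)).
have [l hl] := h A (or_introl erefl).
exists (maxn k l) => B /= [<-|/hk hB]; [apply: stage_mono hl; lia|apply: stage_mono hB; lia].
Qed.

Lemma split_list Δ (S : form Γ -> Prop) A : (forall B, In B Δ -> S B \/ B = A) ->
  exists2 Δ', (forall B, In B Δ' -> S B) & incl Δ (A :: Δ').
Proof.
elim: Δ => [|B Δ IH] h; first by exists nil.
have [Δ' h1 h2] := IH (fun C hC => h C (or_intror hC)).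
case: (h B (or_introl erefl)) => hB.
  exists (B :: Δ') => [C /= [<-//|/h1//]|C /= [<-|/h2 /=[]]]; by intuition.
by exists Δ' => // C /= [<-|/h2//]; left.
Qed.

Lemma Lind_con : Con Lind.
Proof. by move=> [Δ /Lind_list [k hk] h]; apply: (@stage_con k); exists Δ. Qed.

Lemma Lind_refuted A : ~ Lind A ->
  exists2 Δ, (forall B, In B Δ -> Lind B) & A :: Δ ⊢ Bot.
Proof.
move=> hA; have [k hk] := enumP A.
have : ~ Con (fun B => stage k B \/ B = enum Γ k).
  by move=> hc; apply: hA; exists k.+1; right; rewrite hk in hc *.
move=> /contrapT [Δ /split_list [Δ' h1 h2] h]; exists Δ'.
  by move=> B /h1; exists k.
by apply: prv_weaken h _; rewrite -hk.
Qed.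

(** If both A and ¬A had been refused, each would be refuted from finitely many accepted formulas;
    the first refutation proves ¬A, the second proves A by reductio. *)
Lemma Lind_mcs : mcs Lind.
Proof.
split; first exact: Lind_con.
move=> A; apply: contrapT => /not_orP [/Lind_refuted [Δ h1 h2] /Lind_refuted [Δ' h3 h4]].
apply: Lind_con; exists (Δ ++ Δ')%list => [B /in_app_iff [/h1//|/h3//]|].
have hn : (Δ ++ Δ')%list ⊢ ¬ A.
  by apply: p_impI => //; apply: prv_weaken h2 _ => B /= [|h]; [left|right; apply/in_app_iff; left].
have ha : (Δ ++ Δ')%list ⊢ A.
  by apply: p_raa => //; apply: prv_weaken h4 _ => B /= [|h]; [left|right; apply/in_app_iff; right].
exact: p_impE hn ha.
Qed.

Lemma Lind_sub A : P A -> Lind A.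
Proof. by exists 0. Qed.

End One.

Section McsTheory.
Variables (Γ : ctx) (S : form Γ -> Prop).
Hypothesis hS : mcs S.

Lemma mcs_closed Δ A : (forall B, In B Δ -> S B) -> Δ ⊢ A -> S A.
Proof.
move=> hΔ h; case: (mcs_max hS A) => // hn; exfalso; apply: (mcs_con hS).
exists ((¬ A) :: Δ) => [B /= [<-//|/hΔ//]|].
apply: (@p_impE _ _ _ _ A); first by apply: p_hyp => //; left.
by apply: prv_weaken h _ => B; right.
Qed.

Lemma mcs_bot : ~ S Bot.
Proof. by move=> h; apply: (mcs_con hS); exists [:: Bot] => [B /= [<-|]//|]; apply: p_hyp => //; left. Qed.

Lemma mcs_not A : S (¬ A) <-> ~ S A.
Proof.
split=> [hn h|h]; last by case: (mcs_max hS A).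
apply: mcs_bot; apply: (@mcs_closed [:: ¬ A; A]) => [B /= [<-//|[<-//|//]]|].
by apply: (@p_impE _ _ _ _ A); apply: p_hyp => //=; auto.
Qed.

Lemma mcs_imp A B : S (A ⇒ B) <-> (S A -> S B).
Proof.
split=> [h hA|h].
  apply: (@mcs_closed [:: A ⇒ B; A]) => [C /= [<-//|[<-//|//]]|].
  by apply: (@p_impE _ _ _ _ A); apply: p_hyp => //=; auto.
case: (pselect (S A)) => [/h hB|/mcs_not hA].
  apply: (@mcs_closed [:: B]) => [C /= [<-//|//]|].
  by apply: p_impI => //; apply: p_hyp => //=; auto.
apply: (@mcs_closed [:: ¬ A]) => [C /= [<-//|//]|].
apply: p_impI => //; apply: p_raa => //.
by apply: (@p_impE _ _ _ _ A); apply: p_hyp => //=; auto.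
Qed.

Lemma mcs_and A B : S (A ∧ B) <-> S A /\ S B.
Proof.
split=> [h|[hA hB]].
  split; apply: (@mcs_closed [:: A ∧ B]) => [C /= [<-//|//]|].
    by apply: (@p_andE1 _ _ _ _ A B); apply: p_hyp => //=; auto.
  by apply: (@p_andE2 _ _ _ _ A B); apply: p_hyp => //=; auto.
apply: (@mcs_closed [:: A; B]) => [C /= [<-//|[<-//|//]]|].
by apply: p_andI; apply: p_hyp => //=; auto.
Qed.

Lemma mcs_or A B : S (A ∨ B) <-> S A \/ S B.
Proof.
split=> [h|[hA|hB]].
- apply: contrapT => /not_orP [/mcs_not nA /mcs_not nB]; apply: mcs_bot.
  apply: (@mcs_closed [:: A ∨ B; ¬ A; ¬ B]) => [C /= [<-//|[<-//|[<-//|//]]]|].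
  apply: (@p_orE _ _ _ _ A B); first by apply: p_hyp => //=; auto.
    by apply: (@p_impE _ _ _ _ A); apply: p_hyp => //=; auto.
  by apply: (@p_impE _ _ _ _ B); apply: p_hyp => //=; auto 6.
- apply: (@mcs_closed [:: A]) => [C /= [<-//|//]|].
  by apply: p_orI1 => //; apply: p_hyp => //=; auto.
- apply: (@mcs_closed [:: B]) => [C /= [<-//|//]|].
  by apply: p_orI2 => //; apply: p_hyp => //=; auto.
Qed.

Lemma mcs_inst τ (A : form (τ :: Γ)) t : S (All A) -> S (inst A t).
Proof.
move=> h; apply: (@mcs_closed [:: All A]) => [C /= [<-//|//]|].
by apply: p_allE => //; apply: p_hyp => //=; auto.
Qed.

Lemma mcs_exI τ (A : form (τ :: Γ)) t : S (inst A t) -> S (Ex A).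
Proof.
move=> h; apply: (@mcs_closed [:: inst A t]) => [C /= [<-//|//]|].
by apply: (p_exI (t := t)) => //; apply: p_hyp => //=; auto.
Qed.

(** Dual to the witness property: a failing universal statement turns into an existential one, for
    which witnesses are provided. The derivation generalises over the fresh variable, where ¬A would
    contradict ¬∃¬A. *)
Lemma mcs_all τ (A : form (τ :: Γ)) : S (All A) \/ S (Ex (¬ A)).
Proof.
case: (mcs_max hS (Ex (¬ A))) => h; [by right|left].
apply: (@mcs_closed [:: ¬ Ex (¬ A)]) => [C /= [<-//|//]|].
apply: p_allI => //; apply: p_raa => //.
apply: (@p_impE _ _ _ _ (wk_fm τ (Ex (¬ A)))).
  by apply: p_hyp => //; right; left.
apply: (p_exI (t := Var vz)) => //.
(* Weakening under the binder and then instantiating by the newest variable is the identity. *)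
have -> : inst (sub_fm (¬ A) (up (fun τ0 v => Var (vs τ v)))) (Var vz) = ¬ A.
  rewrite sub_fm_inst -[RHS]sub_fm_ids; congr sub_fm.
  by apply: sub_ext; apply: var_case.
by apply: p_hyp => //; left.
Qed.

(** A fresh variable is as good as a Henkin constant. If [Ex B] is in S, a contradiction from B and
    weakened members of S is discharged by ∃-elimination. Otherwise B does not occur, and the fresh
    variable is removed by ∃-elimination from a trivially true statement, whose proof uses that τ is
    inhabited. *)
Lemma Con_witness τ (B : form (τ :: Γ)) :
  Con (fun F => (exists2 G, S G & F = wk_fm τ G) \/ (F = B /\ S (Ex B))).
Proof.
move=> [Δ hΔ h].
have [Δ0 h0 hi] : exists2 Δ0, (forall G, In G Δ0 -> S G)
    & forall F, In F Δ -> In F (List.map (@wk_fm Γ τ) Δ0) \/ (F = B /\ S (Ex B)).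
  elim: Δ hΔ {h} => [|F Δ IH] hΔ; first by exists nil.
  have [Δ0 h1 h2] := IH (fun C hC => hΔ C (or_intror hC)).
  case: (hΔ F (or_introl erefl)) => [[G hG hF]|hF].
    exists (G :: Δ0) => [C /= [<-//|/h1//]|C /= [<-|/h2 []]]; by intuition.
  by exists Δ0 => // C /= [<-|/h2//]; right.
apply: mcs_bot; case: (pselect (S (Ex B))) => hB.
  apply: (@mcs_closed (Ex B :: Δ0)) => [C /= [<-//|/h0//]|].
  apply: (@p_exE _ _ _ _ τ B); first by apply: p_hyp => //; left.
  apply: prv_weaken h _ => F /hi [hF|[-> _]]; last by left.
  by right; right.
apply: (@mcs_closed Δ0) => [//|].
apply: (@p_exE _ _ _ _ τ (Bot ⇒ Bot)).
  apply: (p_exI (t := closed_term _ _)) => //.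
  by apply: p_impI => //; apply: p_hyp => //; left.
apply: prv_weaken h _ => F /hi [hF|[_ //]].
by right.
Qed.

End McsTheory.

End Lindenbaum.

(** * Quotients by equivalence relations *)

Section Quotient.
Variables (T : Type) (R : T -> T -> Prop).
Hypotheses (Rrefl : forall x, R x x) (Rsym : forall x y, R x y -> R y x)
  (Rtrans : forall y x z, R x y -> R y z -> R x z).

(** Classes are predicates, so classes of related elements are Leibniz equal by propositional and
    functional extensionality. Both the term model and the rationals are built this way. *)
Definition quot := {P : T -> Prop | exists x, P = R x}.
Definition cl (x : T) : quot := exist _ (R x) (ex_intro _ x erefl).

Lemma clP x y : cl x = cl y <-> R x y.
Proof.
split=> [/(congr1 sval) /= ->|h]; first exact: Rrefl.
apply: eq_exist => /=; apply/funext => z; apply/propext; split=> h'.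
  exact: Rtrans (Rsym h) h'.
exact: Rtrans h h'.
Qed.

Lemma cl_surj (x : quot) : exists d, cl d = x.
Proof. by case: x => P [d e]; exists d; apply: eq_exist. Qed.

Definition rep (x : quot) : T := projT1 (cid (cl_surj x)).

Lemma repK x : cl (rep x) = x.
Proof. exact: projT2 (cid (cl_surj x)). Qed.

End Quotient.

(** * The term model over a growing chain of contexts *)

Section Henkin.
Variable T : theory.
Hypothesis extT : forall ρ τ, @T nil
    (∀ x : ρ, ∀ y : ρ, ∀ φ : ρ ⟶ τ,
       eqT ↑x ↑y ⇒ eqT (φ · ↑x) (φ · ↑y)).
Variable A0 : sentence.
Hypothesis hA0 : ~ proves T A0.

Notation "Δ ⊢ A" := (prv Lomega T Δ A) (at level 99).

(* Step [n] of the chain decodes [n] as (k, (j, (i, l))): it adds a variable of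
   the [i]-th type of [tys k] as a witness for the [l]-th formula of [fms k],
   over the context of step [j]. *)
Definition dec_k n := (Cantor.of_nat n).1.
Definition dec_j n := (Cantor.of_nat (Cantor.of_nat n).2).1.
Definition dec_i n := (Cantor.of_nat (Cantor.of_nat (Cantor.of_nat n).2).2).1.
Definition dec_l n := (Cantor.of_nat (Cantor.of_nat (Cantor.of_nat n).2).2).2.

Definition ty_at n : ty := List.nth (dec_i n) (tys (dec_k n)) tN.

Fixpoint Gm n : ctx := match n with 0 => nil | S n => ty_at n :: Gm n end.

Definition ids_cast j n (e : j = n) : sub (Gm j) (Gm n) :=
  match e with erefl => @ids _ end.

(** The inclusion of an earlier context in a later one. When j exceeds n it takes closed terms as
    junk values. *)
Fixpoint chain j n : sub (Gm j) (Gm n) :=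
  match PeanoNat.Nat.eq_dec j n with
  | left e => ids_cast e
  | right _ =>
    match n return sub (Gm j) (Gm n) with
    | 0 => fun τ _ => closed_term _ τ
    | S m => comp (@chain j m) (@shift _ (ty_at m))
    end
  end.

Arguments chain : clear implicits.

Lemma chain_id j : chain j j = @ids _.
Proof.
have e0 : PeanoNat.Nat.eq_dec j j = left erefl.
  by case: (PeanoNat.Nat.eq_dec j j) => // e; congr left; exact: (Eqdep_dec.UIP_dec PeanoNat.Nat.eq_dec).
by case: j e0 => [|j] e0; rewrite /chain -/chain e0.
Qed.

Lemma chain_S j n : (j <= n)%nat -> chain j n.+1 = comp (chain j n) (@shift _ (ty_at n)).
Proof.
move=> h /=; case: (PeanoNat.Nat.eq_dec j n.+1) => // e; lia.
Qed.

Definition wit n : form (ty_at n :: Gm n) :=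
  sub_fm (List.nth (dec_l n) (fms (dec_k n) (ty_at n :: Gm (dec_j n))) Bot)
    (up (chain (dec_j n) n)).

Lemma witE n N (A : form (ty_at n :: Gm N)) : dec_j n = N ->
  List.nth (dec_l n) (fms (dec_k n) (ty_at n :: Gm N)) Bot = A ->
  wit n = sub_fm A (up (chain N n)).
Proof. by move=> e; case: N / e A => A <-. Qed.

Fixpoint Th n : form (Gm n) -> Prop :=
  match n with
  | 0 => Lind T (fun F => F = ¬ A0)
  | S n => Lind T (fun F : form (Gm (S n)) =>
      (exists2 G, Th G & F = wk_fm (ty_at n) G) \/ (F = wit n /\ Th (Ex (wit n))))
  end.

Lemma Th_mcs n : mcs T (@Th n).
Proof.
elim: n => [|n IH]; apply: Lind_mcs; last exact: Con_witness.
move=> [Δ hΔ h]; apply: hA0; apply: p_raa => //.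
by apply: prv_weaken h _ => B /hΔ ->; left.
Qed.

Lemma Th0 : Th (n := 0) (¬ A0).
Proof. exact: Lind_sub. Qed.

Lemma Th_wk n A : Th (n := n) A -> Th (n := n.+1) (wk_fm (ty_at n) A).
Proof. by move=> h; apply: Lind_sub; left; exists A. Qed.

(** Conservativity comes from maximality: if A were missing from the smaller theory, its negation
    would be there and would be carried into the larger one. *)
Lemma Th_wkE n A : Th (n := n.+1) (wk_fm (ty_at n) A) <-> Th (n := n) A.
Proof.
split; last exact: Th_wk.
move=> h; case: (mcs_max (Th_mcs n) A) => // /Th_wk hn.
by have /(mcs_not (Th_mcs n.+1)) := hn.
Qed.

Lemma Th_wit n : Th (Ex (wit n)) -> Th (n := n.+1) (wit n).
Proof. by move=> h; apply: Lind_sub; right. Qed.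

(** An element of the direct limit of the terms over the chain: a term at every stage, compatible
    with weakening from some stage on. Early values are irrelevant, which avoids transporting terms
    between contexts. *)
Record sec τ := Sec {
  sec_at :> forall n, tm (Gm n) τ;
  sec_coh : ev (fun n => sec_at n.+1 = sub_tm (@shift _ _) (sec_at n)) }.

Definition senv Γ := forall τ, var Γ τ -> sec τ.

Definition at_ Γ (ρ : senv Γ) n : sub Γ (Gm n) := fun τ v => ρ τ v n.

Lemma senv_coh Γ (ρ : senv Γ) :
  ev (fun n => at_ ρ n.+1 = comp (at_ ρ n) (@shift _ _)).
Proof.
suff h : ev (fun n => forall τ v, at_ ρ n.+1 v = sub_tm (@shift _ _) (at_ ρ n v) :> tm _ τ).
  by apply: ev_imp h => n h; apply: sub_ext.
elim: Γ ρ => [|σ Γ IH] ρ; first by apply: ev_all => n; apply: var_nil.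
have h := ev_and (sec_coh (ρ σ vz)) (IH (fun τ v => ρ τ (vs σ v))).
apply: ev_imp h => n [h1 h2].
by apply: var_case => // τ v; exact: h2.
Qed.

Definition econs Γ σ (d : sec σ) (ρ : senv Γ) : senv (σ :: Γ) :=
  fun τ (v : var (σ :: Γ) τ) =>
    match v in var Δ τ
          return match Δ with
                 | nil => unit
                 | σ0 :: Δ0 => sec σ0 -> senv Δ0 -> sec τ
                 end with
    | vz => fun d _ => d
    | vs _ w => fun _ ρ => ρ _ w
    end d ρ.

Lemma at_econs Γ σ (d : sec σ) (ρ : senv Γ) n :
  at_ (econs d ρ) n = scons (d n) (at_ ρ n).
Proof. by apply: sub_ext; apply: var_case. Qed.

Definition Tr Γ (A : form Γ) (ρ : senv Γ) := ev (fun n => Th (sub_fm A (at_ ρ n))).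

Lemma Th_step Γ (A : form Γ) ρ n : at_ ρ n.+1 = comp (at_ ρ n) (@shift _ _) ->
  Th (sub_fm A (at_ ρ n.+1)) <-> Th (sub_fm A (at_ ρ n)).
Proof. by move=> ->; rewrite -sub_fm_comp; apply: Th_wkE. Qed.

(** Once the environment is coherent, membership no longer changes from one stage to the next. Truth
    can be tested at any single late stage, where the clauses for connectives are those of a maximal
    consistent set. *)
Lemma Tr_stable Γ (A : form Γ) ρ : ev (fun n =>
  Th (sub_fm A (at_ ρ n)) <-> Tr A ρ).
Proof.
have [N hN] := senv_coh ρ; exists N.
have step n : (N <= n)%nat ->
    Th (sub_fm A (at_ ρ n.+1)) <-> Th (sub_fm A (at_ ρ n)).
  by move=> hn; apply: Th_step; apply: hN.
have steps n k : (N <= n)%nat ->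
    Th (sub_fm A (at_ ρ (k + n))) <-> Th (sub_fm A (at_ ρ n)).
  move=> hn; elim: k => [//|k IH]; rewrite addSn; apply: iff_trans IH.
  by apply: step; lia.
move=> n hn; split=> [h|[N' h]].
  exists n => m hm; have -> : m = (m - n + n)%nat by lia.
  exact/steps.
by apply/(steps n N' hn); apply: h; lia.
Qed.

Lemma ev_ex P : ev P -> exists n, P n.
Proof. by move=> [N h]; exists N; apply: h. Qed.

Lemma Tr_bot Γ (ρ : senv Γ) : ~ Tr Bot ρ.
Proof. by move=> /ev_ex [n /(mcs_bot (Th_mcs n))]. Qed.

Lemma Tr_imp Γ (A B : form Γ) ρ : Tr (A ⇒ B) ρ <-> (Tr A ρ -> Tr B ρ).
Proof.
have [n [h1 [h2 h3]]] := ev_ex (ev_and (Tr_stable A ρ) (ev_and (Tr_stable B ρ) (Tr_stable (A ⇒ B) ρ))).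
by rewrite -h1 -h2 -h3 /=; apply: (mcs_imp (Th_mcs n)).
Qed.

Lemma Tr_and Γ (A B : form Γ) ρ : Tr (A ∧ B) ρ <-> (Tr A ρ /\ Tr B ρ).
Proof.
have [n [h1 [h2 h3]]] := ev_ex (ev_and (Tr_stable A ρ) (ev_and (Tr_stable B ρ) (Tr_stable (A ∧ B) ρ))).
by rewrite -h1 -h2 -h3 /=; apply: (mcs_and (Th_mcs n)).
Qed.

Lemma Tr_or Γ (A B : form Γ) ρ : Tr (A ∨ B) ρ <-> (Tr A ρ \/ Tr B ρ).
Proof.
have [n [h1 [h2 h3]]] := ev_ex (ev_and (Tr_stable A ρ) (ev_and (Tr_stable B ρ) (Tr_stable (A ∨ B) ρ))).
by rewrite -h1 -h2 -h3 /=; apply: (mcs_or (Th_mcs n)).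
Qed.

Lemma Tr_inst Γ σ (A : form (σ :: Γ)) ρ (d : sec σ) :
  Tr (All A) ρ -> Tr A (econs d ρ).
Proof.
apply: ev_imp => n h; rewrite at_econs -sub_fm_inst.
exact: (mcs_inst (Th_mcs n)).
Qed.

Lemma Tr_exI Γ σ (A : form (σ :: Γ)) ρ (d : sec σ) :
  Tr A (econs d ρ) -> Tr (Ex A) ρ.
Proof.
apply: ev_imp => n h; rewrite at_econs -sub_fm_inst in h.
exact: (mcs_exI (Th_mcs n) h).
Qed.

Definition witness_at n m : tm (Gm m) (ty_at n) := chain n.+1 m _ vz.

Lemma witness_coh n : ev (fun m => witness_at n m.+1 = sub_tm (@shift _ _) (witness_at n m)).
Proof. by exists n.+1 => m hm; rewrite /witness_at chain_S. Qed.

Definition witness n : sec (ty_at n) := Sec (witness_coh n).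

(** Past a stage N the environment is coherent, so the formula can be frozen over the context of
    stage N. Its type and its position in the enumeration are coded together with N in a step n ≥ N,
    and the variable added at that step is the witness. *)
Lemma Tr_exE Γ σ (A : form (σ :: Γ)) ρ : Tr (Ex A) ρ -> exists d, Tr A (econs d ρ).
Proof.
move=> h.
have [N hN] := senv_coh ρ.
have at_chain m : (N <= m)%nat -> at_ ρ m = comp (at_ ρ N) (chain N m).
  elim: m => [|m IH] hm; first by have -> : N = 0 by [lia]; rewrite chain_id comp_ids.
  case: (ltnP m N) => hm'; first by have -> : N = m.+1 by [lia]; rewrite chain_id comp_ids.
  rewrite hN // IH // chain_S //; apply: sub_ext => τ v.
  by rewrite /comp sub_sub.
pose B := sub_fm A (up (at_ ρ N)).
have [K /= hK] := ev_and (tysP σ) (ev_and (fmsP B) (ev_ge N)).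
have /(_ K) [//|hσ [hB hNK]] := hK.
have [i [_ hi]] := In_nth _ _ tN hσ.
have [l [_ hl]] := In_nth _ _ Bot hB.
pose n := Cantor.to_nat (K, Cantor.to_nat (N, Cantor.to_nat (i, l))).
have ek : dec_k n = K by rewrite /dec_k Cantor.cancel_of_to.
have ej : dec_j n = N by rewrite /dec_j !Cantor.cancel_of_to.
have ei : dec_i n = i by rewrite /dec_i !Cantor.cancel_of_to.
have el : dec_l n = l by rewrite /dec_l !Cantor.cancel_of_to.
have hn : (N <= n)%nat.
  have := Cantor.to_nat_non_decreasing K (Cantor.to_nat (N, Cantor.to_nat (i, l))).
  rewrite -/n; lia.
have eσ : ty_at n = σ by rewrite /ty_at ek ei.
clear hK hσ hi; rewrite /B in hl; clear B hB; move: eσ A h hl => eσ.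
case: σ / eσ => A h hl.
have ew : wit n = sub_fm A (up (at_ ρ n)).
  by rewrite (witE ej (A := sub_fm A (up (at_ ρ N)))) ?ek ?el // sub_fm_comp up_comp -at_chain.
have stepE m : (N <= m)%nat ->
    Th (sub_fm (Ex A) (at_ ρ m.+1)) <-> Th (sub_fm (Ex A) (at_ ρ m)).
  by move=> hm; apply: Th_step; apply: hN.
have /Th_wit : Th (Ex (wit n)).
  (* Truth is known at some late stage only; coherence carries it back down to step n. *)
  rewrite ew; case: h => [N' h'].
  have : Th (sub_fm (Ex A) (at_ ρ (N' + n))) by apply: h'; lia.
  by elim: (N') => [//|k IH]; rewrite addSn => h''; apply: IH; apply/stepE => //; lia.
rewrite ew => hw; exists (witness n); exists n.+1.
have coh m : (n < m)%nat -> at_ (econs (witness n) ρ) m.+1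
    = comp (at_ (econs (witness n) ρ) m) (@shift _ _).
  move=> hm; rewrite !at_econs scons_comp -hN; last lia.
  by rewrite [witness n m.+1]/= /witness_at chain_S.
elim=> [//|m IH] hm; case: (ltnP n m) => hm'.
  by apply/Th_step; [apply: coh|apply: IH].
have <- : n = m by lia.
(* At the stage where the witness variable enters, extending the environment by it is the same as
   lifting the old environment under a binder. *)
suff -> : at_ (econs (witness n) ρ) n.+1 = up (at_ ρ n) by [].
rewrite at_econs [witness n n.+1]/= /witness_at chain_id hN //.
by apply: sub_ext; apply: var_case => // τ v; rewrite /up /= ren_as_sub.
Qed.

Lemma Tr_ex Γ σ (A : form (σ :: Γ)) ρ : Tr (Ex A) ρ <-> exists d, Tr A (econs d ρ).
Proof. by split=> [/Tr_exE//|[d /Tr_exI]]. Qed.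

Lemma Tr_all Γ σ (A : form (σ :: Γ)) ρ : Tr (All A) ρ <-> forall d, Tr A (econs d ρ).
Proof.
split=> [h d|h]; first exact: Tr_inst.
have [n [h1 h2]] := ev_ex (ev_and (Tr_stable (All A) ρ) (Tr_stable (Ex (¬ A)) ρ)).
case: (mcs_all (Th_mcs n) (sub_fm A (up (at_ ρ n)))) => [/h1//|/h2 /Tr_ex [d]].
by move=> /Tr_imp /(_ (h d)) /Tr_bot.
Qed.

Definition rel τ (d d' : sec τ) := ev (fun n => Th (eqT (d n) (d' n))).

Lemma tsec_coh Γ τ (t : tm Γ τ) (ρ : senv Γ) :
  ev (fun n => sub_tm (at_ ρ n.+1) t = sub_tm (@shift _ _) (sub_tm (at_ ρ n) t)).
Proof. by apply: ev_imp (senv_coh ρ) => n ->; rewrite sub_sub. Qed.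

Definition tsec Γ τ (t : tm Γ τ) (ρ : senv Γ) : sec τ := Sec (tsec_coh t ρ).

Lemma Tr_eqT Γ τ (t u : tm Γ τ) ρ : Tr (eqT t u) ρ <-> rel (tsec t ρ) (tsec u ρ).
Proof. by split; apply: ev_imp => n; rewrite sub_eqT. Qed.

Definition enil : senv nil := fun τ v =>
  match v in var Δ τ return match Δ with nil => sec τ | _ => unit end with
  | vz => tt | vs _ _ => tt end.

Definition sapp σ τ (f : sec (σ ⟶ τ)) (d : sec σ) : sec τ :=
  tsec (Var vz · Var (vs _ vz)) (econs f (econs d enil)).

(** [eqT] at an arrow type is a universal formula, so [Tr_all] applies. In the quotient this becomes
    extensionality. *)
Lemma rel_arrow σ τ (f g : sec (σ ⟶ τ)) :
  rel f g <-> forall d, rel (sapp f d) (sapp g d).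
Proof.
have e : rel f g <-> Tr (@eqT (σ ⟶ τ) _ (Var vz) (Var (vs _ vz))) (econs f (econs g enil)).
  by apply: iff_sym; apply: (@Tr_eqT _ (σ ⟶ τ)).
apply: (iff_trans e); rewrite /= /fall.
apply: (iff_trans (@Tr_all _ _ _ _)).
by split=> h d; [have /Tr_eqT := h d|apply/Tr_eqT; exact: h d].
Qed.

Lemma inst_wk Γ σ τ (t : tm Γ τ) (u : tm Γ σ) : sub_tm (scons u (@ids Γ)) (wk_tm σ t) = t.
Proof. by rewrite wk_tmE sub_sub shift_scons sub_ids. Qed.

Lemma Th_refl n (t : tm _ tN) : Th (n := n) (t ≐ t).
Proof. by apply: (mcs_closed (Th_mcs n) (Δ := nil)) => //; apply: p_eqI. Qed.

Lemma Th_subst n (A : form (tN :: Gm n)) (t u : tm _ tN) :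
  Th (n := n) (t ≐ u) -> Th (inst A t) -> Th (inst A u).
Proof.
move=> h1 h2; apply: (mcs_closed (Th_mcs n) (Δ := [:: t ≐ u; inst A t])).
  by move=> B /= [<-//|[<-//|//]].
by apply: (@p_eqE _ _ _ _ _ t) => //; apply: p_hyp => //=; auto.
Qed.

Lemma Th_sym n (t u : tm _ tN) : Th (n := n) (t ≐ u) -> Th (u ≐ t).
Proof.
move=> h; have := @Th_subst n (Var vz ≐ wk_tm _ t) t u h.
by rewrite /inst /= !inst_wk; apply; exact: Th_refl.
Qed.

Lemma Th_trans n (t u v : tm _ tN) : Th (n := n) (t ≐ u) -> Th (u ≐ v) -> Th (t ≐ v).
Proof.
move=> h h'; have := @Th_subst n (wk_tm _ t ≐ Var vz) u v h'.
by rewrite /inst /= !inst_wk; apply.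
Qed.

Lemma Th_lt n (t u t' u' : tm _ tN) : Th (n := n) (t ≐ t') -> Th (u ≐ u') ->
  Th (t ≺ u) -> Th (t' ≺ u').
Proof.
move=> h h' hl.
have := @Th_subst n (wk_tm _ t' ≺ Var vz) u u' h'; rewrite /inst /= !inst_wk; apply.
by have := @Th_subst n (Var vz ≺ wk_tm _ u) t t' h; rewrite /inst /= !inst_wk; apply.
Qed.

Lemma rel_refl τ (d : sec τ) : rel d d.
Proof.
elim: τ d => [|σ _ τ IH] d; first by apply: ev_all => n; exact: Th_refl.
by apply/rel_arrow.
Qed.

Lemma rel_sym τ (d d' : sec τ) : rel d d' -> rel d' d.
Proof.
elim: τ d d' => [|σ _ τ IH] d d'; first by apply: ev_imp => n; exact: Th_sym.
by move=> /rel_arrow h; apply/rel_arrow => x; apply: IH.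
Qed.

Lemma rel_trans τ (d d' d'' : sec τ) : rel d d' -> rel d' d'' -> rel d d''.
Proof.
elim: τ d d' d'' => [|σ _ τ IH] d d' d''.
  by move=> h h'; apply: ev_imp (ev_and h h') => n [hn hn']; apply: Th_trans hn'.
by move=> /rel_arrow h /rel_arrow h'; apply/rel_arrow => x; apply: IH (h x) (h' x).
Qed.

Lemma Tr_nil (A : sentence) (ρ : senv nil) : Th (n := 0) A -> Tr A ρ.
Proof.
move=> h; exists 0 => n _; elim: n => [|n IH].
  by rewrite (_ : at_ ρ 0 = @ids _) ?sub_fm_ids //; apply: sub_ext; apply: var_nil.
by apply/Th_step => //; apply: sub_ext; apply: var_nil.
Qed.

(** Here the extensionality axiom enters: it makes application respect the defined equality, so that
    application descends to the quotient. *)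
Lemma rel_app_arg σ τ (f : sec (σ ⟶ τ)) (d d' : sec σ) :
  rel d d' -> rel (sapp f d) (sapp f d').
Proof.
move=> h.
have hA : Th (n := 0) (∀ x : σ, ∀ y : σ, ∀ φ : σ ⟶ τ, eqT ↑x ↑y ⇒ eqT (φ · ↑x) (φ · ↑y)).
  by apply: (mcs_closed (Th_mcs 0) (Δ := nil)) => //; apply: p_ax.
have /Tr_all/(_ d)/Tr_all/(_ d')/Tr_all/(_ f)/Tr_imp := Tr_nil enil hA.
move=> hh; have {}hh := fun p => iffLR (Tr_eqT _ _ _) (hh p).
by apply: hh; apply/Tr_eqT; exact: h.
Qed.

Lemma rel_app σ τ (f f' : sec (σ ⟶ τ)) (d d' : sec σ) :
  rel f f' -> rel d d' -> rel (sapp f d) (sapp f' d').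
Proof.
move=> /rel_arrow h h'; apply: rel_trans (h d) _.
exact: rel_app_arg.
Qed.

Definition qdom τ := quot (@rel τ).
Definition cls τ (d : sec τ) : qdom τ := cl (@rel τ) d.
Definition crep τ (x : qdom τ) : sec τ := rep x.

Lemma clsP τ (d d' : sec τ) : cls d = cls d' <-> rel d d'.
Proof. exact: (clP (@rel_refl τ) (@rel_sym τ) (fun y x z => @rel_trans τ x y z)). Qed.

Lemma cls_surj τ (x : qdom τ) : exists d, cls d = x.
Proof. exact: cl_surj. Qed.

Lemma crepK τ (x : qdom τ) : cls (crep x) = x.
Proof. exact: repK. Qed.

Definition qapp σ τ (f : qdom (σ ⟶ τ)) (x : qdom σ) : qdom τ :=
  cls (sapp (crep f) (crep x)).

Lemma qappE σ τ (f : sec (σ ⟶ τ)) (x : sec σ) : qapp (cls f) (cls x) = cls (sapp f x).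
Proof. by apply/clsP; apply: rel_app; apply/clsP; rewrite crepK. Qed.

Definition clt (x y : qdom tN) := ev (fun n => Th (crep x n ≺ crep y n)).

Lemma cltE (x y : sec tN) : clt (cls x) (cls y) <-> ev (fun n => Th (x n ≺ y n)).
Proof.
have hx : rel (crep (cls x)) x by apply/clsP; rewrite crepK.
have hy : rel (crep (cls y)) y by apply/clsP; rewrite crepK.
split=> h.
  apply: ev_imp (ev_and h (ev_and hx hy)) => n [h1 [h2 h3]].
  exact: Th_lt h2 h3 h1.
apply: ev_imp (ev_and h (ev_and (rel_sym hx) (rel_sym hy))) => n [h1 [h2 h3]].
exact: Th_lt h2 h3 h1.
Qed.

Lemma qapp_ext σ τ (f g : qdom (σ ⟶ τ)) : (forall x, qapp f x = qapp g x) -> f = g.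
Proof.
have [f' <-] := cls_surj f; have [g' <-] := cls_surj g => h.
by apply/clsP/rel_arrow => d; apply/clsP; rewrite -!qappE.
Qed.

Definition ctm τ (t : tm nil τ) : qdom τ := cls (tsec t enil).

Definition term_model : structure :=
  @Structure qdom qapp (ctm Zero) (ctm One) (ctm Plus) (ctm Times)
    (fun σ τ => ctm (Kc σ τ)) (fun ρ σ τ => ctm (Sc ρ σ τ)) (ctm R0) clt qapp_ext.

Definition qenv Γ (ρ : senv Γ) : env term_model Γ := tab (fun τ v => cls (ρ τ v) : dom term_model τ).

Lemma cls_eq τ (d d' : sec τ) : (forall n, d n = d' n) -> cls d = cls d'.
Proof.
move=> h; apply/clsP; have := rel_refl d; apply: ev_imp => n.
by rewrite h.
Qed.

Lemma qeval Γ τ (t : tm Γ τ) (ρ : senv Γ) :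
  eval t (qenv ρ) = cls (tsec t ρ) :> dom term_model τ.
Proof.
elim: t => [τ' v|||||||| σ τ' f IHf u IHu] /=; try by move=> *; apply: cls_eq.
  by rewrite look_tab; apply: cls_eq.
by rewrite IHf IHu qappE; apply: cls_eq.
Qed.

Lemma truth Γ (A : form Γ) : forall ρ : senv Γ, sat A (qenv ρ) <-> Tr A ρ.
Proof.
elim: A => {Γ}.
- move=> Γ t u ρ; rewrite /= !qeval; apply: (iff_trans (clsP _ _)).
  by apply: iff_sym; apply: (@Tr_eqT _ tN).
- by move=> Γ t u ρ; rewrite /= !qeval; apply: cltE.
- by move=> Γ ρ; split=> // /Tr_bot.
- by move=> Γ A IA B IB ρ; rewrite /= IA IB Tr_imp.
- by move=> Γ A IA B IB ρ; rewrite /= IA IB Tr_and.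
- by move=> Γ A IA B IB ρ; rewrite /= IA IB Tr_or.
- move=> Γ τ A IA ρ /=; rewrite Tr_all; split=> h d; first exact/IA/(h (cls d)).
  by have [d' <-] := cls_surj d; have /IA := h d'.
- move=> Γ τ A IA ρ /=; rewrite Tr_ex; split=> [[d]|[d /IA h]]; last by exists (cls d).
  by have [d' <-] := cls_surj d => h; exists d'; apply/IA.
Qed.

Lemma prv_closure Γ (A : form Γ) : prv Lomega T nil A -> prv Lomega T nil (closure A).
Proof.
elim: Γ A => [//|τ Γ IH] A h /=; apply: IH.
by apply: p_allI.
Qed.

Lemma sat_closure (M : structure) Γ (A : form Γ) (h : sat (M := M) (closure A) tt) :
  forall ρ : env M Γ, sat A ρ.
Proof.
elim: Γ A h => [|τ Γ IH] A h ρ; first by case: ρ.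
by case: ρ => x ρ; exact: (IH _ h ρ x).
Qed.

(** Axioms with free variables are replaced by their universal closures, which are derivable
    sentences and thus belong to the initial theory of the chain. *)
Lemma term_model_models : models term_model T.
Proof.
move=> Γ A hA; apply: sat_closure; apply/(truth (closure A) enil); apply: Tr_nil.
apply: (mcs_closed (Th_mcs 0) (Δ := nil)) => //.
by apply: prv_closure; apply: p_ax.
Qed.

Lemma term_model_refutes : ~ sat (M := term_model) A0 tt.
Proof.
move=> /(truth A0 enil) h; have := Tr_nil enil Th0.
by move=> /Tr_imp /(_ h) /Tr_bot.
Qed.

End Henkin.

Theorem completeness (T : theory) :
  (forall Γ (A : form Γ), RCA0omega A -> T Γ A) ->
  forall A : sentence,
  (forall M, models M T -> sat (M := M) A tt) -> proves T A.
Proof.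
move=> hT A h; apply: contrapT => hA.
have extT ρ τ := hT _ _ (ax_extensionality nil ρ τ).
by apply: (@term_model_refutes T extT A hA); apply: h; apply: term_model_models.
Qed.

(** * The ordered semiring of numbers of a model *)

Record wmodel := WModel { wm :> structure; wax : models wm RCA0omega }.

Definition NN (M : wmodel) : Type := dom M tN.

HB.instance Definition _ (M : wmodel) := gen_eqMixin (NN M).
HB.instance Definition _ (M : wmodel) := gen_choiceMixin (NN M).

Import GRing.Theory Num.Theory Order.Theory.
Local Open Scope ring_scope.

Section Numbers.
Variable M : wmodel.
Notation N := (NN M).

Definition addN (x y : N) : N := app (app plusM x) y.
Definition mulN (x y : N) : N := app (app timesM x) y.

Definition ax_num Γ (A : form Γ) (h : basic_omega A) (ρ : env M Γ) : sat A ρ :=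
  wax (ax_semiring h) ρ.

Lemma addNA : associative addN.
Proof. by move=> x y z; have := ax_num (s_addA nil) tt x y z. Qed.
Lemma addNC : commutative addN.
Proof. exact: (ax_num (s_addC nil) tt). Qed.
Lemma add0N : left_id (zeroM : N) addN.
Proof. move=> x; rewrite addNC; exact: (ax_num (s_add0 nil) tt). Qed.
Lemma mulNA : associative mulN.
Proof. by move=> x y z; have := ax_num (s_mulA nil) tt x y z. Qed.
Lemma mulNC : commutative mulN.
Proof. exact: (ax_num (s_mulC nil) tt). Qed.
Lemma mul1N : left_id (oneM : N) mulN.
Proof. move=> x; rewrite mulNC; exact: (ax_num (s_mul1 nil) tt). Qed.
Lemma mul0N : left_zero (zeroM : N) mulN.
Proof. move=> x; rewrite mulNC; exact: (ax_num (s_mul0 nil) tt). Qed.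
Lemma mulNDl : left_distributive mulN addN.
Proof.
move=> x y z; rewrite mulNC (mulNC x) (mulNC y); exact: (ax_num (s_mulD nil) tt).
Qed.

Lemma oneN_neq0 : (oneM : N) <> zeroM.
Proof.
have hd := (ax_num (s_discrete nil) tt (zeroM : N) (zeroM : N)).2.
have : ltM (zeroM : N) (addN zeroM oneM) by apply: hd; right.
by rewrite add0N => h e; rewrite e in h; apply: (ax_num (s_irr nil) tt _ h).
Qed.

End Numbers.

HB.instance Definition _ (M : wmodel) :=
  GRing.isNmodule.Build (NN M) (@addNA M) (@addNC M) (@add0N M).

Lemma oneN_neq0b (M : wmodel) : (oneM : NN M) != (zeroM : NN M).
Proof. by apply/eqP; exact: oneN_neq0. Qed.

HB.instance Definition _ (M : wmodel) :=
  GRing.Nmodule_isComNzSemiRing.Build (NN M) (@mulNA M) (@mulNC M) (@mul1N M)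
   (@mulNDl M) (@mul0N M) (@oneN_neq0b M).

Section Numbers2.
Variable M : wmodel.
Notation N := (NN M).

Definition ltN (x y : N) : Prop := ltM x y.
Definition leN (x y : N) : Prop := ltM x y \/ x = y.

Lemma ltN_irr (x : N) : ~ ltN x x. Proof. exact: (ax_num (s_irr nil) tt). Qed.
Lemma ltN_trans (x y z : N) : ltN x y -> ltN y z -> ltN x z.
Proof. exact: (ax_num (s_trans nil) tt x y z). Qed.
Lemma ltN_total (x y : N) : ltN x y \/ x = y \/ ltN y x.
Proof. exact: (ax_num (s_total nil) tt x y). Qed.
Lemma ltN_add2r (x y z : N) : ltN x y -> ltN (x + z) (y + z).
Proof. exact: (ax_num (s_ltD nil) tt x y z). Qed.
Lemma ltN_mul2r (x y z : N) : ltN 0 z -> ltN x y -> ltN (x * z) (y * z).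
Proof. exact: (ax_num (s_ltM nil) tt x y z). Qed.
Lemma ltN_0 (x : N) : ~ ltN x 0.
Proof. exact: (ax_num (s_pos nil) tt x). Qed.
Lemma ltN_S (x y : N) : ltN x (y + 1) <-> leN x y.
Proof. exact: (ax_num (s_discrete nil) tt x y). Qed.

Lemma addN_inj (x y z : N) : x + z = y + z -> x = y.
Proof.
move=> h; case: (ltN_total x y) => [|[//|]] /(@ltN_add2r _ _ z); rewrite h => /ltN_irr //.
Qed.

Lemma mulN_inj (x y z : N) : ltN 0 z -> x * z = y * z -> x = y.
Proof.
move=> hz h; case: (ltN_total x y) => [|[//|]] /(ltN_mul2r hz); rewrite h => /ltN_irr //.
Qed.

Definition ext_env Γ Γ' (e : ext Γ Γ') (ρ : env M Γ') : env M Γ :=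
  tab (fun τ v => look (e τ v) ρ).

Lemma ext_env_refl Γ (ρ : env M Γ) : ext_env (@ext_refl Γ) ρ = ρ.
Proof. exact: tab_look. Qed.

Lemma ext_env_step Γ Γ' σ (e : ext Γ Γ') (x : dom M σ) ρ :
  @ext_env Γ (σ :: Γ') (@ext_step Γ Γ' σ e) (x, ρ) = ext_env e ρ.
Proof. by []. Qed.

Lemma sat_at1 Γ Γ' (e : ext Γ Γ') σ (A : form (σ :: Γ)) (t : tm Γ' σ) (ρ : env M Γ') :
  sat (at1 A t) ρ = sat A (eval t ρ, ext_env e ρ).
Proof. exact: sat_sub. Qed.

Lemma sat_at2 Γ Γ' (e : ext Γ Γ') σ τ (A : form (τ :: σ :: Γ)) (t : tm Γ' σ)
  (u : tm Γ' τ) (ρ : env M Γ') :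
  sat (at2 A t u) ρ = sat A (eval u ρ, (eval t ρ, ext_env e ρ)).
Proof. exact: sat_sub. Qed.

Lemma sat_ind_axiom Γ (A : form (tN :: Γ)) (ρ : env M Γ) :
  sat (ind_axiom A) ρ <-> (sat A ((0 : N) : dom M tN, ρ) ->
    (forall n : N, sat A (n : dom M tN, ρ) -> sat A (n + 1 : dom M tN, ρ)) ->
    forall n : N, sat A (n : dom M tN, ρ)).
Proof.
rewrite /ind_axiom /= sat_at1 ext_env_refl.
split=> h h0 hS n.
  have {h} := h h0 _ n; rewrite sat_at1 ext_env_step ext_env_refl; apply.
  by move=> m; rewrite !sat_at1 !ext_env_step !ext_env_refl; apply: hS.
rewrite sat_at1 ext_env_step ext_env_refl; apply: h => // m.
by have := hS m; rewrite !sat_at1 !ext_env_step !ext_env_refl.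
Qed.

Lemma sat_choice Γ σ τ (A : form (τ :: σ :: Γ)) (ρ : env M Γ) :
  sat (choice A) ρ <-> ((forall x, exists y, sat A (y, (x, ρ))) ->
    exists Y : dom M (σ ⟶ τ), forall x, sat A (app Y x, (x, ρ))).
Proof.
rewrite /choice /=; split=> h h0.
  have {h} [|Y hY] := h _.
    move=> x; have [y hy] := h0 x; exists y.
    by rewrite sat_at2 !ext_env_step ext_env_refl.
  by exists Y => x; have := hY x; rewrite sat_at2 !ext_env_step ext_env_refl.
have {h} [|Y hY] := h _.
  move=> x; have [y] := h0 x; rewrite sat_at2 !ext_env_step ext_env_refl.
  by exists y.
by exists Y => x; rewrite sat_at2 !ext_env_step ext_env_refl; exact: hY.
Qed.

Lemma sat_comprehension Γ (A : form (tN :: Γ)) (ρ : env M Γ) :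
  sat (comprehension A) ρ <-> exists X : dom M t1,
    (forall n : N, leN (app X n) 1) /\
    (forall n : N, app X n = oneM <-> sat A (n : dom M tN, ρ)).
Proof.
rewrite /comprehension /=; split=> -[X [h1 h2]]; exists X; split=> // n.
  by have := h2 n; rewrite /= sat_at1 !ext_env_step ext_env_refl => -[h3 h4]; split.
have [h3 h4] := h2 n.
by rewrite /= sat_at1 !ext_env_step ext_env_refl.
Qed.

Lemma qf_induction Γ (A : form (tN :: Γ)) (ρ : env M Γ) : qfree A ->
  sat A ((0 : N) : dom M tN, ρ) ->
  (forall n : N, sat A (n : dom M tN, ρ) -> sat A (n + 1 : dom M tN, ρ)) ->
  forall n : N, sat A (n : dom M tN, ρ).
Proof. by move=> hA; apply/sat_ind_axiom; apply: (wax (ax_QF_ind hA)). Qed.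

Lemma leN_refl (x : N) : leN x x. Proof. by right. Qed.
Lemma leN_0 (x : N) : leN 0 x.
Proof. by case: (ltN_total 0 x) => [|[|/ltN_0//]]; [left|right]. Qed.

Lemma ltN_le (x y : N) : ltN x y <-> leN (x + 1) y.
Proof.
rewrite -ltN_S; split=> [/(@ltN_add2r _ _ 1)//|h].
case: (ltN_total x y) => [//|[e|h']].
  by rewrite e in h; case: (ltN_irr h).
by case: (ltN_irr (ltN_trans h (ltN_add2r 1 h'))).
Qed.

(* By quantifier-free induction on z for the formula x + z <= y. *)
Lemma leNP (x y : N) : leN x y <-> exists z : N, y = x + z.
Proof.
have posl (z u : N) : leN u (u + z).
  case: (leN_0 z) => [h|<-]; last by rewrite addr0; right.
  by left; have := @ltN_add2r 0 z u h; rewrite add0r addrC.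
split=> [h|[z ->]]; last exact: posl.
apply: contrapT => hn.
pose A : form [:: tN; tN; tN] := (Var (vs _ vz) ⊕ Var vz ⪯ Var (vs _ (vs _ vz)))%fm.
have := @qf_induction _ A (x : dom M tN, (y : dom M tN, tt)) _ _ _ (y + 1).
have hA : qfree A by [].
move=> /(_ hA) hh.
have {hh} : leN (x + (y + 1)) y.
  apply: hh; first by rewrite [sat _ _]/(leN (x + 0) y) addr0.
  move=> z [hz|hz]; last by case: hn; exists z; exact: esym hz.
  by rewrite [sat _ _]/(leN (x + (z + 1)) y) addrA; apply/ltN_le; exact: hz.
rewrite -ltN_S => h'.
have := posl x (y + 1); rewrite [y + 1 + x]addrC => -[h''|e].
  exact: ltN_irr (ltN_trans h' h'').
by rewrite -e in h'; case: (ltN_irr h').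
Qed.

Lemma ltNP (x y : N) : ltN x y <-> exists z : N, y = x + z + 1.
Proof.
rewrite ltN_le leNP; split=> -[z ->]; exists z; ring.
Qed.

Lemma leN_total (x y : N) : leN x y \/ leN y x.
Proof. by case: (ltN_total x y) => [h|[->|h]]; [left; left|left; right|right; left]. Qed.

Lemma leN_anti (x y : N) : leN x y -> leN y x -> x = y.
Proof. by case=> [h|//]; case=> [h'|//]; case: (ltN_irr (ltN_trans h h')). Qed.

Lemma ltN01 : ltN 0 1.
Proof. by apply/ltNP; exists 0; rewrite !add0r. Qed.

Lemma ltN_mul0 (x y : N) : ltN 0 x -> ltN 0 y -> ltN 0 (x * y).
Proof. by move=> hx hy; have := ltN_mul2r hy hx; rewrite mul0r. Qed.

Lemma ltN_leF (x y : N) : ltN x y <-> ~ leN y x.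
Proof.
split=> [h [h'|h']|h].
- exact: ltN_irr (ltN_trans h h').
- by rewrite h' in h; case: (ltN_irr h).
by case: (ltN_total x y) => [//|[h'|h']]; case: h; [right|left].
Qed.

(** Formal fractions (p - m) / d with entries in the semiring, matching the triples [rat] of the
    language. The relation [qeq] below is cross multiplication with the subtracted terms moved
    across. *)
Record rawq := RawQ { qp : N; qm : N; qd : N; qd_gt0 : ltN 0 qd }.

Definition qeq r s := qp r * qd s + qm s * qd r = qp s * qd r + qm r * qd s.

Lemma qeq_refl r : qeq r r. Proof. by []. Qed.
Lemma qeq_sym r s : qeq r s -> qeq s r. Proof. by []. Qed.
Lemma qeq_trans s r t : qeq r s -> qeq s t -> qeq r t.
Proof.
rewrite /qeq => h1 h2.
apply: (mulN_inj (qd_gt0 s)).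
apply: (@addN_inj _ _ (qp s * qd r * qd t + qm s * qd t * qd r)).
transitivity ((qp r * qd s + qm s * qd r) * qd t + (qp s * qd t + qm t * qd s) * qd r).
  by ring.
by rewrite h1 h2; ring.
Qed.

End Numbers2.

(** * The ordered field of rationals of a model *)

Definition QQ (M : wmodel) : Type := quot (@qeq M).

HB.instance Definition _ (M : wmodel) := gen_eqMixin (QQ M).
HB.instance Definition _ (M : wmodel) := gen_choiceMixin (QQ M).

Section Rationals.
Variable M : wmodel.
Notation N := (NN M).
Notation Q := (QQ M).
Notation raw := (rawq M).
Implicit Types (r s : raw) (x y z : Q).

Definition qcl (r : raw) : Q := cl (@qeq M) r.
Definition qrep (x : Q) : raw := rep x.

Lemma qclP r s : qcl r = qcl s <-> qeq r s.
Proof. exact: (clP (@qeq_refl M) (@qeq_sym M) (@qeq_trans M)). Qed.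
Lemma qrepK x : qcl (qrep x) = x. Proof. exact: repK. Qed.

Definition radd r s : raw :=
  RawQ (qp r * qd s + qp s * qd r) (qm r * qd s + qm s * qd r)
    (ltN_mul0 (qd_gt0 r) (qd_gt0 s)).
Definition ropp r : raw := RawQ (qm r) (qp r) (qd_gt0 r).
Definition rmul r s : raw :=
  RawQ (qp r * qp s + qm r * qm s) (qp r * qm s + qm r * qp s)
    (ltN_mul0 (qd_gt0 r) (qd_gt0 s)).
Definition rnat (n : N) : raw := RawQ (n) (0) (@ltN01 M).

Definition qadd x y : Q := qcl (radd (qrep x) (qrep y)).
Definition qopp x : Q := qcl (ropp (qrep x)).
Definition qmul x y : Q := qcl (rmul (qrep x) (qrep y)).
Definition qnat (n : N) : Q := qcl (rnat n).

Lemma qrep_cl r : qeq (qrep (qcl r)) r.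
Proof. by apply/qclP; rewrite qrepK. Qed.

Lemma qaddE r s : qadd (qcl r) (qcl s) = qcl (radd r s).
Proof.
apply/qclP; have := qrep_cl r; have := qrep_cl s.
case: (qrep _) => p m d hd; case: (qrep _) => p' m' d' hd'.
rewrite /qeq /= => h1 h2.
transitivity ((p' * qd r + qm r * d') * (d * qd s) + (p * qd s + qm s * d) * (d' * qd r)).
  by ring.
by rewrite h1 h2; ring.
Qed.

Lemma qoppE r : qopp (qcl r) = qcl (ropp r).
Proof.
apply/qclP; have := qrep_cl r; case: (qrep _) => p m d hd.
by rewrite /qeq /= addrC => ->; rewrite addrC.
Qed.

Lemma rmulC r s : qeq (rmul r s) (rmul s r).
Proof. by rewrite /qeq /=; ring. Qed.

Lemma rmul_compat r r' s : qeq r r' -> qeq (rmul r s) (rmul r' s).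
Proof.
rewrite /qeq /= => h.
transitivity (qp s * qd s * (qp r * qd r' + qm r' * qd r)
  + qm s * qd s * (qp r' * qd r + qm r * qd r')); first by ring.
by rewrite [in LHS]h -[in X in _ + X]h; ring.
Qed.

Lemma qmulE r s : qmul (qcl r) (qcl s) = qcl (rmul r s).
Proof.
apply/qclP; apply: qeq_trans (rmul_compat _ (qrep_cl r)) _.
apply: qeq_trans (rmulC _ _) _.
apply: qeq_trans (rmul_compat _ (qrep_cl s)) _.
exact: rmulC.
Qed.

Lemma qcl_surj x : exists r, x = qcl r.
Proof. by exists (qrep x); rewrite qrepK. Qed.

Ltac qcases := repeat (let x := fresh "x" in let r := fresh "r" in
  move=> x; have [r ->] := qcl_surj x).

Lemma qaddA : associative qadd.
Proof. by qcases; rewrite !qaddE; apply/qclP; rewrite /qeq /=; ring. Qed.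
Lemma qaddC : commutative qadd.
Proof. by qcases; rewrite !qaddE; apply/qclP; rewrite /qeq /=; ring. Qed.
Lemma qadd0 : left_id (qnat 0) qadd.
Proof. by qcases; rewrite !qaddE; apply/qclP; rewrite /qeq /=; ring. Qed.
Lemma qaddN : left_inverse (qnat 0) qopp qadd.
Proof. by qcases; rewrite !qoppE !qaddE; apply/qclP; rewrite /qeq /=; ring. Qed.
Lemma qmulA : associative qmul.
Proof. by qcases; rewrite !qmulE; apply/qclP; rewrite /qeq /=; ring. Qed.
Lemma qmulC : commutative qmul.
Proof. by qcases; rewrite !qmulE; apply/qclP; rewrite /qeq /=; ring. Qed.
Lemma qmul1 : left_id (qnat 1) qmul.
Proof. by qcases; rewrite !qmulE; apply/qclP; rewrite /qeq /=; ring. Qed.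
Lemma qmulDl : left_distributive qmul qadd.
Proof. by qcases; rewrite !(qaddE, qmulE); apply/qclP; rewrite /qeq /=; ring. Qed.
Lemma q1_neq0 : qnat 1 != qnat 0.
Proof.
apply/eqP => /qclP; rewrite /qeq /= !mul1r !mul0r !addr0 => h.
exact: (@oneN_neq0 M).
Qed.

Definition qnonneg x : Prop := leN (qm (qrep x)) (qp (qrep x)).

Lemma leN_cancel (a b c : N) : leN (a + c) (b + c) <-> leN a b.
Proof.
rewrite !leNP; split=> -[z h]; exists z; last by rewrite h; ring.
by apply: (@addN_inj _ _ _ c); rewrite h; ring.
Qed.

Lemma leN_mulC (a b c : N) : ltN 0 c -> leN (a * c) (b * c) <-> leN a b.
Proof.
move=> hc; split=> [h|[h|->]]; [|by left; apply: ltN_mul2r|by right].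
case: (ltN_total b a) => [hl|[e|hl]]; [|by right|by left].
by have := ltN_mul2r hc hl; rewrite ltN_leF.
Qed.

Lemma qnonnegE r : qnonneg (qcl r) <-> leN (qm r) (qp r).
Proof.
rewrite /qnonneg; have := qrep_cl r; case: (qrep _) => p m d hd; rewrite /qeq /= => h.
rewrite -(leN_mulC _ _ (qd_gt0 r)) -(leN_mulC (qm r) (qp r) hd).
rewrite -(leN_cancel _ _ (qm r * d)) h addrC leN_cancel //.
Qed.

End Rationals.

HB.instance Definition _ (M : wmodel) :=
  GRing.isZmodule.Build (QQ M) (@qaddA M) (@qaddC M) (@qadd0 M) (@qaddN M).
HB.instance Definition _ (M : wmodel) :=
  GRing.Zmodule_isComNzRing.Build (QQ M) (@qmulA M) (@qmulC M) (@qmul1 M)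
   (@qmulDl M) (@q1_neq0 M).

Section RationalField.
Variable M : wmodel.
Notation N := (NN M).
Notation Q := (QQ M).
Implicit Types (r s : rawq M) (x y z : Q).

Lemma qcl_add r s : qcl r + qcl s = qcl (radd r s). Proof. exact: qaddE. Qed.
Lemma qcl_mul r s : qcl r * qcl s = qcl (rmul r s). Proof. exact: qmulE. Qed.
Lemma qcl_opp r : - qcl r = qcl (ropp r). Proof. exact: qoppE. Qed.

Lemma q_inverse x : x != 0 -> exists y, y * x = 1.
Proof.
have [r ->] := qcl_surj x => /eqP h.
case: (ltN_total (qm r) (qp r)) => [h1|[h1|h1]].
- have [z hz] := (ltNP _ _).1 h1.
  have pz : ltN 0 (z + 1) by apply/ltNP; exists z; rewrite add0r.
  exists (qcl (RawQ (qd r) (0) pz)); rewrite qcl_mul; apply/qclP.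
  by rewrite /qeq /= hz; ring.
- by case: h; apply/qclP; rewrite /qeq /= h1; ring.
- have [z hz] := (ltNP _ _).1 h1.
  have pz : ltN 0 (z + 1) by apply/ltNP; exists z; rewrite add0r.
  exists (qcl (RawQ (0) (qd r) pz)); rewrite qcl_mul; apply/qclP.
  by rewrite /qeq /= hz; ring.
Qed.

Definition qinv x : Q :=
  match pselect (x != 0) with
  | left h => projT1 (cid (q_inverse h))
  | right _ => 0
  end.

Lemma qmulV x : x != 0 -> qinv x * x = 1.
Proof. by move=> h; rewrite /qinv; case: pselect => // h'; exact: projT2 (cid (q_inverse h')). Qed.

Lemma qinv0 : qinv 0 = 0.
Proof. by rewrite /qinv; case: pselect => // h; exfalso; rewrite eqxx in h. Qed.

Definition qle x y : bool := `[< qnonneg (y - x) >].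
Definition qlt x y : bool := (y != x) && qle x y.
Definition qabs x : Q := if qle 0 x then x else - x.

Lemma qle0_add x y : qle 0 x -> qle 0 y -> qle 0 (x + y).
Proof.
rewrite /qle !subr0 => /asboolP + /asboolP + ; move=> h1 h2; apply/asboolP; move: h1 h2.
have [r ->] := qcl_surj x; have [s ->] := qcl_surj y; rewrite qcl_add !qnonnegE /= !leNP.
by move=> [z ->] [u ->]; exists (z * qd s + u * qd r); ring.
Qed.

Lemma qle0_mul x y : qle 0 x -> qle 0 y -> qle 0 (x * y).
Proof.
rewrite /qle !subr0 => /asboolP + /asboolP + ; move=> h1 h2; apply/asboolP; move: h1 h2.
have [r ->] := qcl_surj x; have [s ->] := qcl_surj y; rewrite qcl_mul !qnonnegE /= !leNP.
by move=> [z ->] [u ->]; exists (z * u); ring.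
Qed.

Lemma qle0_anti x : qle 0 x -> qle x 0 -> x = 0.
Proof.
rewrite /qle subr0 sub0r => /asboolP + /asboolP.
have [r ->] := qcl_surj x; rewrite qcl_opp !qnonnegE /= => h1 h2.
by apply/qclP; rewrite /qeq /= (leN_anti h1 h2); ring.
Qed.

Lemma qsub_ge0 x y : qle 0 (y - x) = qle x y.
Proof. by rewrite /qle subr0. Qed.

Lemma qle0_total x : qle 0 x || qle x 0.
Proof.
rewrite /qle subr0 sub0r; have [r ->] := qcl_surj x; rewrite qcl_opp; apply/orP.
case: (leN_total (qm r) (qp r)) => h; [left|right]; apply/asboolP; exact/qnonnegE.
Qed.

Lemma qabsN x : qabs (- x) = qabs x.
Proof.
rewrite /qabs; have e : qle 0 (- x) = qle x 0 by rewrite /qle subr0 sub0r.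
rewrite e; case: (boolP (qle 0 x)) => h1; case: (boolP (qle x 0)) => h2; rewrite ?opprK //.
  by rewrite (qle0_anti h1 h2) oppr0.
by have := qle0_total x; rewrite (negbTE h1) (negbTE h2).
Qed.

Lemma qabs_ge0 x : qle 0 x -> qabs x = x.
Proof. by rewrite /qabs => ->. Qed.

Lemma qlt_def x y : qlt x y = (y != x) && qle x y. Proof. by []. Qed.

End RationalField.

HB.instance Definition _ (M : wmodel) :=
  GRing.ComNzRing_isField.Build (QQ M) (@qmulV M) (@qinv0 M).
HB.instance Definition _ (M : wmodel) :=
  Num.IntegralDomain_isLeReal.Build (QQ M) (@qle0_add M) (@qle0_mul M) (@qle0_anti M)
   (@qsub_ge0 M) (@qle0_total M) (@qabsN M) (@qabs_ge0 M) (@qlt_def M).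

(** * The embedding of the numbers into the rationals *)

Section Embedding.
Variable M : wmodel.
Notation N := (NN M).
Notation Q := (QQ M).

Local Notation ι := (@qnat M).

Lemma qnatE (n : N) : ι n = qcl (rnat n). Proof. by []. Qed.
Lemma qnatD (x y : N) : ι (x + y) = ι x + ι y.
Proof. by rewrite !qnatE qcl_add; apply/qclP; rewrite /qeq /=; ring. Qed.
Lemma qnatM (x y : N) : ι (x * y) = ι x * ι y.
Proof. by rewrite !qnatE qcl_mul; apply/qclP; rewrite /qeq /=; ring. Qed.
Lemma qnat0 : ι 0 = 0. Proof. by []. Qed.
Lemma qnat1 : ι 1 = 1. Proof. by []. Qed.
Lemma qleE (x y : Q) : (x <= y) = `[< qnonneg (y - x) >]. Proof. by []. Qed.
Lemma qnat_le (x y : N) : leN x y <-> ι x <= ι y.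
Proof.
rewrite qleE !qnatE qcl_opp qcl_add; split=> h.
  apply/asboolP/qnonnegE => /=; move: h; rewrite !leNP => -[z ->]; exists z; ring.
move/asboolP: h => /qnonnegE /=; rewrite !leNP => -[z h]; exists z.
by transitivity (y * 1 + 0 * 1); [ring|rewrite h; ring].
Qed.
Lemma qnat_lt (x y : N) : ltN x y <-> ι x < ι y.
Proof.
rewrite ltN_leF qnat_le; split=> [/negP|h]; first by rewrite -ltNge.
by apply/negP; rewrite -ltNge.
Qed.
Lemma qnat_inj (x y : N) : ι x = ι y -> x = y.
Proof. by move=> h; apply: leN_anti; apply/qnat_le; rewrite h. Qed.
Lemma qnat_ge0 (x : N) : 0 <= ι x.
Proof. by rewrite -qnat0; apply/qnat_le; exact: leN_0. Qed.
(** Discreteness, in a form usable over an ordered field: a strict inequality between numbers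
    becomes a weak one with a gap of one unit. *)
Lemma qnat_ltS (x y : N) : ltN x y <-> ι x + 1 <= ι y.
Proof. by rewrite ltN_le qnat_le qnatD. Qed.

End Embedding.

(* Keeps [lra] and [ring] from comparing rationals by unfolding them. *)
Global Opaque qnat qadd qopp qmul qinv qle qlt qabs.

(** * Definable functions *)

Section Definability.
Variable M : wmodel.
Notation N := (NN M).
Local Notation ι := (@qnat M).

Lemma appK σ τ (x : dom M σ) (y : dom M τ) : app (app (KM σ τ) x) y = x.
Proof. exact: (iffLR (@sat_eqT M σ [:: τ; σ] (Kc σ τ · Var (vs _ vz) · Var vz)%fm (Var (vs _ vz)) (y, (x, tt))) (wax (@ax_K nil σ τ) tt x y)). Qed.

Lemma appS ρ σ τ (x : dom M (ρ ⟶ σ ⟶ τ)) (y : dom M (ρ ⟶ σ)) (z : dom M ρ) :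
  app (app (app (SM ρ σ τ) x) y) z = app (app x z) (app y z).
Proof. exact: (iffLR (@sat_eqT M τ [:: ρ; (ρ ⟶ σ)%ty; (ρ ⟶ σ ⟶ τ)%ty]
  (Sc ρ σ τ · Var (vs _ (vs _ vz)) · Var (vs _ vz) · Var vz)%fm
  (Var (vs _ (vs _ vz)) · Var vz · (Var (vs _ vz) · Var vz))%fm (z, (y, (x, tt))))
  (wax (@ax_S nil ρ σ τ) tt x y z)). Qed.

Lemma appR0 f m : app (app (app (@RM M) f) m) (0 : N) = m.
Proof. exact: (wax (@ax_R0_0 nil) tt f m). Qed.

Lemma appRS f m (n : N) : app (app (app (@RM M) f) m) (n + 1 : N)
  = app f (app (app (app (@RM M) f) m) n).
Proof. exact: (wax (@ax_R0_S nil) tt f m n). Qed.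

(** The newest variable of the context becomes the last argument. Abstraction over it then keeps the
    representing element ([def_lam]), and the work lies in [def_app]. *)
Fixpoint arr (Γ : ctx) (τ : ty) : ty :=
  match Γ with nil => τ | σ :: Γ => arr Γ (σ ⟶ τ)%ty end.

Fixpoint apps (Γ : ctx) : forall τ, dom M (arr Γ τ) -> env M Γ -> dom M τ :=
  match Γ return forall τ, dom M (arr Γ τ) -> env M Γ -> dom M τ with
  | nil => fun τ c _ => c
  | σ :: Γ => fun τ c ρ => app (@apps Γ (σ ⟶ τ)%ty c (snd ρ)) (fst ρ)
  end.

Definition def Γ τ (F : env M Γ -> dom M τ) := exists c, forall ρ, apps c ρ = F ρ.

Lemma def_ext Γ τ (F G : env M Γ -> dom M τ) : (forall ρ, F ρ = G ρ) -> def F -> def G.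
Proof. by move=> h [c hc]; exists c => ρ; rewrite hc. Qed.

Lemma def_const Γ τ (x : dom M τ) : def (fun _ : env M Γ => x).
Proof.
elim: Γ τ x => [|σ Γ IH] τ x; first by exists x.
by have [c hc] := IH _ (app (KM τ σ) x); exists c => ρ /=; rewrite hc appK.
Qed.

(** Combinatory completeness, one variable at a time: [SM] distributes the newest argument over an
    application, and the induction hypothesis treats the older ones. *)
Lemma def_app Γ σ τ (F : env M Γ -> dom M (σ ⟶ τ)) (G : env M Γ -> dom M σ) :
  def F -> def G -> def (fun ρ => app (F ρ) (G ρ)).
Proof.
move=> [c hc] [d hd].
suff [e he] : exists e, forall ρ, apps e ρ = app (apps c ρ) (apps d ρ).
  by exists e => ρ; rewrite he hc hd.
elim: Γ σ τ c d {F G hc hd} => [|ρ0 Γ IH] σ τ c d; first by exists (app c d).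
have [s hs] := def_const Γ (SM ρ0 σ τ).
have [e1 h1] := IH _ _ s c.
have [e2 h2] := IH _ _ e1 d.
by exists e2 => -[x ρ] /=; rewrite h2 h1 hs appS.
Qed.

Lemma def_weak Γ σ τ (F : env M Γ -> dom M τ) :
  def F -> def (fun ρ : env M (σ :: Γ) => F (snd ρ)).
Proof.
move=> hF; have [c hc] := def_app (def_const Γ (KM τ σ)) hF.
by exists c => -[x ρ] /=; rewrite hc appK.
Qed.

Lemma def_v0 Γ σ : def (fun ρ : env M (σ :: Γ) => fst ρ).
Proof.
have [c hc] := def_const Γ
  (app (app (SM σ (σ ⟶ σ) σ) (KM σ (σ ⟶ σ))) (KM σ σ)).
by exists c => -[x ρ] /=; rewrite hc appS appK.
Qed.
Lemma def_v1 Γ σ σ1 : def (fun ρ : env M (σ1 :: σ :: Γ) => fst (snd ρ)).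
Proof. exact: def_weak (@def_v0 _ _). Qed.
Lemma def_v2 Γ σ σ1 σ2 : def (fun ρ : env M (σ1 :: σ2 :: σ :: Γ) => fst (snd (snd ρ))).
Proof. exact: def_weak (@def_v1 _ _ _). Qed.
Lemma def_v3 Γ σ σ1 σ2 σ3 :
  def (fun ρ : env M (σ1 :: σ2 :: σ3 :: σ :: Γ) => fst (snd (snd (snd ρ)))).
Proof. exact: def_weak (@def_v2 _ _ _ _). Qed.
Lemma def_v4 Γ σ σ1 σ2 σ3 σ4 :
  def (fun ρ : env M (σ1 :: σ2 :: σ3 :: σ4 :: σ :: Γ) => fst (snd (snd (snd (snd ρ))))).
Proof. exact: def_weak (@def_v3 _ _ _ _ _). Qed.
Lemma def_v5 Γ σ σ1 σ2 σ3 σ4 σ5 :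
  def (fun ρ : env M (σ1 :: σ2 :: σ3 :: σ4 :: σ5 :: σ :: Γ) =>
    fst (snd (snd (snd (snd (snd ρ)))))).
Proof. exact: def_weak (@def_v4 _ _ _ _ _ _). Qed.

Lemma def_eval Γ τ (t : tm Γ τ) : def (fun ρ : env M Γ => eval t ρ).
Proof.
elim: t => {τ} /=; try by move=> *; apply: def_const.
  move=> τ v; elim: v => {Γ τ} [Γ τ|Γ σ τ v IH]; first exact: def_v0.
  exact: def_weak IH.
by move=> σ τ t ht u hu; apply: def_app.
Qed.

Lemma def_env Γ Γ' τ (F : env M Γ' -> dom M τ) (s : sub Γ' Γ) :
  def F -> def (fun ρ : env M Γ => F (sub_env s ρ)).
Proof.
move=> [c hc]; suff : def (fun ρ : env M Γ => apps c (sub_env s ρ)).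
  by apply: def_ext => ρ; rewrite hc.
elim: Γ' τ s c {F hc} => [|σ Γ' IH] τ s c /=; first exact: def_const.
apply: def_app; last exact: def_eval.
exact: (IH _ (fun τ v => s τ (vs σ v)) c).
Qed.

Definition default τ : dom M τ := eval (closed_term nil τ) tt.

(* The element with the values of [F]; a junk value if [F] is not definable. *)
Definition lam σ τ (F : dom M σ -> dom M τ) : dom M (σ ⟶ τ) :=
  match pselect (exists f, forall x, app f x = F x) with
  | left h => projT1 (cid h)
  | right _ => default (σ ⟶ τ)
  end.

Lemma lamP σ τ (F : dom M σ -> dom M τ) :
  (exists f, forall x, app f x = F x) -> forall x, app (lam F) x = F x.
Proof. by rewrite /lam; case: pselect => // h _; exact: projT2 (cid h). Qed.

Lemma lamE σ τ (F : dom M σ -> dom M τ) (x : dom M σ) :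
  def (fun ρ : env M [:: σ] => F (fst ρ)) -> app (lam F) x = F x.
Proof. by move=> [c hc]; apply: lamP; exists c => y; exact: (hc (y, tt)). Qed.

Lemma def_lam Γ σ τ (F : dom M σ -> env M Γ -> dom M τ) :
  def (fun ρ : env M (σ :: Γ) => F (fst ρ) (snd ρ)) ->
  def (fun ρ => lam (fun x => F x ρ)).
Proof.
move=> [c hc]; exists c => ρ; apply: app_ext => x.
have hh y : app (apps (Γ := Γ) (τ := σ ⟶ τ) c ρ) y = F y ρ by exact: (hc (y, ρ)).
by rewrite hh lamP //; exists (apps (Γ := Γ) (τ := σ ⟶ τ) c ρ).
Qed.

Lemma lam2E ρ σ τ (F : dom M ρ -> dom M σ -> dom M τ) x y :
  def (fun r : env M [:: σ; ρ] => F (fst (snd r)) (fst r)) ->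
  app (app (lam (fun x => lam (F x))) x) y = F x y.
Proof.
move=> hF; rewrite lamE.
  case: hF => c hc; apply: lamP.
  by exists (apps (Γ := [:: ρ]) (τ := σ ⟶ τ) c (x, tt)) => z; exact: (hc (z, (x, tt))).
exact: (@def_lam [:: ρ] σ τ (fun y r => F (fst r) y) hF).
Qed.

Lemma lam_env Γ σ τ (F : env M (σ :: Γ) -> dom M τ) (ρ : env M Γ) x :
  def F -> app (lam (fun x => F (x, ρ))) x = F (x, ρ).
Proof. by move=> [c hc]; apply: lamP; exists (apps (τ := σ ⟶ τ) c ρ) => y; exact: (hc (y, ρ)). Qed.

Lemma def_lam_env Γ σ τ (F : env M (σ :: Γ) -> dom M τ) :
  def F -> def (fun ρ => lam (fun x => F (x, ρ))).
Proof. by move=> h; apply: def_lam; apply: def_ext h; case. Qed.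

Lemma def_add Γ (F G : env M Γ -> N) : @def Γ tN F -> @def Γ tN G ->
  @def Γ tN (fun ρ => F ρ + G ρ).
Proof. by move=> hF hG; apply: (def_app (def_app (def_const _ plusM) hF) hG). Qed.

Lemma def_mul Γ (F G : env M Γ -> N) : @def Γ tN F -> @def Γ tN G ->
  @def Γ tN (fun ρ => F ρ * G ρ).
Proof. by move=> hF hG; apply: (def_app (def_app (def_const _ timesM) hF) hG). Qed.

End Definability.

Ltac defn1 := cbv beta; first
  [ assumption | apply: def_const | apply: def_v0 | apply: def_v1 | apply: def_v2
  | apply: def_v3 | apply: def_v4 | apply: def_v5
  | apply: def_add | apply: def_mul | apply: def_app | apply: def_lam ].
Ltac defn := repeat defn1.

(** Arithmetic of numbers is done in the rationals: hypotheses and goal are transported along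
    [qnat], which is then pushed to the atoms, each atom is declared nonnegative, and linear or
    nonlinear arithmetic finishes. *)
Ltac nify :=
  repeat match goal with
  | H : ltN _ _ |- _ => move/qnat_ltS: H => H
  | H : leN _ _ |- _ => move/qnat_le: H => H
  | H : @eq _ _ _ |- _ => apply (congr1 (@qnat _)) in H
  end.
Ltac ngoal :=
  match goal with
  | |- ltN _ _ => apply/qnat_ltS
  | |- leN _ _ => apply/qnat_le
  | |- @eq _ _ _ => try apply: qnat_inj
  | |- _ => idtac
  end.
Ltac natoms :=
  repeat match goal with
  | |- context [@qnat ?M ?x] =>
    lazymatch goal with
    | _ : is_true (0 <= @qnat M x) |- _ => fail
    | _ => have := @qnat_ge0 M x; move=> ?
    end
  | _ : context [@qnat ?M ?x] |- _ =>
    lazymatch goal with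
    | _ : is_true (0 <= @qnat M x) |- _ => fail
    | _ => have := @qnat_ge0 M x; move=> ?
    end
  end.
Ltac npush :=
  rewrite ?(qnatD, qnatM, qnat0, qnat1);
  repeat match goal with
  | H : context [@qnat _ (_ + _)] |- _ => rewrite !qnatD in H
  | H : context [@qnat _ (_ * _)] |- _ => rewrite !qnatM in H
  | H : context [@qnat _ 0] |- _ => rewrite !qnat0 in H
  | H : context [@qnat _ 1] |- _ => rewrite !qnat1 in H
  end.
Ltac nlra := ngoal; nify; npush; natoms; lra.
Ltac nnra := ngoal; nify; npush; natoms; nra.

(** * Cut-off subtraction and decidable predicates *)

Section Arithmetic.
Variable M : wmodel.
Notation N := (NN M).
Local Notation ι := (@qnat M).

Lemma qf_choice10 Γ (A : form (tN :: t1 :: Γ)) (ρ : env M Γ) : qfree A ->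
  (forall f : dom M t1, exists y, sat A (y, (f, ρ))) ->
  exists Y : dom M t2, forall f, sat A (app Y f, (f, ρ)).
Proof.
move=> hA; apply/sat_choice.
exact: (wax (ax_QF_AC10 (ax_QF_AC hA))).
Qed.

(* The arguments x and y are coded by the function n => x + n * y. *)
Lemma sub_exists : exists s : dom M (tN ⟶ tN ⟶ tN), forall x y : N,
  (leN y x -> (app (app s x) y : N) + y = x) /\ (leN x y -> app (app s x) y = 0 :> N).
Proof.
(* Here f(0) = x and f(1) = x + y, so comparing x + x with x + y compares x with y, and z is the
   cut-off difference. *)
pose A : form [:: tN; t1] := (let f := Var (vs _ vz) in let z := Var vz in
  (f · Zero) ⊕ (f · Zero) ≐ (f · One) ⊕ z ∨
  ((f · Zero) ⊕ (f · Zero) ≺ (f · One) ∧ z ≐ Zero))%fm.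
have [|f|Y hY] := @qf_choice10 nil A tt; first by [].
  pose x : N := app f (0 : N); pose w : N := app f (1 : N).
  case: (leN_total w (x + x)) => h.
    by have [z hz] := (leNP _ _).1 h; exists z; left.
  case: h => h; exists (0 : N); first by right.
  by left; have e : x + x = w + 0 by [rewrite h addr0]; exact: e.
pose s : dom M (tN ⟶ tN ⟶ tN) := lam (fun x : N => lam (fun y : N =>
  app Y (lam (fun n : N => x + n * y : dom M tN) : dom M t1))).
exists s => x y.
have e : app (app s x) y = app Y (lam (fun n : N => x + n * y : dom M tN) : dom M t1).
  by rewrite /s lamE ?lamE //; defn.
have := hY (lam (fun n : N => x + n * y : dom M tN) : dom M t1).
rewrite -e; move: (app (app s x) y) => z.
rewrite /= !lamE; try defn.
move=> [h|[h1 h2]].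
  have {}h : (x + 0 * y) + (x + 0 * y) = (x + 1 * y) + (z : N) := h.
  by split=> h'; nlra.
have {}h1 : ltN ((x + 0 * y) + (x + 0 * y)) (x + 1 * y) := h1.
split=> h'; last by [].
by exfalso; nlra.
Qed.

Definition subM : dom M (tN ⟶ tN ⟶ tN) := projT1 (cid sub_exists).
Definition subN (x y : N) : N := app (app subM x) y.

Lemma subN_le (x y : N) : leN y x -> subN x y + y = x.
Proof. by case: (projT2 (cid sub_exists) x y). Qed.
Lemma subN_ge (x y : N) : leN x y -> subN x y = 0.
Proof. by case: (projT2 (cid sub_exists) x y). Qed.

Lemma subN_eq0 (x y : N) : subN x y = 0 <-> leN x y.
Proof.
split; last exact: subN_ge.
move=> h; case: (leN_total x y) => // h'; have := subN_le h'; rewrite h add0r => ->.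
exact: leN_refl.
Qed.

Lemma def_sub Γ (F G : env M Γ -> N) : @def M Γ tN F -> @def M Γ tN G ->
  @def M Γ tN (fun ρ => subN (F ρ) (G ρ)).
Proof. by move=> hF hG; apply: (def_app (def_app (def_const _ subM) hF) hG). Qed.

(** Decidability in the sense of the model, with 0 for truth. Induction, choice and comprehension of
    the model extend from equations to these predicates. *)
Definition dec Γ (P : env M Γ -> Prop) :=
  exists2 F : env M Γ -> N, @def M Γ tN F & forall ρ, P ρ <-> F ρ = 0.

Lemma dec_ext Γ (P Q : env M Γ -> Prop) : (forall ρ, P ρ <-> Q ρ) -> dec P -> dec Q.
Proof. by move=> h [F hF hP]; exists F => // ρ; rewrite -h. Qed.

Lemma dec_const Γ (P : Prop) : dec (fun _ : env M Γ => P).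
Proof.
case: (pselect P) => h.
  by exists (fun _ => 0); [exact: def_const|].
by exists (fun _ => 1); [exact: def_const|move=> ρ; split=> // /oneN_neq0].
Qed.

Lemma dec_le Γ (F G : env M Γ -> N) : @def M Γ tN F -> @def M Γ tN G ->
  dec (fun ρ => leN (F ρ) (G ρ)).
Proof.
move=> hF hG; exists (fun ρ => subN (F ρ) (G ρ)); first exact: def_sub.
by move=> ρ; rewrite subN_eq0.
Qed.

Lemma dec_lt Γ (F G : env M Γ -> N) : @def M Γ tN F -> @def M Γ tN G ->
  dec (fun ρ => ltN (F ρ) (G ρ)).
Proof.
move=> hF hG; apply: (@dec_ext _ (fun ρ => leN (F ρ + 1) (G ρ))).
  by move=> ρ; rewrite ltN_le.
by apply: dec_le => //; apply: def_add => //; apply: def_const.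
Qed.

Lemma addN_eq0 (x y : N) : x + y = 0 <-> x = 0 /\ y = 0.
Proof. by split=> [h|[-> ->]]; [split; nlra|rewrite addr0]. Qed.

Lemma mulN_eq0 (x y : N) : x * y = 0 <-> x = 0 \/ y = 0.
Proof.
split=> [h|[->|->]]; [|by rewrite mul0r|by rewrite mulr0].
case: (leN_0 x) => hx; [right|by left]; apply: (mulN_inj hx).
by rewrite mulrC h mul0r.
Qed.

Lemma dec_and Γ (P Q : env M Γ -> Prop) : dec P -> dec Q -> dec (fun ρ => P ρ /\ Q ρ).
Proof.
move=> [F hF hP] [G hG hQ]; exists (fun ρ => F ρ + G ρ); first exact: def_add.
by move=> ρ; rewrite addN_eq0 hP hQ.
Qed.

Lemma dec_or Γ (P Q : env M Γ -> Prop) : dec P -> dec Q -> dec (fun ρ => P ρ \/ Q ρ).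
Proof.
move=> [F hF hP] [G hG hQ]; exists (fun ρ => F ρ * G ρ); first exact: def_mul.
by move=> ρ; rewrite mulN_eq0 hP hQ.
Qed.

Lemma neqN0 (x : N) : x <> 0 <-> leN 1 x.
Proof.
split=> [h|h e]; last by rewrite e in h; nlra.
by case: (leN_0 x) => [/ltN_le|e]; [rewrite add0r|case: h].
Qed.

Lemma dec_not Γ (P : env M Γ -> Prop) : dec P -> dec (fun ρ => ~ P ρ).
Proof.
move=> [F hF hP]; exists (fun ρ => subN 1 (F ρ)).
  by apply: def_sub => //; apply: def_const.
by move=> ρ; rewrite subN_eq0 hP neqN0.
Qed.

Lemma dec_imp Γ (P Q : env M Γ -> Prop) : dec P -> dec Q -> dec (fun ρ => P ρ -> Q ρ).
Proof.
move=> hP hQ; apply: dec_ext (dec_or (dec_not hP) hQ) => ρ.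
by split=> [[]|h]; [|by []|case: (pselect (P ρ)) => [/h|]; [right|left]].
Qed.

Lemma dec_eq Γ (F G : env M Γ -> N) : @def M Γ tN F -> @def M Γ tN G ->
  dec (fun ρ => F ρ = G ρ).
Proof.
move=> hF hG; apply: dec_ext (dec_and (dec_le hF hG) (dec_le hG hF)) => ρ.
by split=> [[h1 h2]|->]; [apply: leN_anti|split; right].
Qed.

Lemma def_if Γ (P : env M Γ -> Prop) (F G : env M Γ -> N) : dec P ->
  @def M Γ tN F -> @def M Γ tN G ->
  @def M Γ tN (fun ρ => if `[< P ρ >] then F ρ else G ρ).
Proof.
move=> [H hH hP] hF hG.
(* Cut-off subtraction from 1 turns the characteristic value into the indicator of P, and applied
   again into that of its complement. *)
apply: (@def_ext M _ _ (fun ρ => subN 1 (H ρ) * F ρ + subN 1 (subN 1 (H ρ)) * G ρ)).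
  move=> ρ; case: asboolP => [/hP ->|h].
    have -> : subN 1 0 = 1 by have := @subN_le 1 0 (leN_0 _); rewrite addr0.
    by rewrite (@subN_ge 1 1 (leN_refl _)) mul1r mul0r addr0.
  have -> : subN 1 (H ρ) = 0 by apply: subN_ge; apply/neqN0 => /hP.
  have -> : subN 1 0 = 1 by have := @subN_le 1 0 (leN_0 _); rewrite addr0.
  by rewrite mul0r mul1r add0r.
by apply: def_add; apply: def_mul => //; repeat (apply: def_sub => //); apply: def_const.
Qed.

End Arithmetic.

(** * Choice, recursion, pairing and the second-order axioms *)

Section Arithmetic2.
Variable M : wmodel.
Notation N := (NN M).
Local Notation ι := (@qnat M).

Lemma dec_fun1 Γ σ (P : env M (σ :: Γ) -> Prop) (ρ : env M Γ) : dec P ->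
  exists h : dom M (σ ⟶ tN), forall x, P (x, ρ) <-> app h x = (0 : N).
Proof.
move=> [F [c hc] hP]; exists (apps (τ := σ ⟶ tN) c ρ) => x.
by rewrite hP -hc.
Qed.

Lemma dec_fun2 Γ σ τ (P : env M (τ :: σ :: Γ) -> Prop) (ρ : env M Γ) : dec P ->
  exists h : dom M (σ ⟶ τ ⟶ tN), forall x y, P (y, (x, ρ)) <-> app (app h x) y = (0 : N).
Proof.
move=> [F [c hc] hP]; exists (apps (τ := σ ⟶ τ ⟶ tN) c ρ) => x y.
by rewrite hP -hc.
Qed.

Lemma fun_ind (h : dom M t1) : app h (0 : N) = (0 : N) ->
  (forall n : N, app h n = (0 : N) -> app h (n + 1 : N) = (0 : N)) ->
  forall n : N, app h n = (0 : N).
Proof.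
move=> h0 hS n.
exact: (@qf_induction M [:: t1] (Var (vs _ vz) · Var vz ≐ Zero)%fm (h, tt) _ h0 hS n).
Qed.

Lemma dec_ind Γ (P : N -> Prop) (ρ : env M Γ) (Q : env M (tN :: Γ) -> Prop) :
  dec Q -> (forall n : N, P n <-> Q (n : dom M tN, ρ)) ->
  P 0 -> (forall n, P n -> P (n + 1)) -> forall n, P n.
Proof.
move=> hQ hPQ h0 hS n; have [h hh] := dec_fun1 ρ hQ.
apply/hPQ/hh; apply: fun_ind => [|m]; first exact/hh/hPQ.
by move=> /hh/hPQ/hS/hPQ/hh.
Qed.

Lemma numind (P : N -> Prop) : dec (fun ρ : env M [:: tN] => P (fst ρ)) ->
  P 0 -> (forall n, P n -> P (n + 1)) -> forall n, P n.
Proof. by move=> hP; apply: (@dec_ind nil P tt _ hP). Qed.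

Lemma fun_choice10 (h : dom M (t1 ⟶ tN ⟶ tN)) :
  (forall f, exists y : N, app (app h f) y = (0 : N)) ->
  exists Y : dom M t2, forall f, app (app h f) (app Y f) = (0 : N).
Proof.
exact: (@qf_choice10 M [:: (t1 ⟶ tN ⟶ tN)%ty]
  (Var (vs _ (vs _ vz)) · Var (vs _ vz) · Var vz ≐ Zero)%fm (h, tt)).
Qed.

(** QF-AC^{0,0} from QF-AC^{1,0}: a number is coded by the constant function with that value. *)
Lemma fun_choice00 (h : dom M (tN ⟶ tN ⟶ tN)) :
  (forall x : N, exists y : N, app (app h x) y = (0 : N)) ->
  exists f : dom M t1, forall x : N, app (app h x) (app f x) = (0 : N).
Proof.
move=> hh.
pose h' : dom M (t1 ⟶ tN ⟶ tN) := lam (fun f : dom M t1 => app h (app f (0 : N))).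
have e f y : app (app h' f) y = app (app h (app f (0 : N))) y.
  by rewrite /h' lamE //; defn.
have [|Y hY] := @fun_choice10 h'.
  by move=> f; have [y hy] := hh (app f (0 : N)); exists y; rewrite e.
exists (lam (fun x : N => app Y (lam (fun _ : N => x) : dom M t1))) => x.
rewrite lamE; last by defn.
have := hY (lam (fun _ : N => x) : dom M t1).
by rewrite e lamE //; defn.
Qed.

Lemma numchoice (P : N -> N -> Prop) :
  dec (fun ρ : env M [:: tN; tN] => P (fst (snd ρ)) (fst ρ)) ->
  (forall x, exists y, P x y) ->
  exists f : dom M t1, forall x : N, P x (app f x).
Proof.
move=> hd hP; have [h hh] := @dec_fun2 nil tN tN _ tt hd; simpl in hh.
have [|f hf] := @fun_choice00 h; last by exists f => x; apply/hh.
by move=> x; have [y /hh] := hP x; exists y.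
Qed.

Lemma comprehension_fun Γ (P : env M (tN :: Γ) -> Prop) (ρ : env M Γ) : dec P ->
  exists X : dom M t1, (forall n : N, leN (app X n : N) 1) /\
    forall n : N, app X n = (1 : N) <-> P (n : dom M tN, ρ).
Proof.
move=> hP; have hF : @def M (tN :: Γ) tN (fun ρ => if `[< P ρ >] then 1 else 0 : N).
  by apply: def_if => //; apply: def_const.
have [c hc] := def_lam_env hF.
exists (apps c ρ); rewrite hc; split=> n; rewrite (@lam_env M Γ tN tN _ _ _ hF).
  by case: asboolP => _; [right|exact: leN_0].
by case: asboolP => h; split=> // e; case: (@oneN_neq0 M); rewrite -[LHS]e.
Qed.

(** A discrete intermediate value principle: without a crossing, induction would keep the whole
    sequence below p. Square root, division by three, integer parts and string lengths are all
    obtained from it. *)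
Lemma between (g : dom M t1) (p : N) : leN (app g (0 : N) : N) p ->
  (exists k : N, ltN p (app g k : N)) ->
  exists m : N, leN (app g m : N) p /\ ltN p (app g (m + 1 : N) : N).
Proof.
move=> h0 [k hk]; apply: contrapT => hn.
have : forall m : N, leN (app g m : N) p.
  apply: numind => //; first by apply: dec_le; defn.
  move=> m hm; apply: contrapT => h; apply: hn; exists m; split=> //.
  exact/ltN_leF.
by move=> /(_ k); apply/ltN_leF.
Qed.

Lemma sqrt_exists : exists f : dom M t1, forall s : N,
  leN ((app f s : N) * (app f s : N)) s /\
  ltN s (((app f s : N) + 1) * ((app f s : N) + 1)).
Proof.
apply: (@numchoice (fun s w => leN (w * w) s /\ ltN s ((w + 1) * (w + 1)))).
  by apply: dec_and; [apply: dec_le|apply: dec_lt]; defn.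
move=> s; pose g : dom M t1 := lam (fun w : N => w * w : dom M tN).
have gE (w : N) : app g w = w * w by rewrite /g lamE //; defn.
have [||m [h1 h2]] := @between g s.
- by rewrite gE mul0r; exact: leN_0.
- by exists (s + 1); rewrite gE; nnra.
by exists m; rewrite -!gE.
Qed.

Definition sqrtM : dom M t1 := projT1 (cid sqrt_exists).
Lemma sqrtP (s : N) : leN ((app sqrtM s : N) * (app sqrtM s : N)) s /\
  ltN s (((app sqrtM s : N) + 1) * ((app sqrtM s : N) + 1)).
Proof. exact: (projT2 (cid sqrt_exists) s). Qed.

Definition pairN (i j : N) : N := (i + j) * (i + j) + i.

(** The code lies between the square of i + j and that of i + j + 1, so the integer square root
    recovers i + j, from which both components follow. *)
Lemma sqrt_pair (i j : N) : app sqrtM (pairN i j) = i + j.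
Proof.
have [] := sqrtP (pairN i j); move: (app sqrtM _) => w; rewrite /pairN => h1 h2.
apply: leN_anti; apply: contrapT => /ltN_leF h.
  have h3 : ltN (i + j) w by [].
  by nnra.
have h3 : ltN w (i + j) by [].
by nnra.
Qed.

Definition fstM : dom M t1 := lam (fun s : N =>
  subN s ((app sqrtM s : N) * (app sqrtM s : N))).
Definition sndM : dom M t1 := lam (fun s : N =>
  subN (app sqrtM s : N) (app fstM s : N)).

Lemma fst_pair (i j : N) : app fstM (pairN i j) = i.
Proof.
rewrite lamE; last by apply: def_sub; defn.
rewrite sqrt_pair.
have h : leN ((i + j) * (i + j)) (pairN i j) by rewrite leNP; exists i.
by apply: (@addN_inj _ _ _ ((i + j) * (i + j))); rewrite (subN_le h) /pairN addrC.
Qed.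

Lemma snd_pair (i j : N) : app sndM (pairN i j) = j.
Proof.
rewrite lamE; last by apply: def_sub; defn.
rewrite sqrt_pair fst_pair.
have h : leN i (i + j) by rewrite leNP; exists j.
by apply: (@addN_inj _ _ _ i); rewrite (subN_le h) addrC.
Qed.

(** The recursor of the language only iterates a unary function. Iterating on pairs of a counter and
    a value gives a recursor whose step may depend on the counter. *)
Lemma rec_exists : exists r : dom M ((tN ⟶ tN ⟶ tN) ⟶ tN ⟶ tN ⟶ tN),
  forall h m, app (app (app r h) m) (0 : N) = m /\
  forall n : N, app (app (app r h) m) (n + 1 : N) = app (app h n) (app (app (app r h) m) n).
Proof.
pose stp (h : dom M (tN ⟶ tN ⟶ tN)) : dom M t1 := lam (fun s : N =>
   pairN ((app fstM s : N) + 1) (app (app h (app fstM s)) (app sndM s) : N)).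
pose r : dom M ((tN ⟶ tN ⟶ tN) ⟶ tN ⟶ tN ⟶ tN) :=
  lam (fun h => lam (fun m => lam (fun n =>
    app sndM (app (app (app (@RM M) (stp h)) (pairN (0 : N) m)) n)))).
have dp Γ (F G : env M Γ -> N) : @def M Γ tN F -> @def M Γ tN G ->
    @def M Γ tN (fun ρ => pairN (F ρ) (G ρ)).
  by move=> hF hG; rewrite /pairN; defn.
exists r => h m.
have rE n : app (app (app r h) m) n = app sndM (app (app (app (@RM M) (stp h)) (pairN (0 : N) m)) n).
  by rewrite /r lamE ?lamE ?lamE // /stp; repeat (first [apply: dp|defn1]).
have stpE (s : N) : app (stp h) s = pairN ((app fstM s : N) + 1) (app (app h (app fstM s)) (app sndM s) : N).
  by rewrite /stp lamE //; repeat (first [apply: dp|defn1]).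
split=> [|n]; rewrite !rE; first by rewrite appR0 snd_pair.
have e : app fstM (app (app (app (@RM M) (stp h)) (pairN (0 : N) m)) n) = n.
  move: n; apply: numind; first by apply: dec_eq; defn.
    by rewrite appR0 fst_pair.
  by move=> n IH; rewrite appRS stpE fst_pair IH.
by rewrite appRS stpE snd_pair e.
Qed.

Definition recM := projT1 (cid rec_exists).
Lemma rec0 h m : app (app (app recM h) m) (0 : N) = m.
Proof. exact: (projT2 (cid rec_exists) h m).1. Qed.
Lemma recS h m (n : N) :
  app (app (app recM h) m) (n + 1 : N) = app (app h n) (app (app (app recM h) m) n).
Proof. exact: (projT2 (cid rec_exists) h m).2. Qed.

Definition sumM : dom M (t1 ⟶ tN ⟶ tN) := lam (fun f : dom M t1 =>
  app (app recM (lam (fun i : N => lam (fun s : N => s + (app f i : N) : dom M tN)) : dom M (tN ⟶ tN ⟶ tN))) (0 : N)).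

Lemma sum0 f : app (app sumM f) (0 : N) = (0 : N).
Proof. by rewrite /sumM lamE ?rec0 //; defn. Qed.
Lemma sumS f (n : N) : app (app sumM f) (n + 1 : N) = (app (app sumM f) n : N) + (app f n : N).
Proof. by rewrite /sumM lamE ?recS ?lamE ?lamE //; defn. Qed.

(** The device behind bounded quantifiers: a sum of natural numbers vanishes exactly when all
    summands do, so the sum of characteristic values is the characteristic value of the bounded
    universal statement. *)
Lemma sum_eq0 f (n : N) : app (app sumM f) n = (0 : N) <->
  forall i : N, ltN i n -> app f i = (0 : N).
Proof.
split=> [h i|h].
  apply: contrapT => /not_implyP [hi hf].
  suff : forall n : N, ltN i n -> app (app sumM f) n <> (0 : N) by move=> /(_ n hi).
  move=> {h n hi}; apply: numind.
  - by apply: dec_imp; [apply: dec_lt|apply: dec_not; apply: dec_eq]; defn.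
  - by move/ltN_0.
  - move=> n IH /ltN_S hi; rewrite sumS => /addN_eq0 [h1 h2].
    by case: hi => [/IH//|e]; apply: hf; rewrite e.
suff : forall k : N, leN k n -> app (app sumM f) k = (0 : N) by apply; exact: leN_refl.
apply: numind.
- by apply: dec_imp; [apply: dec_le|apply: dec_eq]; defn.
- by rewrite sum0.
- move=> k IH /ltN_le hk; rewrite sumS IH ?h ?addr0 //.
  by left.
Qed.

Lemma dec_ball_env Γ (P : env M (tN :: Γ) -> Prop) (G : env M Γ -> N) :
  dec P -> @def M Γ tN G -> dec (fun ρ => forall x : N, ltN x (G ρ) -> P (x : dom M tN, ρ)).
Proof.
move=> [F hF hP] hG.
exists (fun ρ => app (app sumM (lam (fun x => F (x, ρ)))) (G ρ)).
  by have h := def_lam_env hF; defn.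
move=> ρ; rewrite sum_eq0; split=> h i /h; first by move/hP; rewrite (@lam_env M Γ tN tN).
by rewrite (@lam_env M Γ tN tN _ _ _ hF) => /hP.
Qed.

Lemma dec_ball Γ (P : N -> env M Γ -> Prop) (G : env M Γ -> N) :
  dec (fun ρ : env M (tN :: Γ) => P (fst ρ) (snd ρ)) ->
  @def M Γ tN G -> dec (fun ρ => forall x : N, ltN x (G ρ) -> P x ρ).
Proof. by move=> hP hG; have := dec_ball_env hP hG. Qed.

Lemma dec_bex Γ (P : N -> env M Γ -> Prop) (G : env M Γ -> N) :
  dec (fun ρ : env M (tN :: Γ) => P (fst ρ) (snd ρ)) ->
  @def M Γ tN G -> dec (fun ρ => exists x : N, ltN x (G ρ) /\ P x ρ).
Proof.
move=> hP hG; have := dec_not (dec_ball (P := fun x ρ => ~ P x ρ) (dec_not hP) hG).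
apply: dec_ext => ρ; split=> [h|[x [h1 h2]] h]; last by apply: (h x h1).
apply: contrapT => h'; by apply: h => x h1 h2; apply: h'; exists x.
Qed.

Lemma dec_bounded Γ (A : form Γ) : bounded A -> dec (fun ρ : env M Γ => sat A ρ).
Proof.
elim=> {Γ A} [Γ t u|Γ t u|Γ|Γ A B _ IA _ IB|Γ A B _ IA _ IB|Γ A B _ IA _ IB
  |Γ t A _ IA|Γ t A _ IA].
- by apply: dec_eq; apply: def_eval.
- by apply: dec_lt; apply: def_eval.
- exact: dec_const.
- exact: dec_imp.
- exact: dec_and.
- exact: dec_or.
- apply: dec_ext (dec_ball_env IA (def_eval M t)) => ρ /=.
  by split=> h x; have := h x; rewrite eval_wk.
- have := dec_not (dec_ball_env (dec_not IA) (def_eval M t)).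
  apply: dec_ext => ρ /=; split=> [h|[x []]]; last first.
    by rewrite eval_wk => h1 h2 h; apply: (h x h1).
  apply: contrapT => h'; apply: h => x h1 h2; apply: h'; exists x.
  by rewrite eval_wk.
Qed.

Definition E2_at (φ : dom M t2) := forall f : dom M t1,
  (exists n : N, app f n = (0 : N)) <-> app φ f = (0 : N).

Lemma dec_ex φ Γ (P : env M (tN :: Γ) -> Prop) : E2_at φ -> dec P ->
  dec (fun ρ => exists x : N, P (x : dom M tN, ρ)).
Proof.
move=> hφ [F hF hP]; exists (fun ρ => app φ (lam (fun x => F (x, ρ)))).
  by have h := def_lam_env hF; defn.
move=> ρ; rewrite -hφ; split=> -[x hx]; exists x; move: hx.
  by move/hP; rewrite (@lam_env M Γ tN tN).
by rewrite (@lam_env M Γ tN tN _ _ _ hF) => /hP.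
Qed.

(** Number quantifiers are absorbed by φ, applied to the characteristic function of the matrix.
    Parameters of every finite type are allowed, so quantifier-free schemes become available for
    such formulas. *)
Lemma dec_numerical φ Γ (A : form Γ) : E2_at φ -> numerical A ->
  dec (fun ρ : env M Γ => sat A ρ).
Proof.
move=> hφ; elim: A => {Γ} [Γ t u|Γ t u|Γ|Γ A IA B IB|Γ A IA B IB|Γ A IA B IB|Γ τ A IA|Γ τ A IA] /=.
- by move=> _; apply: dec_eq; apply: def_eval.
- by move=> _; apply: dec_lt; apply: def_eval.
- by move=> _; exact: dec_const.
- by move=> [/IA hA /IB hB]; exact: dec_imp.
- by move=> [/IA hA /IB hB]; exact: dec_and.
- by move=> [/IA hA /IB hB]; exact: dec_or.
- move=> [e hA]; subst τ; have := dec_not (dec_ex hφ (dec_not (IA hA))).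
  apply: dec_ext => ρ; split=> [h x|h [x hx]]; last exact/hx/h.
  by apply: contrapT => h'; apply: h; exists x.
- by move=> [e hA]; subst τ; exact: dec_ex hφ (IA hA).
Qed.

(** Σ⁰₁-induction from quantifier-free induction: choice yields a function taking a witness for n to
    a witness for n + 1, recursion iterates it from [m0], and the statement that the iterates are
    witnesses is an equation. *)
Lemma fun_sigma_ind (h : dom M (tN ⟶ tN ⟶ tN)) :
  (exists m : N, app (app h (0 : N)) m = (0 : N)) ->
  (forall n : N, (exists m : N, app (app h n) m = (0 : N)) ->
     exists m : N, app (app h (n + 1 : N)) m = (0 : N)) ->
  forall n : N, exists m : N, app (app h n) m = (0 : N).
Proof.
move=> [m0 h0] hS.
have [||g hg] := @numchoice (fun s m =>
  app (app h (app fstM s)) (app sndM s) = (0 : N) ->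
  app (app h ((app fstM s : N) + 1 : N)) m = (0 : N)).
- by apply: dec_imp; apply: dec_eq; defn.
- move=> s; case: (pselect (app (app h (app fstM s)) (app sndM s) = (0 : N))) => hs.
    by have [|m hm] := hS (app fstM s : N); [exists (app sndM s : N)|exists m].
  by exists 0.
pose k : dom M (tN ⟶ tN ⟶ tN) := lam (fun n : N => lam (fun m : N => app g (pairN n m))).
have kE (n m : N) : app (app k n) m = app g (pairN n m).
  by rewrite /k /pairN lamE ?lamE //; defn.
pose r (n : N) : N := app (app (app recM k) m0) n.
suff hr : forall n : N, app (app h n) (r n) = (0 : N) by move=> n; exists (r n).
apply: numind; first by apply: dec_eq; rewrite /r; defn.
  by rewrite /r rec0.
move=> n hn; rewrite /r recS kE -/(r n).
by have := hg (pairN n (r n)); rewrite fst_pair snd_pair; apply.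
Qed.

Lemma sat_equivalence Γ (A B : form (tN :: Γ)) (ρ : env M Γ) :
  sat (∀ n : tN, at1 A n ⇔ at1 B n)%fm ρ ->
  forall n : dom M tN, sat A (n, ρ) <-> sat B (n, ρ).
Proof.
rewrite /fall /= => h n.
by have := h n; rewrite /= !sat_at1 !ext_env_step !ext_env_refl => -[h1 h2]; split.
Qed.

Theorem RCA0_holds : models M RCA0.
Proof.
move=> Γ A [] {Γ A} Γ.
- move=> A [] {Γ A} Γ ρ.
  + by move=> n e; have {}e : (n : N) + 1 = 0 := e; nlra.
  + by move=> m n e; have {}e : (m : N) + 1 = (n : N) + 1 := e; apply: (addN_inj e).
  + by move=> m; exact: (addr0 (m : N)).
  + by move=> m n; exact: (addrA (m : N) n 1).
  + by move=> m; exact: (mulr0 (m : N)).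
  + move=> m n; have e : (m : N) * ((n : N) + 1) = (m : N) * n + m by ring.
    exact: e.
  + by move=> m; exact: (@ltN_0 M m).
  + by move=> m n; exact: (ltN_S m n).
- move=> A [B [_ [hB ->]]] ρ; apply/sat_ind_axiom => h0 hS.
  have [h hh] := dec_fun2 ρ (dec_bounded hB).
  have := @fun_sigma_ind h; move=> hi n.
  have [||m /hh hm] := hi _ _ n; last by exists m.
    by case: h0 => m /hh hm; exists m.
  move=> k [m /hh hm]; have [|m' /hh hm'] := hS k; first by exists m.
  by exists m'.
- move=> A B [A' [_ [hA ->]]] [B' [_ [hB ->]]] ρ.
  enough (sat (∀ n : tN, at1 (Ex A') n ⇔ at1 (All B') n)%fm ρ ->
      sat (comprehension (Ex A')) ρ) by assumption.
  move=> /sat_equivalence hAB.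
  apply: (iffRL (@sat_comprehension M Γ (Ex A') ρ)).
  (* For every n some m decides the matter, by verifying A' or by refuting B'. Choice gives such an
     m as f(n), and the set consists of the n for which A' holds at f(n). *)
  have hd := dec_or (dec_bounded hA) (dec_not (dec_bounded hB)).
  have [h hh] := dec_fun2 ρ hd.
  have [|f hf] := @fun_choice00 h.
    move=> n; case: (pselect (exists m, sat A' (m, (n : dom M tN, ρ)))) => [[m hm]|hn].
      by exists m; apply/hh; left.
    have /existsNP [m hm] : ~ forall m, sat B' (m, (n : dom M tN, ρ)) by move/hAB.
    by exists m; apply/hh; right.
  have hP : dec (fun ρ' : env M (tN :: t1 :: Γ) => sat A' (app (fst (snd ρ')) (fst ρ'), (fst ρ', snd (snd ρ')))).
    have [F hF hP] := dec_bounded hA.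
    exists (fun ρ' : env M (tN :: t1 :: Γ) => F (app (fst (snd ρ')) (fst ρ'), (fst ρ', snd (snd ρ')))) => //.
    have := @def_env M (tN :: t1 :: Γ) (tN :: tN :: Γ) tN F
      (scons (Var (vs _ vz) · Var vz)%fm (scons (Var vz) (fun τ v => Var (vs _ (vs _ v))))) hF.
    apply: def_ext => -[x [g ρ']]; congr F; congr pair; congr pair.
    by rewrite -[RHS]tab_look.
  have [X [h1 h2]] := @comprehension_fun (t1 :: Γ) _ (f, ρ) hP.
  exists X; split=> // n; apply: (iff_trans (h2 n)) => /=.
  split=> [hx|hx]; first by exists (app f n).
  case: (iffRL (hh _ _) (hf n)) => // hn.
  by case: hn; exact: (iffLR (hAB n) hx (app f n)).
- move=> ρ X _ hX.
  have [||f hf] := @numchoice (fun n m => app X (pairN n m) = (1 : N)).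
  + by apply: dec_eq; rewrite /pairN; defn.
  + by move=> n; have [m [hm _]] := hX n; exists m.
  by exists f => n; exact: hf.
Qed.

Theorem arith_CA_holds φ : E2_at φ -> models M arith_CA.
Proof.
move=> hφ Γ A [] {Γ A} Γ A [_ hA] ρ; apply: (iffRL (@sat_comprehension M Γ A ρ)).
exact: (comprehension_fun ρ (dec_numerical hφ hA)).
Qed.

End Arithmetic2.

Ltac decn1 := cbv beta; first
  [ apply: dec_const | apply: dec_and | apply: dec_or | apply: dec_not
  | apply: dec_ball | apply: dec_bex
  | apply: dec_le | apply: dec_lt | apply: dec_eq | apply: dec_imp
  | apply: def_sub | apply: def_if | defn1 ].
Ltac decn := repeat decn1.

(** * Real numbers of a model *)

Section Reals.
Variable M : wmodel.
Notation N := (NN M).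
Notation Q := (QQ M).
Local Notation ι := (@qnat M).

Definition frac (p m d : N) : Q := (ι p - ι m) / ι d.

Lemma qnat_gt0 (d : N) : ltN 0 d <-> 0 < ι d.
Proof. by rewrite qnat_lt qnat0. Qed.

Lemma frac_lt (p m d p' m' d' : N) : ltN 0 d -> ltN 0 d' ->
  ltN (p * d' + m' * d) (p' * d + m * d') <-> frac p m d < frac p' m' d'.
Proof.
move=> /qnat_gt0 h /qnat_gt0 h'; rewrite qnat_lt /frac ltr_pdivrMr // mulrAC ltr_pdivlMr //.
by rewrite !(qnatD, qnatM); split=> hh; lra.
Qed.

Lemma frac_le (p m d p' m' d' : N) : ltN 0 d -> ltN 0 d' ->
  leN (p * d' + m' * d) (p' * d + m * d') <-> frac p m d <= frac p' m' d'.
Proof.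
move=> /qnat_gt0 h /qnat_gt0 h'; rewrite qnat_le /frac ler_pdivrMr // mulrAC ler_pdivlMr //.
by rewrite !(qnatD, qnatM); split=> hh; lra.
Qed.

Lemma fracD (p m d p' m' d' : N) : ltN 0 d -> ltN 0 d' ->
  frac (p * d' + p' * d) (m * d' + m' * d) (d * d') = frac p m d + frac p' m' d'.
Proof.
move=> /qnat_gt0 h /qnat_gt0 h'; rewrite /frac !(qnatD, qnatM).
by field; rewrite !gt_eqF.
Qed.

Lemma fracN (p m d : N) : frac m p d = - frac p m d.
Proof. by rewrite /frac; ring. Qed.

Definition pw (n : N) : N := app (app (app (@RM M) (app timesM (1 + 1 : N))) (1 : N)) n.

Lemma pw0 : pw 0 = 1. Proof. exact: appR0. Qed.
Lemma pwS (n : N) : pw (n + 1) = (1 + 1) * pw n. Proof. exact: appRS. Qed.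

Lemma pw_gt (n : N) : ltN n (pw n).
Proof.
move: n; apply: numind; first by apply: dec_lt; rewrite /pw; defn.
  by rewrite pw0; exact: ltN01.
by move=> n IH; rewrite pwS; nlra.
Qed.

Lemma pw_gt0 (n : N) : ltN 0 (pw n).
Proof. have := pw_gt n => h; nlra. Qed.

Definition ulp (n : N) : Q := frac 1 0 (pw n).

Lemma ulp_gt0 (n : N) : 0 < ulp n.
Proof.
rewrite /ulp /frac qnat0 qnat1 subr0 div1r invr_gt0.
by apply/qnat_gt0; exact: pw_gt0.
Qed.

Lemma ulp0 : ulp 0 = 1.
Proof. by rewrite /ulp /frac pw0 qnat0 qnat1 subr0 divr1. Qed.

Lemma ulpS (n : N) : ulp (n + 1) = ulp n / 2.
Proof.
rewrite /ulp /frac pwS qnatM qnatD qnat0 qnat1.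
have /qnat_gt0 h := pw_gt0 n.
by field; rewrite !gt_eqF.
Qed.

Lemma ulpE (n : N) : ulp n * ι (pw n) = 1.
Proof.
rewrite /ulp /frac qnat0 qnat1; have /qnat_gt0 h := pw_gt0 n.
by field; rewrite gt_eqF.
Qed.

Lemma pw_mono (n m : N) : leN n m -> leN (pw n) (pw m).
Proof.
move=> /leNP [k ->]; move: k; apply: numind; first by apply: dec_le; rewrite /pw; defn.
  by rewrite addr0; right.
by move=> k IH; rewrite addrA pwS; nlra.
Qed.

Lemma ulp_mono (n m : N) : leN n m -> ulp m <= ulp n.
Proof.
move=> /pw_mono h; apply/frac_le; try exact: pw_gt0.
by nlra.
Qed.

(** The rationals are Archimedean relative to the numbers of the model, nonstandard ones included:
    (p - m) / d lies below p + 1. *)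
Lemma natural_above (x : Q) : exists n : N, x < ι n.
Proof.
have [r ->] := qcl_surj x; exists (qp r + 1).
have hd := qd_gt0 r; have h1 : leN 1 (qd r) by rewrite -(add0r 1) -ltN_le.
rewrite ltNge qleE !qnatE qcl_opp qcl_add; apply/asboolPn => /qnonnegE /=.
rewrite !(mulr1, mul1r, mul0r, addr0, add0r) qnat_le !(qnatD, qnatM, qnat0, qnat1) => h.
have := qnat_ge0 (qp r); have := qnat_ge0 (qm r); move/qnat_le: h1; rewrite qnat1.
by nra.
Qed.

Lemma ulp_small (δ : Q) : 0 < δ -> exists n : N, ulp n < δ.
Proof.
move=> hδ; have [n hn] := natural_above δ^-1; exists n.
have /qnat_lt h := pw_gt n; have h1 := ulpE n; have h0 := ulp_gt0 n.
have h2 : δ^-1 < ι (pw n) by lra.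
have h3 : 1 < δ * ι (pw n) by rewrite -(mulfV (lt0r_neq0 hδ)) ltr_pM2l.
by nra.
Qed.

Lemma floor_nat (q : Q) : 0 <= q -> exists j : N, ι j <= q /\ q < ι j + 1.
Proof.
have [r ->] := qcl_surj q; rewrite qleE subr0 => /asboolP /qnonnegE /leNP [z hz].
pose g : dom M t1 := lam (fun j : N => j * qd r : dom M tN).
have gE (j : N) : app g j = j * qd r by rewrite /g lamE //; defn.
have hd := qd_gt0 r.
have [||j [h1 h2]] := @between M g z.
- by rewrite gE mul0r; exact: leN_0.
- exists (z + 1); rewrite gE; nnra.
exists j; rewrite gE in h1; rewrite gE in h2.
split.
  rewrite qleE !qnatE qcl_opp qcl_add; apply/asboolP/qnonnegE => /=.
  by rewrite hz; nlra.
rewrite -qnat1 -qnatD ltNge qleE !qnatE qcl_opp qcl_add; apply/asboolPn => /qnonnegE /=.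
by rewrite hz => h; nlra.
Qed.

Lemma floor_int (q : Q) : exists a b : N, ι a - ι b <= q /\ q < ι a - ι b + 1.
Proof.
have [b hb] := natural_above (- q).
have [|a [h1 h2]] := @floor_nat (q + ι b); first by lra.
by exists a, b; lra.
Qed.

Definition three (n : N) : N := n + n + n.
Definition ax (x : dom M t1) (n : N) : Q :=
  frac (app x (three n)) (app x (three n + 1 : N)) ((app x (three n + (1 + 1) : N) : N) + 1).

Lemma den_gt0 (d : N) : ltN 0 (d + 1).
Proof. by apply/ltNP; exists d; rewrite add0r. Qed.

(** Order and equality are stated for sequences of rationals, since the endpoints of a ball are real
    expressions that come without a code of type 1. *)
Definition ltS (u v : N -> Q) := exists n, u n + 2 * ulp n < v n.
Definition leS (u v : N -> Q) := forall n, u n <= v n + 2 * ulp n.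
Definition eqS (u v : N -> Q) := forall n, u n - v n <= 2 * ulp n /\ v n - u n <= 2 * ulp n.

Definition qval Γ (q : rat Γ) (ρ : env M Γ) : Q :=
  frac (eval (rpos q) ρ) (eval (rneg q) ρ) (eval (rden q) ρ).
Definition qpos Γ (q : rat Γ) (ρ : env M Γ) := ltN 0 (eval (rden q) ρ : N).

Lemma sat_rat_lt Γ (q r : rat Γ) (ρ : env M Γ) : qpos q ρ -> qpos r ρ ->
  sat (rat_lt q r) ρ <-> qval q ρ < qval r ρ.
Proof. exact: frac_lt. Qed.

Lemma sat_rat_le Γ (q r : rat Γ) (ρ : env M Γ) : qpos q ρ -> qpos r ρ ->
  sat (rat_le q r) ρ <-> qval q ρ <= qval r ρ.
Proof. exact: frac_le. Qed.

Lemma qpos_D Γ (q r : rat Γ) (ρ : env M Γ) : qpos q ρ -> qpos r ρ -> qpos (ratD q r) ρ.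
Proof. exact: ltN_mul0. Qed.

Lemma qval_D Γ (q r : rat Γ) (ρ : env M Γ) : qpos q ρ -> qpos r ρ ->
  qval (ratD q r) ρ = qval q ρ + qval r ρ.
Proof. exact: fracD. Qed.

Lemma qpos_B Γ (q r : rat Γ) (ρ : env M Γ) : qpos q ρ -> qpos r ρ -> qpos (ratB q r) ρ.
Proof. exact: ltN_mul0. Qed.

Lemma qval_B Γ (q r : rat Γ) (ρ : env M Γ) : qpos q ρ -> qpos r ρ ->
  qval (ratB q r) ρ = qval q ρ - qval r ρ.
Proof. by move=> h h'; rewrite /ratB qval_D // [qval (Rat _ _ _) ρ]fracN. Qed.

Fixpoint seqr Γ (x : rexp Γ) (ρ : env M Γ) (n : N) : Q :=
  match x with
  | RVar t => ax (eval t ρ) n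
  | RZero => 0
  | ROne => 1
  | RAdd x y => seqr x ρ (n + 1) + seqr y ρ (n + 1)
  | RSub x y => seqr x ρ (n + 1) - seqr y ρ (n + 1)
  end.

Lemma rapproxP Γ (x : rexp Γ) (ρ : env M Γ) : forall t : tm Γ tN,
  qpos (rapprox x t) ρ /\ qval (rapprox x t) ρ = seqr x ρ (eval t ρ).
Proof.
elim: x => [x|||x IHx y IHy|x IHx y IHy] t.
- by split=> //; exact: den_gt0.
- by split; [exact: ltN01|rewrite /qval /frac subrr mul0r].
- by split; [exact: ltN01|rewrite /qval /frac /= qnat0 qnat1 subr0 divr1].
- have [h1 h2] := IHx (t ⊕ One)%fm; have [h3 h4] := IHy (t ⊕ One)%fm.
  by split; [exact: qpos_D|rewrite /= qval_D // h2 h4].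
- have [h1 h2] := IHx (t ⊕ One)%fm; have [h3 h4] := IHy (t ⊕ One)%fm.
  by split; [exact: qpos_B|rewrite /= qval_B // h2 h4].
Qed.

Lemma seqr_rlift Γ σ (x : rexp Γ) (z : dom M σ) (ρ : env M Γ) :
  seqr (rlift (Γ' := σ :: Γ) x) ((z, ρ) : env M (σ :: Γ)) = seqr x ρ.
Proof.
apply/funext; elim: x => [x|||x IHx y IHy|x IHx y IHy] n //=.
- by rewrite eval_lift1.
- by rewrite IHx IHy.
- by rewrite IHx IHy.
Qed.

Lemma epsP Γ (t : tm Γ tN) (ρ : env M Γ) : qpos (eps t) ρ /\ qval (eps t) ρ = ulp (eval t ρ).
Proof. by split=> //; exact: pw_gt0. Qed.

Lemma eps2P Γ (t : tm Γ tN) (ρ : env M Γ) : qpos (eps2 t) ρ /\ qval (eps2 t) ρ = 2 * ulp (eval t ρ).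
Proof.
split; first exact: pw_gt0.
rewrite [LHS]/(frac (1 + 1) 0 (pw (eval t ρ))) /ulp /frac qnatD qnat0 qnat1 mulrA.
by rewrite !subr0 mulr1.
Qed.

Lemma sat_real_lt Γ (x y : rexp Γ) (ρ : env M Γ) :
  sat (real_lt x y) ρ <-> ltS (seqr x ρ) (seqr y ρ).
Proof.
enough (h : forall n : dom M tN,
    sat (rat_lt (ratD (rapprox (rlift x) (Var vz)) (eps2 (Var vz)))
      (rapprox (rlift y) (Var vz))) ((n, ρ) : env M (tN :: Γ))
    <-> seqr x ρ n + 2 * ulp n < seqr y ρ n).
  by split=> -[n /h hn]; exists n.
move=> n.
have [h1 h2] := rapproxP (rlift x) ((n, ρ) : env M (tN :: Γ)) (Var vz).
have [h3 h4] := rapproxP (rlift y) ((n, ρ) : env M (tN :: Γ)) (Var vz).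
have [h5 h6] := eps2P (Var vz) ((n, ρ) : env M (tN :: Γ)).
rewrite sat_rat_lt; [|exact: qpos_D|by []].
by rewrite qval_D // h2 h4 h6 !seqr_rlift.
Qed.

Lemma sat_real_le Γ (x y : rexp Γ) (ρ : env M Γ) :
  sat (real_le x y) ρ <-> leS (seqr x ρ) (seqr y ρ).
Proof.
enough (h : forall n : dom M tN, sat (rat_le (rapprox (rlift x) (Var vz))
      (ratD (rapprox (rlift y) (Var vz)) (eps2 (Var vz)))) ((n, ρ) : env M (tN :: Γ))
    <-> seqr x ρ n <= seqr y ρ n + 2 * ulp n).
  by split=> H n; apply/h; exact: H.
move=> n.
have [h1 h2] := rapproxP (rlift x) ((n, ρ) : env M (tN :: Γ)) (Var vz).
have [h3 h4] := rapproxP (rlift y) ((n, ρ) : env M (tN :: Γ)) (Var vz).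
have [h5 h6] := eps2P (Var vz) ((n, ρ) : env M (tN :: Γ)).
rewrite sat_rat_le; [|by []|exact: qpos_D].
by rewrite qval_D // h2 h4 h6 !seqr_rlift.
Qed.

Lemma sat_real_eq Γ (x y : rexp Γ) (ρ : env M Γ) :
  sat (real_eq x y) ρ <-> eqS (seqr x ρ) (seqr y ρ).
Proof.
pose wkr x := @rlift Γ (tN :: Γ) (@ext_step Γ Γ tN (@ext_refl Γ)) x.
suff h n (x' y' : rexp Γ) : sat (rat_le (ratB (rapprox (wkr x') (Var vz)) (rapprox (wkr y') (Var vz)))
      (eps2 (Var vz))) ((n, ρ) : env M (tN :: Γ))
    <-> seqr x' ρ n - seqr y' ρ n <= 2 * ulp n.
  by split=> H n; have [H1 H2] := H n; split; apply/h.
have [h1 h2] := rapproxP (wkr x') ((n, ρ) : env M (tN :: Γ)) (Var vz).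
have [h3 h4] := rapproxP (rlift y') ((n, ρ) : env M (tN :: Γ)) (Var vz).
have [h5 h6] := eps2P (Var vz) ((n, ρ) : env M (tN :: Γ)).
rewrite sat_rat_le; [|exact: qpos_B|by []].
by rewrite qval_B // h2 h4 h6 /wkr !seqr_rlift.
Qed.

(* [LIN], [HBU], [E2] and [WKL], read in M, unfold by conversion to the
   propositions below. *)

Definition realP (x : dom M t1) : Prop := sat (is_real (Var vz)) ((x, tt) : env M [:: t1]).
Definition posP (Ψ : dom M (t1 ⟶ t1)) : Prop :=
  sat (pos_real_fun (Var vz)) ((Ψ, tt) : env M [:: (t1 ⟶ t1)%ty]).
Definition unitP (x : dom M t1) : Prop := sat (in_unit (Var vz)) ((x, tt) : env M [:: t1]).
Definition inP (a b z : dom M t1) : Prop :=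
  sat (in_interval (Var vz) (RVar (Var (vs _ vz))) (RVar (Var (vs _ (vs _ vz)))))
    ((z, (a, (b, tt))) : env M [:: t1; t1; t1]).
Definition ballP (Ψ : dom M (t1 ⟶ t1)) (x z : dom M t1) : Prop :=
  sat (in_ball (Var (vs _ (vs _ vz))) (Var (vs _ vz)) (Var vz))
    ((z, (x, (Ψ, tt))) : env M [:: t1; t1; (t1 ⟶ t1)%ty]).

Lemma realPE x : realP x <-> forall n i : N,
  ax x n - ax x (n + i) < ulp n /\ ax x (n + i) - ax x n < ulp n.
Proof.
pose ρ n i : env M [:: tN; tN; t1] := (i, (n, (x, tt))).
have h n i (s t : tm [:: tN; tN; t1] tN) (X := Var (vs _ (vs _ vz))) :
    sat (rat_lt (ratB (approx X s) (approx X t)) (eps (Var (vs _ vz)))) (ρ n i)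
    <-> ax x (eval s (ρ n i)) - ax x (eval t (ρ n i)) < ulp n.
  have [h1 h2] := epsP (Var (vs _ vz)) (ρ n i).
  have [h3 h4] := rapproxP (RVar X) (ρ n i) s.
  have [h5 h6] := rapproxP (RVar X) (ρ n i) t.
  rewrite sat_rat_lt; [|exact: qpos_B|by []].
  by rewrite qval_B // h2 [qval (approx X s) _]h4 [qval (approx X t) _]h6.
split=> H n i; have [H1 H2] := H n i; split.
- exact: (iffLR (h n i (Var (vs _ vz)) (Var (vs _ vz) ⊕ Var vz)%fm) H1).
- exact: (iffLR (h n i (Var (vs _ vz) ⊕ Var vz)%fm (Var (vs _ vz))) H2).
- exact: (iffRL (h n i (Var (vs _ vz)) (Var (vs _ vz) ⊕ Var vz)%fm) H1).
- exact: (iffRL (h n i (Var (vs _ vz) ⊕ Var vz)%fm (Var (vs _ vz))) H2).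
Qed.

Lemma inPE a b z : inP a b z <-> ltS (ax a) (ax z) /\ ltS (ax z) (ax b).
Proof. by rewrite -(sat_real_lt (RVar (Var (vs _ vz))) (RVar (Var vz)) ((z, (a, (b, tt))) : env M [:: t1; t1; t1]))
 -(sat_real_lt (RVar (Var vz)) (RVar (Var (vs _ (vs _ vz)))) ((z, (a, (b, tt))) : env M [:: t1; t1; t1])). Qed.

Lemma ballPE Ψ x z : ballP Ψ x z <->
  ltS (fun k => ax x (k + 1) - ax (app Ψ x) (k + 1)) (ax z) /\
  ltS (ax z) (fun k => ax x (k + 1) + ax (app Ψ x) (k + 1)).
Proof.
pose ρ : env M [:: t1; t1; (t1 ⟶ t1)%ty] := (z, (x, (Ψ, tt))).
pose X : rexp [:: t1; t1; (t1 ⟶ t1)%ty] := RVar (Var (vs _ vz)).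
pose P : rexp [:: t1; t1; (t1 ⟶ t1)%ty] := RVar (Var (vs _ (vs _ vz)) · Var (vs _ vz))%fm.
by rewrite -[ltS _ (ax z)](sat_real_lt (RSub X P) (RVar (Var vz)) ρ)
  -[ltS (ax z) _](sat_real_lt (RVar (Var vz)) (RAdd X P) ρ).
Qed.

Lemma unitPE x : unitP x <-> [/\ realP x, leS (fun=> 0) (ax x) & leS (ax x) (fun=> 1)].
Proof.
have h1 := sat_real_le RZero (RVar (Var vz)) ((x, tt) : env M [:: t1]).
have h2 := sat_real_le (RVar (Var vz)) ROne ((x, tt) : env M [:: t1]).
split=> [[H1 [H2 H3]]|[H1 H2 H3]]; first by split=> //; [exact/h1|exact/h2].
by split=> //; split; [exact/h1|exact/h2].
Qed.

Lemma posPE Ψ : posP Ψ <->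
  (forall x, realP x -> realP (app Ψ x) /\ ltS (fun=> 0) (ax (app Ψ x))) /\
  (forall x y, realP x -> realP y -> eqS (ax x) (ax y) -> eqS (ax (app Ψ x)) (ax (app Ψ y))).
Proof.
pose ρ1 x : env M [:: t1; (t1 ⟶ t1)%ty] := (x, (Ψ, tt)).
pose ρ2 x y : env M [:: t1; t1; (t1 ⟶ t1)%ty] := (y, (x, (Ψ, tt))).
have h1 x := sat_real_lt RZero (RVar (Var (vs _ vz) · Var vz))%fm (ρ1 x).
have h2 x y := sat_real_eq (RVar (Var (vs _ vz))) (RVar (Var vz)) (ρ2 x y).
have h3 x y := sat_real_eq (RVar (Var (vs _ (vs _ vz)) · Var (vs _ vz)))%fm
  (RVar (Var (vs _ (vs _ vz)) · Var vz))%fm (ρ2 x y).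
split=> -[H1 H2]; split.
- by move=> x hx; have [H3 H4] := H1 x hx; split=> //; exact/h1.
- by move=> x y hx hy hxy; apply/h3; apply: H2 => //; exact/h2.
- by move=> x hx; have [H3 H4] := H1 x hx; split=> //; exact/h1.
- by move=> x y hx hy hxy; apply/h3; apply: H2 => //; exact/h2.
Qed.

Definition LINs := forall Ψ, posP Ψ -> exists a b : dom M (tN ⟶ t1),
  (forall n, realP (app a n) /\ realP (app b n)) /\
  (forall x, realP x -> exists n, inP (app a n) (app b n) x) /\
  forall n, exists x, realP x /\
    forall z, realP z -> (inP (app a n) (app b n) z <-> ballP Ψ x z).

Definition HBUs := forall Ψ, posP Ψ -> exists (k : N) (y : dom M (tN ⟶ t1)),
  (forall i : N, ltN i k -> realP (app y i)) /\
  forall x, unitP x -> exists i : N, ltN i k /\ ballP Ψ (app y i) x.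

Definition E2s := exists φ : dom M t2, (forall f, leN (app φ f : N) 1) /\ E2_at φ.
Definition snocN (s i : N) : N := (1 + 1) * s + 1 + i.
Definition WKLs := forall T : dom M t1,
  ((forall n : N, leN (app T n : N) 1) /\
   (forall s i : N, leN i 1 -> app T (snocN s i) = oneM -> app T s = oneM)) ->
  (forall n : N, exists s : N, ltN n s /\ app T s = oneM) ->
  exists f : dom M t1, (forall n : N, leN (app f n : N) 1) /\
  exists g : dom M t1,
   (app g (0 : N) = (0 : N) /\ forall n : N, app g (n + 1 : N) = snocN (app g n) (app f n)) /\
   forall n : N, app T (app g n) = oneM.
End Reals.

Lemma mulf_fracs (F : fieldType) (a b c a' b' c' : F) :
  (a * a' + b * b' - (a * b' + b * a')) / (c * c') = (a - b) / c * ((a' - b') / c').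
Proof. by rewrite mulrACA -invfM; congr (_ / _); ring. Qed.

(** * Estimates, definable rationals and codes of reals *)

Section RealTools.
Variable M : wmodel.
Notation N := (NN M).
Notation Q := (QQ M).
Local Notation ι := (@qnat M).

Lemma real_close (x : dom M t1) (n m : N) : realP x -> leN n m ->
  ax x n - ax x m < ulp n /\ ax x m - ax x n < ulp n.
Proof. by move=> /realPE hx /leNP [k ->]; exact: hx. Qed.

Lemma real_near (x : dom M t1) (n m : N) : realP x -> ax x n - ax x m < ulp n + ulp m.
Proof.
move=> hx; have := ulp_gt0 n; have := ulp_gt0 m; case: (leN_total n m) => h.
  by have [h1 h2] := real_close hx h; lra.
by have [h1 h2] := real_close hx h; lra.
Qed.

Lemma above2 (a b : N) : exists c : N, leN a c /\ leN b c.
Proof. by exists (a + b); split; nlra. Qed.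

Definition regular (u : N -> Q) := forall n m, leN n m -> u n - u m <= ulp n /\ u m - u n <= ulp n.

(** Strict inequality with a margin that persists at all late indices, in contrast to the single
    index of [ltS]. Several such inequalities can be combined at a common index. *)
Definition gap (u v : N -> Q) :=
  exists2 δ : Q, 0 < δ & exists K : N, forall k, leN K k -> u k + δ < v k.

Lemma gap_ltS u v : gap u v -> ltS u v.
Proof.
move=> [δ hδ [K hK]]; have [n hn] : exists n : N, ulp n < δ / 2 by apply: ulp_small; lra.
have [k [h1 h2]] := above2 K n; exists k.
by have := hK k h1; have := ulp_mono h2; lra.
Qed.

Lemma ltS_gap u v : regular u -> regular v -> ltS u v -> gap u v.
Proof.
move=> hu hv [n hn]; exists ((v n - u n - 2 * ulp n) / 2); first by lra.
exists n => k hk; have [h1 h2] := hu _ _ hk; have [h3 h4] := hv _ _ hk; lra.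
Qed.

Lemma gap_and u v u' v' : gap u v -> gap u' v' -> exists2 δ : Q, 0 < δ &
  exists K : N, forall k, leN K k -> u k + δ < v k /\ u' k + δ < v' k.
Proof.
move=> [δ hδ [K hK]] [δ' hδ' [K' hK']]; have [L [h1 h2]] := above2 K K'.
have le_trans' (a b c : N) : leN a b -> leN b c -> leN a c by move=> ? ?; nlra.
case: (leP δ δ') => h.
  exists δ => //; exists L => k hk.
  have := hK k (le_trans' _ _ _ h1 hk); have := hK' k (le_trans' _ _ _ h2 hk); split; lra.
exists δ' => //; exists L => k hk.
have := hK k (le_trans' _ _ _ h1 hk); have := hK' k (le_trans' _ _ _ h2 hk); split; lra.
Qed.

Lemma axE (x : dom M t1) (n : N) : ax x n =
  frac (app x (three n)) (app x (three n + 1 : N)) ((app x (three n + (1 + 1) : N) : N) + 1).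
Proof. by []. Qed.

Lemma fracE (p m d : N) : frac p m d = (ι p - ι m) / ι d. Proof. by []. Qed.
Lemma ulp_inv (n : N) : ulp n = (ι (pw n))^-1.
Proof. by rewrite /ulp /frac qnat0 qnat1 subr0 div1r. Qed.

Lemma fracM (p m d p' m' d' : N) :
  frac (p * p' + m * m') (p * m' + m * p') (d * d') = frac p m d * frac p' m' d'.
Proof. by rewrite /frac !(qnatD, qnatM); apply: mulf_fracs. Qed.

Lemma regular_ax x : realP x -> regular (ax x).
Proof. by move=> hx n m h; have [h1 h2] := real_close hx h; split; apply: ltW. Qed.

Lemma regular_sub u v : regular u -> regular v -> regular (fun k => u (k + 1) - v (k + 1)).
Proof.
move=> hu hv n m h; have h' : leN (n + 1) (m + 1) by nlra.
have [h1 h2] := hu _ _ h'; have [h3 h4] := hv _ _ h'; have h5 := ulpS n.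
by split; lra.
Qed.

Lemma regular_add u v : regular u -> regular v -> regular (fun k => u (k + 1) + v (k + 1)).
Proof.
move=> hu hv n m h; have h' : leN (n + 1) (m + 1) by nlra.
have [h1 h2] := hu _ _ h'; have [h3 h4] := hv _ _ h'; have h5 := ulpS n.
by split; lra.
Qed.

Lemma inP_gap a b z : realP a -> realP b -> realP z -> inP a b z ->
  exists2 δ : Q, 0 < δ & exists K : N, forall k, leN K k ->
    ax a k + δ < ax z k /\ ax z k + δ < ax b k.
Proof.
move=> ha hb hz /inPE [h1 h2].
by apply: gap_and; apply: ltS_gap => //; apply: regular_ax.
Qed.

Lemma gap_inP a b z (δ : Q) (K : N) : 0 < δ -> (forall k, leN K k ->
  ax a k + δ < ax z k /\ ax z k + δ < ax b k) -> inP a b z.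
Proof.
move=> hδ h; apply/inPE; split; apply: gap_ltS; exists δ => //; exists K => k hk;
  by have [] := h k hk.
Qed.

Lemma ballP_gap Ψ x z : realP x -> realP (app Ψ x) -> realP z -> ballP Ψ x z ->
  exists2 δ : Q, 0 < δ & exists K : N, forall k, leN K k ->
    ax x k - ax (app Ψ x) k + δ < ax z k /\ ax z k + δ < ax x k + ax (app Ψ x) k.
Proof.
move=> hx hΨ hz /ballPE [h1 h2].
have hrx := regular_ax hx; have hrΨ := regular_ax hΨ; have hrz := regular_ax hz.
have [δ hδ [K hK]] := gap_and (ltS_gap (regular_sub hrx hrΨ) hrz h1) (ltS_gap hrz (regular_add hrx hrΨ) h2).
have [n hn] : exists n : N, ulp n < δ / 4 by apply: ulp_small; lra.
have [L [hL1 hL2]] := above2 K n.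
exists (δ / 2); first by lra.
exists L => k hk; have hKk : leN K k by nlra.
have hnk : leN n k by nlra.
have h3 : leN k (k + 1) by nlra.
have [h4 h5] := hK k hKk; have [h6 h7] := hrx _ _ h3; have [h8 h9] := hrΨ _ _ h3.
by have := ulp_mono hnk; split; lra.
Qed.

Lemma gap_ballP Ψ x z (δ : Q) (K : N) : realP x -> realP (app Ψ x) -> 0 < δ ->
  (forall k, leN K k ->
    ax x k - ax (app Ψ x) k + δ < ax z k /\ ax z k + δ < ax x k + ax (app Ψ x) k) ->
  ballP Ψ x z.
Proof.
move=> hx hΨ hδ hK; apply/ballPE.
have hrx := regular_ax hx; have hrΨ := regular_ax hΨ.
have [n hn] : exists n : N, ulp n < δ / 4 by apply: ulp_small; lra.
have [L [hL1 hL2]] := above2 K n.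
split; apply: gap_ltS; exists (δ / 2); try lra; exists L => k hk.
  have hKk : leN K k by nlra.
  have hnk : leN n k by nlra.
  have h3 : leN k (k + 1) by nlra.
  have [h4 h5] := hK k hKk; have [h6 h7] := hrx _ _ h3; have [h8 h9] := hrΨ _ _ h3.
  by have := ulp_mono hnk; lra.
have hKk : leN K k by nlra.
have hnk : leN n k by nlra.
have h3 : leN k (k + 1) by nlra.
have [h4 h5] := hK k hKk; have [h6 h7] := hrx _ _ h3; have [h8 h9] := hrΨ _ _ h3.
by have := ulp_mono hnk; lra.
Qed.

(** The rationals are a quotient formed outside the model, so a definable rational-valued function
    is one with definable numerators and denominator. *)
Definition defq Γ (F : env M Γ -> Q) := exists P P' D : env M Γ -> N,
  [/\ @def M Γ tN P, @def M Γ tN P', @def M Γ tN D,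
      forall ρ, ltN 0 (D ρ) & forall ρ, F ρ = frac (P ρ) (P' ρ) (D ρ)].

Lemma defq_frac Γ (P P' D : env M Γ -> N) :
  @def M Γ tN P -> @def M Γ tN P' -> @def M Γ tN D -> (forall ρ, ltN 0 (D ρ)) ->
  defq (fun ρ => frac (P ρ) (P' ρ) (D ρ)).
Proof. by move=> *; exists P, P', D. Qed.

Lemma defq_const Γ (q : Q) : defq (fun _ : env M Γ => q).
Proof.
have [[p m d hd] ->] := qcl_surj q.
exists (fun _ => p), (fun _ => m), (fun _ => d); split => //; try exact: def_const.
move=> _; have /qnat_gt0 h := hd; apply: (mulIf (lt0r_neq0 h)).
rewrite /frac divfK ?gt_eqF // !qnatE qcl_opp qcl_add qcl_mul; apply/qclP.
by rewrite /qeq /=; ring.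
Qed.

Lemma defq_add Γ (F G : env M Γ -> Q) : defq F -> defq G -> defq (fun ρ => F ρ + G ρ).
Proof.
move=> [p [m [d [h1 h2 h3 h4 h5]]]] [p' [m' [d' [h1' h2' h3' h4' h5']]]].
exists (fun ρ => p ρ * d' ρ + p' ρ * d ρ), (fun ρ => m ρ * d' ρ + m' ρ * d ρ),
  (fun ρ => d ρ * d' ρ); split; try by defn.
  by move=> ρ; exact: ltN_mul0.
by move=> ρ; rewrite fracD // h5 h5'.
Qed.

Lemma defq_opp Γ (F : env M Γ -> Q) : defq F -> defq (fun ρ => - F ρ).
Proof.
move=> [p [m [d [h1 h2 h3 h4 h5]]]]; exists m, p, d; split=> // ρ.
by rewrite h5 -fracN.
Qed.

Lemma defq_mul Γ (F G : env M Γ -> Q) : defq F -> defq G -> defq (fun ρ => F ρ * G ρ).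
Proof.
move=> [p [m [d [h1 h2 h3 h4 h5]]]] [p' [m' [d' [h1' h2' h3' h4' h5']]]].
exists (fun ρ => p ρ * p' ρ + m ρ * m' ρ), (fun ρ => p ρ * m' ρ + m ρ * p' ρ),
  (fun ρ => d ρ * d' ρ); split; try by defn.
  by move=> ρ; exact: ltN_mul0.
by move=> ρ; rewrite h5 h5' fracM.
Qed.

Lemma defq_ax Γ (X : env M Γ -> dom M t1) (n : env M Γ -> N) :
  def X -> @def M Γ tN n -> defq (fun ρ => ax (X ρ) (n ρ)).
Proof.
move=> hX hn; apply: defq_frac; rewrite /three; try by defn.
by move=> ρ; exact: den_gt0.
Qed.

Lemma defq_ulp Γ (n : env M Γ -> N) : @def M Γ tN n -> defq (fun ρ => ulp (n ρ)).
Proof.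
move=> hn; apply: defq_frac; rewrite /pw; try by defn.
by move=> ρ; exact: pw_gt0.
Qed.

Lemma dec_ltq Γ (F G : env M Γ -> Q) : defq F -> defq G -> dec (fun ρ => F ρ < G ρ).
Proof.
move=> [p [m [d [h1 h2 h3 h4 h5]]]] [p' [m' [d' [h1' h2' h3' h4' h5']]]].
apply: (dec_ext (P := fun ρ => ltN (p ρ * d' ρ + m' ρ * d ρ) (p' ρ * d ρ + m ρ * d' ρ))).
  by move=> ρ; rewrite frac_lt // h5 h5'.
by apply: dec_lt; defn.
Qed.

Lemma dec_leq Γ (F G : env M Γ -> Q) : defq F -> defq G -> dec (fun ρ => F ρ <= G ρ).
Proof.
move=> hF hG; apply: dec_ext (dec_not (dec_ltq hG hF)) => ρ.
by rewrite leNgt; split=> /negP.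
Qed.

Lemma div3_exists : exists f : dom M t1, forall p : N,
  leN (three (app f p)) p /\ ltN p (three ((app f p : N) + 1)).
Proof.
apply: (@numchoice _ (fun p m => leN (three m) p /\ ltN p (three (m + 1)))).
  by apply: dec_and; [apply: dec_le|apply: dec_lt]; rewrite /three; defn.
move=> p; pose g : dom M t1 := lam (fun m : N => m + m + m : dom M tN).
have gE (m : N) : app g m = three m by rewrite /g lamE //; defn.
have [||m [h1 h2]] := @between _ g p.
- by rewrite gE /three !addr0; exact: leN_0.
- by exists (p + 1); rewrite gE /three; nlra.
by exists m; rewrite -!gE.
Qed.

Definition div3 : dom M t1 := projT1 (cid div3_exists).

Lemma div3P (p : N) : leN (three (app div3 p)) p /\ ltN p (three ((app div3 p : N) + 1)).
Proof. exact: (projT2 (cid div3_exists) p). Qed.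

Lemma div3E (n r : N) : ltN r (1 + 1 + 1) -> app div3 (three n + r) = n.
Proof.
move=> hr; have [] := div3P (three n + r); move: (app div3 _) => m; rewrite /three => h1 h2.
apply: leN_anti; apply: contrapT => /ltN_leF h; have {}h := h : ltN _ _; nlra.
Qed.

(** The inverse of the decoding in [ax]: interleaves two numerators and a denominator less one into
    a code of type 1. *)
Definition tri (u v w : N -> N) : dom M t1 := lam (fun p : N =>
  if `[< p = three (app div3 p) >] then u (app div3 p)
  else if `[< p = three (app div3 p) + 1 >] then v (app div3 p) else w (app div3 p)).

Lemma def_tri_body Γ (U V W : N -> env M Γ -> N) :
  @def M (tN :: Γ) tN (fun ρ => U (fst ρ) (snd ρ)) ->
  @def M (tN :: Γ) tN (fun ρ => V (fst ρ) (snd ρ)) ->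
  @def M (tN :: Γ) tN (fun ρ => W (fst ρ) (snd ρ)) ->
  @def M (tN :: Γ) tN (fun ρ =>
    if `[< fst ρ = three (app div3 (fst ρ)) >] then U (app div3 (fst ρ)) (snd ρ)
    else if `[< fst ρ = three (app div3 (fst ρ)) + 1 >] then V (app div3 (fst ρ)) (snd ρ)
    else W (app div3 (fst ρ)) (snd ρ)).
Proof.
have h (G : N -> env M Γ -> N) : @def M (tN :: Γ) tN (fun ρ => G (fst ρ) (snd ρ)) ->
    @def M (tN :: Γ) tN (fun ρ => G (app div3 (fst ρ)) (snd ρ)).
  move=> hG; have h1 := def_weak tN (def_lam_env hG).
  have h2 : @def M (tN :: Γ) tN (fun ρ => app div3 (fst ρ)) by defn.
  apply: def_ext (def_app h1 h2) => -[p ρ] /=.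
  by rewrite (@lam_env M Γ tN tN _ _ _ hG).
move=> hU hV hW; apply: def_if; first by apply: dec_eq; rewrite /three; defn.
  exact: h.
by apply: def_if; [apply: dec_eq; rewrite /three; defn|exact: h|exact: h].
Qed.

Lemma def_tri Γ (U V W : N -> env M Γ -> N) :
  @def M (tN :: Γ) tN (fun ρ => U (fst ρ) (snd ρ)) ->
  @def M (tN :: Γ) tN (fun ρ => V (fst ρ) (snd ρ)) ->
  @def M (tN :: Γ) tN (fun ρ => W (fst ρ) (snd ρ)) ->
  def (fun ρ => tri (fun m => U m ρ) (fun m => V m ρ) (fun m => W m ρ)).
Proof. by move=> hU hV hW; apply: def_lam; apply: def_tri_body. Qed.

Lemma ax_tri (u v w : N -> N) (n : N) :
  @def M [:: tN] tN (fun ρ => u (fst ρ)) ->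
  @def M [:: tN] tN (fun ρ => v (fst ρ)) ->
  @def M [:: tN] tN (fun ρ => w (fst ρ)) ->
  ax (tri u v w) n = frac (u n) (v n) (w n + 1).
Proof.
move=> hu hv hw.
have hd := @def_tri_body nil (fun m _ => u m) (fun m _ => v m) (fun m _ => w m) hu hv hw.
have d0 : app div3 (three n) = n by rewrite -{1}(addr0 (three n)) div3E //; nlra.
have e1 : app div3 (three n + 1) = n by apply: div3E; nlra.
have e2 : app div3 (three n + (1 + 1)) = n by apply: div3E; nlra.
have n1 : three n + 1 <> three n by move=> h; nlra.
have n2 : three n + (1 + 1) <> three n by move=> h; nlra.
have n3 : three n + (1 + 1) <> three n + 1 by move=> h; nlra.
have tE (p : N) : app (tri u v w) p = (if `[< p = three (app div3 p) >] then u (app div3 p)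
  else if `[< p = three (app div3 p) + 1 >] then v (app div3 p) else w (app div3 p) : N).
  by rewrite /tri lamE; last exact: hd.
rewrite /ax !tE d0 e1 e2.
rewrite (introT (asboolP (three n = three n)) erefl) (introF (asboolP _) n1).
rewrite (introT (asboolP (three n + 1 = three n + 1)) erefl).
by rewrite (introF (asboolP _) n2) (introF (asboolP _) n3).
Qed.

(** All rationals of the model as constant sequences, the index coding ((p, m), d - 1). They are the
    centres when (∃²) fails and the test points when it holds. *)
Definition ratc : dom M (tN ⟶ t1) := lam (fun j : N =>
  tri (fun _ => app (fstM M) (app (fstM M) j)) (fun _ => app (sndM M) (app (fstM M) j)) (fun _ => app (sndM M) j)).

Lemma ax_ratc (j k : N) : ax (app ratc j) k =
  frac (app (fstM M) (app (fstM M) j)) (app (sndM M) (app (fstM M) j)) ((app (sndM M) j : N) + 1).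
Proof.
rewrite /ratc lamE; first by apply: ax_tri; defn.
by apply: (@def_tri [:: tN] (fun _ ρ => app (fstM M) (app (fstM M) (fst ρ)))
  (fun _ ρ => app (sndM M) (app (fstM M) (fst ρ))) (fun _ ρ => app (sndM M) (fst ρ))); defn.
Qed.

Lemma ratc_real (j : N) : realP (app ratc j).
Proof. by apply/realPE => n i; rewrite !ax_ratc subrr; split; exact: ulp_gt0. Qed.

Lemma ratc_surj (q : Q) : exists j, forall k, ax (app ratc j) k = q.
Proof.
have [[p m d hd] ->] := qcl_surj q.
have [d' hd'] := (ltNP _ _).1 hd; rewrite add0r in hd'.
exists (pairN (pairN p m) d') => k; rewrite ax_ratc !(fst_pair, snd_pair) -hd'.
have /qnat_gt0 h := hd; apply: (mulIf (lt0r_neq0 h)).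
rewrite /frac divfK ?gt_eqF // !qnatE qcl_opp qcl_add qcl_mul; apply/qclP.
by rewrite /qeq /=; ring.
Qed.

End RealTools.

Global Opaque ax ulp frac.

Ltac defq1 := cbv beta; lazymatch goal with
  | |- defq (fun ρ => @?a ρ + @?b ρ) => apply: defq_add
  | |- defq (fun ρ => - @?a ρ) => apply: defq_opp
  | |- defq (fun ρ => @?a ρ * @?b ρ) => apply: defq_mul
  | |- defq (fun ρ => ax (@?a ρ) (@?b ρ)) => apply: defq_ax
  | |- defq (fun ρ => ulp (@?a ρ)) => apply: defq_ulp
  | |- defq _ => apply: defq_const
  | |- _ => defn1
  end.

(** * Countable subcovers *)

Section Covers.
Variable M : wmodel.
Notation N := (NN M).
Notation Q := (QQ M).
Local Notation ι := (@qnat M).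

Definition covers (Ψ : dom M (t1 ⟶ t1)) (y : dom M (tN ⟶ t1)) :=
  (forall n, realP (app y n)) /\ forall x, realP x -> exists n, ballP Ψ (app y n) x.

(** A countable subcover given by its centres. Every implication between LIN and HBU passes through
    this statement. *)
Definition SLIN := forall Ψ, posP Ψ -> exists y, covers Ψ y.

Lemma SLIN_LIN : SLIN -> LINs M.
Proof.
move=> hS Ψ hΨ; have [y [hy hcov]] := hS Ψ hΨ; have [hΨ1 hΨ2] := (posPE Ψ).1 hΨ.
(* One construction for both endpoints: for the lower one the two numerators of the radius are
   exchanged. Approximations at k + 1 make the codes agree exactly with the endpoint expressions of
   the ball. *)
have hD (sg : bool) : exists a : dom M (tN ⟶ t1), forall n k, ax (app a n) k =
    ax (app y n) (k + 1) + (if sg then 1 else -1) * ax (app Ψ (app y n)) (k + 1).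
  pose cd (x : dom M t1) (r : N) (k : N) : N := app x (three (k + 1) + r).
  pose D x k : N := cd x (1 + 1) k + 1.
  pose P1 (n k : N) : N := let x := app y n in let z := app Ψ x in
    cd x 0 k * D z k + (if sg then cd z 0 k else cd z 1 k) * D x k.
  pose P2 (n k : N) : N := let x := app y n in let z := app Ψ x in
    cd x 1 k * D z k + (if sg then cd z 1 k else cd z 0 k) * D x k.
  (* The product (d + 1)(e + 1) of the denominators less one, as [tri] stores it. *)
  pose P3 (n k : N) : N := let x := app y n in let z := app Ψ x in
    cd x (1 + 1) k * cd z (1 + 1) k + cd x (1 + 1) k + cd z (1 + 1) k.
  have d1 : @def M [:: tN; tN] tN (fun ρ => P1 (fst (snd ρ)) (fst ρ)).
    by rewrite /P1 /D /cd /three; case: (sg); defn.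
  have d2 : @def M [:: tN; tN] tN (fun ρ => P2 (fst (snd ρ)) (fst ρ)).
    by rewrite /P2 /D /cd /three; case: (sg); defn.
  have d3 : @def M [:: tN; tN] tN (fun ρ => P3 (fst (snd ρ)) (fst ρ)).
    by rewrite /P3 /cd /three; defn.
  exists (lam (fun n : N => tri (P1 n) (P2 n) (P3 n))) => n k.
  rewrite lamE; last first.
    exact: (@def_tri M [:: tN] (fun k ρ => P1 (fst ρ) k) (fun k ρ => P2 (fst ρ) k)
      (fun k ρ => P3 (fst ρ) k)).
  rewrite ax_tri.
  - have hc (x : dom M t1) : ax x (k + 1) = frac (cd x 0 k) (cd x 1 k) (D x k).
      by rewrite axE /cd /D /cd addr0.
    have hf (x : dom M t1) : (if sg then 1 else -1) * frac (cd x 0 k) (cd x 1 k) (D x k)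
        = frac (if sg then cd x 0 k else cd x 1 k) (if sg then cd x 1 k else cd x 0 k) (D x k).
      by case: (sg); [rewrite mul1r|rewrite mulN1r -fracN].
    rewrite !hc hf -fracD; try exact: den_gt0.
    congr frac; rewrite /P3 /D.
    move: (cd _ _ _) (cd (app Ψ _) _ _) => u v; ring.
  - rewrite /P1 /D /cd /three; case: (sg); defn.
  - rewrite /P2 /D /cd /three; case: (sg); defn.
  - rewrite /P3 /cd /three; defn.
have [b hb] := hD true; have [a ha] := hD false.
have areal (sg : Q) n c : (sg = 1 \/ sg = -1) -> (forall k, ax c k =
    ax (app y n) (k + 1) + sg * ax (app Ψ (app y n)) (k + 1)) -> realP c.
  move=> hsg hc; apply/realPE => m i; rewrite !hc.
  have h' : leN (m + 1) (m + i + 1) by nlra.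
  have [h1 h2] := real_close (hy n) h'; have [h3 h4] := real_close (hΨ1 _ (hy n)).1 h'.
  by have h5 := ulpS m; case: hsg => ->; split; lra.
have ain n z : inP (app a n) (app b n) z <-> ballP Ψ (app y n) z.
  rewrite inPE ballPE.
  have -> : ax (app a n) = (fun k => ax (app y n) (k + 1) - ax (app Ψ (app y n)) (k + 1)).
    by apply/funext => k; rewrite ha mulN1r.
  have -> // : ax (app b n) = (fun k => ax (app y n) (k + 1) + ax (app Ψ (app y n)) (k + 1)).
  by apply/funext => k; rewrite hb mul1r.
exists a, b; split; [|split].
- move=> n; split; first by apply: (areal (-1) n) => //; right.
  by apply: (areal 1 n) => //; left.
- by move=> x /hcov [n hn]; exists n; apply/ain.
- by move=> n; exists (app y n); split=> // z _; exact: ain.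
Qed.

(* Grilliot's trick. Let x be a real lying in none of the balls around rationals,
   and let y_f be x, frozen at its n-th approximation once f n = 0. If f has a zero
   then y_f is rational and close to x, so Ψ (y_f) is small; otherwise
   Ψ (y_f) = Ψ (x). A rational approximation of Ψ (y_f) thus decides whether f has a
   zero. *)
Lemma E2_or_SLIN : ~ E2s M -> SLIN.
Proof.
move=> nE2 Ψ hΨ; exists (ratc M); split; first exact: ratc_real.
move=> x hx; apply: contrapT => hno; apply: nE2.
have {}hno j : ~ ballP Ψ (app (ratc M) j) x by move=> hb; apply: hno; exists j.
have [hΨ1 hΨ2] := (posPE Ψ).1 hΨ.
have [hrΨ [n0 hn0]] := hΨ1 x hx.
(* With four extra digits 2^-n0 equals 16 · 2^-K. As Ψ(x) exceeds 2 · 2^-n0 at index n0, it still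
   exceeds 16 · 2^-K at index K, well above the threshold 8 · 2^-K used below. *)
pose K : N := n0 + 1 + 1 + 1 + 1.
pose st (f : dom M t1) : dom M (tN ⟶ tN ⟶ tN) := lam (fun m : N => lam (fun s : N =>
  if `[< app f s = (0 : N) >] then s else m + 1 : N)).
pose g : dom M (t1 ⟶ tN ⟶ tN) := lam (fun f => app (app (recM M) (st f)) (0 : N)).
have stE f (m s : N) : app (app (st f) m) s = (if `[< app f s = (0 : N) >] then s else m + 1 : N).
  by rewrite /st lamE ?lamE //; decn.
have gE f : app g f = app (app (recM M) (st f)) (0 : N).
  by rewrite /g lamE // /st; decn.
have g0 f : app (app g f) (0 : N) = (0 : N) by rewrite gE rec0.
have gS f (m : N) : app (app g f) (m + 1 : N) =
    (if `[< app f (app (app g f) m) = (0 : N) >] then app (app g f) m else m + 1 : N).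
  by rewrite gE recS stE.
have gA f : forall m : N, app f (app (app g f) m) = (0 : N) \/ app (app g f) m = m.
  apply: numind; first by decn.
    by right; rewrite g0.
  by move=> m IH; rewrite gS; case: asboolP => h; [left|right].
have gB f (m : N) : app f (app (app g f) m) = (0 : N) ->
    forall i : N, app (app g f) (m + i : N) = app (app g f) m.
  move=> h; apply: numind; first by decn.
    by rewrite addr0.
  by move=> i IH; rewrite addrA gS IH; case: asboolP.
have gC f : forall m : N, leN (app (app g f) m : N) m.
  apply: numind; first by decn.
    by rewrite g0; right.
  by move=> m IH; rewrite gS; case: asboolP => h; [nlra|right].
have gD f (m : N) : leN (app (app g f) m : N) (app (app g f) (m + 1 : N) : N).
  by rewrite gS; case: asboolP => h; [right|have hC := gC f m; nlra].
have gM f (m : N) : forall i : N, leN (app (app g f) m : N) (app (app g f) (m + i : N) : N).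
  apply: numind; first by decn.
    by rewrite addr0; right.
  move=> i IH; have := gD f (m + i); rewrite addrA => h; nlra.
pose yM : dom M (t1 ⟶ t1) := lam (fun f => tri (fun m => app x (three (app (app g f) m)))
  (fun m => app x (three (app (app g f) m) + 1 : N))
  (fun m => app x (three (app (app g f) m) + (1 + 1) : N))).
have axy f (m : N) : ax (app yM f) m = ax x (app (app g f) m).
  rewrite /yM lamE.
    by rewrite ax_tri; [|rewrite /three; defn..].
  by apply: (@def_tri M [:: t1] (fun m ρ => app x (three (app (app g (fst ρ)) m)))
    (fun m ρ => app x (three (app (app g (fst ρ)) m) + 1 : N))
    (fun m ρ => app x (three (app (app g (fst ρ)) m) + (1 + 1) : N)));
    rewrite /three; defn.
have yreal f : realP (app yM f).
  apply/realPE => n i; rewrite !axy.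
  case: (gA f n) => [h|h].
    by rewrite (gB f n h i) subrr; split; exact: ulp_gt0.
  have h1 := gM f n i; rewrite h in h1; rewrite h.
  exact: real_close.
(* Zeros up to K are found by inspection. A first zero beyond K makes y_f an approximation of x that
   is within 2^-K of x, and its ball would contain x unless Ψ(y_f) were small. *)
pose φ : dom M t2 := lam (fun f : dom M t1 =>
  if `[< app f (app (app g f) K) = (0 : N) \/ ~ (8 * ulp K < ax (app Ψ (app yM f)) K) >]
  then 0 : N else 1).
have φE f : app φ f = (if `[< app f (app (app g f) K) = (0 : N) \/ ~ (8 * ulp K < ax (app Ψ (app yM f)) K) >]
  then 0 : N else 1).
  rewrite /φ lamE //; apply: def_if; try by defn.
  apply: dec_or; first by decn.
  by apply: dec_not; apply: dec_ltq; [exact: defq_const|apply: defq_ax; defn].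
have eK : ulp n0 = 16 * ulp K by rewrite /K !ulpS; lra.
have hK0 : leN n0 K by rewrite /K; nlra.
exists φ; split.
  by move=> f; rewrite φE; case: asboolP => _; [exact: leN_0|right].
move=> f; rewrite φE; split.
- move=> [n hn]; case: asboolP => // /not_orP [h1 /contrapT h2]; exfalso.
  pose i0 : N := app (app g f) n.
  have hi0 : app f i0 = (0 : N) by case: (gA f n) => // h; rewrite /i0 h.
  have ge_n m : leN n m -> app (app g f) m = i0.
    by move=> /leNP [k ->]; rewrite gB.
  have le_n m : leN m n -> app (app g f) m = i0 \/ (app (app g f) m = m /\ leN m i0).
    move=> /leNP [k e1]; case: (gA f m) => h.
      by left; rewrite /i0 e1 gB.
    by right; split=> //; have := gM f m k; rewrite h -e1.
  have hKi0 : leN K i0.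
    case: (leN_total n K) => hh; first by case: h1; rewrite ge_n.
    by case: (le_n K hh) => [h|[_ //]]; case: h1; rewrite h.
  have [j hj] := ratc_surj (ax x i0).
  (* y_f and the constant sequence code the same real, so the values of Ψ at the two codes are equal
     reals. *)
  have heq : eqS (ax (app yM f)) (ax (app (ratc M) j)).
    move=> m; rewrite axy hj.
    have ep := ulp_gt0 m.
    case: (leN_total n m) => hh; first by rewrite ge_n // subrr; split; lra.
    case: (le_n m hh) => [->|[-> h]]; first by rewrite subrr; split; lra.
    by have [h3 h4] := real_close hx h; split; lra.
  have [h3 _] := hΨ2 _ _ (yreal f) (ratc_real j) heq K.
  apply: (hno j); have [hc _] := hΨ1 _ (ratc_real j).
  set c := app (ratc M) j in hj hc h3 *.
  have h4 : 6 * ulp K < ax (app Ψ c) K by lra.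
  have h5 : leN K (K + 1) by nlra.
  have [h6 h7] := real_close hc h5.
  have [h8 h9] := real_close hx hKi0.
  have := ulp_gt0 K => ep.
  by apply/ballPE; split; exists K; rewrite hj; lra.
- case: asboolP => [h _|_ h]; last by case: (@oneN_neq0 M).
  apply: contrapT => hn; case: h => [h|]; first by apply: hn; exists (app (app g f) K).
  apply.
  have gid m : app (app g f) m = m.
    by case: (gA f m) => // h; case: hn; exists (app (app g f) m).
  have heq : eqS (ax x) (ax (app yM f)).
    by move=> m; rewrite axy gid subrr; have := ulp_gt0 m; split; lra.
  have [h3 _] := hΨ2 _ _ hx (yreal f) heq K.
  have [h4 h5] := real_close hrΨ hK0.
  by have := ulp_gt0 K; lra.
Qed.

End Covers.

(** * Heine-Borel from weak Koenig's lemma *)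

Section HeineBorel.
Variable M : wmodel.
Notation N := (NN M).
Notation Q := (QQ M).
Local Notation ι := (@qnat M).

(** In the bijective coding, s + 1 in binary is the string preceded by a digit 1, so strings of
    length l have s + 1 between 2^l and 2^(l+1). *)
Definition has_len (l s : N) := leN (pw l) (s + 1) /\ ltN (s + 1) (pw (l + 1)).

Lemma has_len_inj (l l' s : N) : has_len l s -> has_len l' s -> l = l'.
Proof.
have h (a b : N) : has_len a s -> has_len b s -> ~ ltN a b.
  move=> [h1 h2] [h3 h4] /ltN_le /pw_mono h5.
  by nlra.
move=> h1 h2; case: (ltN_total l l') => [h3|[//|h3]]; [case: (h _ _ h1 h2 h3)|case: (h _ _ h2 h1 h3)].
Qed.

Lemma len_exists : exists f : dom M t1, forall s : N, has_len (app f s) s.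
Proof.
apply: (@numchoice M (fun s l => has_len l s)).
  by rewrite /has_len /pw; decn.
move=> s; pose g : dom M t1 := lam (fun m : N => pw m : dom M tN).
have gE (m : N) : app g m = pw m by rewrite /g lamE // /pw; defn.
have [||m [h1 h2]] := @between M g (s + 1).
- by rewrite gE pw0; nlra.
- by exists (s + 1); rewrite gE; exact: pw_gt.
by exists m; split; rewrite -gE.
Qed.

Definition len : dom M t1 := projT1 (cid len_exists).
Lemma lenP (s : N) : has_len (app len s) s.
Proof. exact: (projT2 (cid len_exists) s). Qed.

(* Left end of the dyadic interval of length 2^-l coded by a binary string [s] of length [l]. *)
Definition lf (l s : N) : Q := frac (s + 1) (pw l) (pw l).

Lemma lfE (l s : N) : lf l s = (ι s + 1) * ulp l - 1.
Proof.
have /qnat_gt0 h := pw_gt0 l.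
by rewrite /lf fracE ulp_inv qnatD qnat1 mulrBl divff // gt_eqF.
Qed.

Lemma defq_lf Γ (l s : env M Γ -> N) : @def M Γ tN l -> @def M Γ tN s ->
  defq (fun ρ => lf (l ρ) (s ρ)).
Proof.
by move=> hl hs; apply: defq_frac; rewrite /pw; try defn; move=> ρ; exact: pw_gt0.
Qed.

Ltac defqlf := repeat (cbv beta; lazymatch goal with
  | |- defq (fun ρ => lf (@?a ρ) (@?b ρ)) => apply: defq_lf
  | |- _ => defq1
  end).

Lemma lf_snoc (l s i : N) : lf (l + 1) (snocN s i) = lf l s + ι i * ulp (l + 1).
Proof. by rewrite !lfE /snocN !(qnatD, qnatM, qnat1) ulpS; lra. Qed.

Lemma has_len_snoc (l s i : N) : leN i 1 -> has_len l s -> has_len (l + 1) (snocN s i).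
Proof.
move=> hi [h1 h2]; rewrite pwS in h2; rewrite /has_len /snocN !pwS.
by split; nlra.
Qed.

(* The interval coded by [s], with a margin, lies in one of the first balls, as
   witnessed by approximations up to [l]. *)
Definition seen (Ψ : dom M (t1 ⟶ t1)) (y : dom M (tN ⟶ t1)) (l s : N) :=
  exists n : N, ltN n (l + 1) /\ exists m : N, ltN m (l + 1) /\
    (ax (app y n) m - ax (app Ψ (app y n)) m + 6 * ulp m < lf l s /\
     lf l s + ulp l + 6 * ulp m < ax (app y n) m + ax (app Ψ (app y n)) m).

Lemma dec_seen4 : dec (fun ρ : env M [:: tN; tN; (tN ⟶ t1)%ty; (t1 ⟶ t1)%ty] =>
  seen (fst (snd (snd (snd ρ)))) (fst (snd (snd ρ))) (fst (snd ρ)) (fst ρ)).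
Proof.
apply: dec_bex; last by defn.
apply: dec_bex; last by defn.
by apply: dec_and; apply: dec_ltq; defqlf.
Qed.

(** Packing [seen] into one functional lets it be applied to definable arguments in any context, as
    [dec_seen] requires. *)
Lemma seen_exists : exists h : dom M ((t1 ⟶ t1) ⟶ (tN ⟶ t1) ⟶ tN ⟶ tN ⟶ tN),
  forall Ψ y (l s : N), seen Ψ y l s <-> app (app (app (app h Ψ) y) l) s = (0 : N).
Proof.
have [F [c hc] hP] := dec_seen4; exists c => Ψ y l s.
have := hP (s, (l, (y, (Ψ, tt)))); have := hc (s, (l, (y, (Ψ, tt)))).
by move=> /= -> h; exact: h.
Qed.

Definition seenM := projT1 (cid seen_exists).

Lemma dec_seen Γ (Ψ : env M Γ -> dom M (t1 ⟶ t1)) (y : env M Γ -> dom M (tN ⟶ t1))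
  (l s : env M Γ -> N) : def Ψ -> def y -> @def M Γ tN l -> @def M Γ tN s ->
  dec (fun ρ => seen (Ψ ρ) (y ρ) (l ρ) (s ρ)).
Proof.
move=> h1 h2 h3 h4.
apply: (dec_ext (P := fun ρ => app (app (app (app seenM (Ψ ρ)) (y ρ)) (l ρ)) (s ρ) = (0 : N))).
  by move=> ρ; apply: iff_sym; exact: (projT2 (cid seen_exists)).
by apply: dec_eq; defn.
Qed.

(** Halving an interval keeps it inside the ball and more data is inspected at the next level. Hence
    the strings that are not seen form a tree. *)
Lemma seen_snoc Ψ y (l s i : N) : leN i 1 -> seen Ψ y l s -> seen Ψ y (l + 1) (snocN s i).
Proof.
move=> hi [n [hn [m [hm [h1 h2]]]]]; exists n; split; first by nlra.
exists m; split; first by nlra.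
rewrite lf_snoc ulpS; have h3 := ulp_gt0 l; have h4 := qnat_ge0 i.
move/qnat_le: hi; rewrite qnat1 => hi.
by split; nra.
Qed.

(** An arithmetical surrogate for the statement that finitely many balls cover [0,1]. The bound on s
    displays the quantifier as bounded, so that the condition is decidable. *)
Definition finite_cover Ψ y (L : N) := forall s : N, ltN s (pw (L + 1)) ->
  leN (pw L) (s + 1) /\ ltN (s + 1) (pw (L + 1)) -> seen Ψ y L s.

(** Rounding an approximation of x gives a dyadic interval of length 2^-L near x; the ball that was
    seen to contain this interval with a margin also contains x. *)
Lemma finite_cover_covers Ψ y (L : N) : posP Ψ -> (forall n, realP (app y n)) ->
  finite_cover Ψ y L ->
  forall x, unitP x -> exists n : N, ltN n (L + 1) /\ ballP Ψ (app y n) x.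
Proof.
move=> hΨ hy hfin x /unitPE [hx h0 h1].
have [hΨ1 _] := (posPE Ψ).1 hΨ.
(* Two extra digits put the approximation within a quarter of 2^-L of all later ones. *)
pose q := ax x (L + 1 + 1).
have e2 : ulp (L + 1 + 1) = ulp L / 4 by rewrite !ulpS; lra.
have eL := ulp_gt0 L; have eWL := ulpE L; set W := ι (pw L) in eWL.
have hW : 0 < W by apply/qnat_gt0; exact: pw_gt0.
have hq0 : - (ulp L / 2) <= q by have := h0 (L + 1 + 1); rewrite e2 -/q; lra.
have hq1 : q <= 1 + ulp L / 2 by have := h1 (L + 1 + 1); rewrite e2 -/q; lra.
have [p hp] : exists p : N, pw L = p + 1.
  by have /ltNP [p hp] := pw_gt0 L; exists p; rewrite hp add0r.
have hWp : W = ι p + 1 by rewrite /W hp qnatD qnat1.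
(* The approximation may slip out of [0,1] by half an interval; it is then assigned to the first or
   to the last interval, with that slack allowed throughout. *)
have [j [hj [hj1 hj2]]] : exists j : N, ltN j (pw L) /\
    (ι j * ulp L - ulp L / 2 <= q /\ q <= ι j * ulp L + ulp L + ulp L / 2).
  case: (ltP q 0) => hq.
    exists 0; split; first exact: pw_gt0.
    by rewrite qnat0 mul0r; split; lra.
  case: (ltP q 1) => hq'.
    have [|j [hj1 hj2]] := @floor_nat M (q * W); first by nra.
    have h3 : ι j * ulp L <= q * W * ulp L by rewrite ler_pM2r.
    have h4 : q * W * ulp L < (ι j + 1) * ulp L by rewrite ltr_pM2r.
    have h5 : q * W * ulp L = q by rewrite -mulrA (mulrC W) eWL mulr1.
    exists j; split; last by split; lra.
    by apply/qnat_lt; rewrite -/W; nra.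
  exists p; split; first by rewrite hp; nlra.
  have h3 : ι p * ulp L = 1 - ulp L by rewrite -eWL hWp; ring.
  by rewrite h3; split; lra.
(* As p = 2^L - 1 codes the string of L zeros, p + j codes the j-th string of length L. *)
have hs1 : p + j + 1 = pw L + j by rewrite hp; ring.
have hlf : lf L (p + j) = ι j * ulp L.
  rewrite lfE qnatD; have h3 : ι p * ulp L = 1 - ulp L by rewrite -eWL hWp; ring.
  by rewrite !mulrDl h3; ring.
have [||n [hn [m [hm [hA hB]]]]] := hfin (p + j).
- by rewrite pwS; move: hj; rewrite hp => hj; nlra.
- by rewrite hs1 pwS; split; nlra.
exists n; split=> //.
have hmL : leN m L by nlra.
have heL := ulp_mono hmL.
have [k0 [hk1 hk2]] := above2 m (L + 1 + 1).
have [hψ _] := hΨ1 _ (hy n).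
(* The margin 6 · 2^-m in [seen] pays for the drift of centre and radius, 2^-m each, for the
   location of x, three quarters of 2^-L with m ≤ L, and for the margin 2^-m claimed here. *)
apply: (@gap_ballP M Ψ (app y n) x (ulp m) k0 (hy n) hψ (ulp_gt0 m)).
move=> k hk; have hmk : leN m k by nlra.
have hLk : leN (L + 1 + 1) k by nlra.
have [h2 h3] := real_close (hy n) hmk; have [h4 h5] := real_close hψ hmk.
have [h6 h7] := real_close hx hLk; rewrite e2 -/q in h6 h7.
by rewrite hlf in hA hB; split; lra.
Qed.

(** If the tree of unseen strings were infinite, a path through it would give nested dyadic
    intervals shrinking to a real z in [0,1]. Some ball contains z with a margin, so a late interval
    on the path would be seen. *)
Lemma WKL_finite_cover Ψ y : WKLs M -> posP Ψ -> (forall n, realP (app y n)) ->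
  (forall x, unitP x -> exists n, ballP Ψ (app y n) x) -> exists L, finite_cover Ψ y L.
Proof.
move=> wkl hΨ hy hcov; have [hΨ1 _] := (posPE Ψ).1 hΨ.
have ds : @dec M [:: tN] (fun ρ => seen Ψ y (app len (fst ρ)) (fst ρ)).
  by apply: dec_seen; defn.
pose T : dom M t1 := lam (fun s : N => if `[< seen Ψ y (app len s) s >] then 0 : N else 1).
have TE (s : N) : app T s = (if `[< seen Ψ y (app len s) s >] then 0 : N else 1).
  by rewrite /T lamE //; apply: def_if => //; defn.
have T1 (s : N) : app T s = oneM <-> ~ seen Ψ y (app len s) s.
  rewrite TE; case: asboolP => h; split=> // h'.
  by case: (@oneN_neq0 M).
have treeT : (forall n : N, leN (app T n : N) 1) /\
   (forall s i : N, leN i 1 -> app T (snocN s i) = oneM -> app T s = oneM).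
  split=> [n|s i hi]; first by rewrite TE; case: asboolP => _; [exact: leN_0|right].
  rewrite !T1 => h h'; apply: h.
  have -> : app len (snocN s i) = (app len s : N) + 1.
    exact: has_len_inj (lenP _) (has_len_snoc hi (lenP s)).
  exact: seen_snoc.
case: (pselect (forall n : N, exists s : N, ltN n s /\ app T s = oneM)) => hinf; last first.
  move/existsNP: hinf => [n0 hn0].
  (* No unseen string has a code above n0, while all strings of length n0 + 1 do, so this level is
     entirely seen. *)
  exists (n0 + 1) => s _ hs; apply: contrapT => hns; apply: hn0; exists s; split.
    by case: hs => h1 h2; have h3 := pw_gt (n0 + 1); nlra.
  apply/T1; suff -> : app len s = n0 + 1 by [].
  exact: has_len_inj (lenP s) hs.
exfalso; have [f [hf [g [[g0 gS] hg]]]] := wkl T treeT hinf.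
have hlen : forall n : N, has_len n (app g n).
  apply: numind; first by rewrite /has_len /pw; decn.
    by rewrite g0 /has_len pwS pw0; split; nlra.
  by move=> n IH; rewrite gS; apply: has_len_snoc.
(* The left ends along the path increase weakly, while the right ends [u n + ulp n] decrease
   weakly. *)
pose u (n : N) : Q := lf n (app g n).
have u0 : u 0 = 0 by rewrite /u lfE g0 ulp0 qnat0; lra.
have fpos (n : N) : 0 <= ι (app f n) * ulp (n + 1) by apply: mulr_ge0; [exact: qnat_ge0|apply: ltW; exact: ulp_gt0].
have fle (n : N) : ι (app f n) * ulp (n + 1) <= ulp (n + 1).
  have /qnat_le := hf n; rewrite qnat1 => h; rewrite -[leRHS]mul1r ler_pM2r //; exact: ulp_gt0.
have uS (n : N) : u (n + 1) = u n + ι (app f n) * ulp (n + 1) by rewrite /u gS lf_snoc.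
have umono (n : N) : forall i : N, u n <= u (n + i) /\ u (n + i) + ulp (n + i) <= u n + ulp n.
  apply: numind.
    by rewrite /u; apply: dec_and; apply: dec_leq; defqlf.
    by rewrite addr0; split; exact: lexx.
  move=> i [h1 h2]; rewrite addrA uS.
  by have := fpos (n + i); have := fle (n + i); have := ulpS (n + i); split; lra.
pose z : dom M t1 := tri (fun n => (app g n : N) + 1) (fun n => pw n) (fun n => subN (pw n) 1).
have axz (n : N) : ax z n = u n.
  rewrite /z ax_tri; try by rewrite /pw; repeat first [apply: def_sub|defn1].
  rewrite subN_le //; have h := pw_gt0 n; nlra.
have hz : realP z.
  apply/realPE => n i; rewrite !axz; have [h1 h2] := umono n i.
  by have := ulp_gt0 (n + i); have := ulp_gt0 n; split; lra.
have uz : unitP z.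
  apply/unitPE; split=> // n; rewrite axz; have := umono 0 n; rewrite !add0r u0 ulp0 => -[h1 h2];
  by have := ulp_gt0 n; lra.
have [n hn] := hcov z uz.
have [δ hδ [K hK]] := ballP_gap (hy n) (hΨ1 _ (hy n)).1 hz hn.
(* Seven units: one for the length of the interval and six for the margin in [seen]. *)
have [k0 hk0] : exists k : N, ulp k < δ / 7 by apply: ulp_small; lra.
(* Adding n puts the ball of index n among those inspected at level k. *)
pose k := K + n + k0.
have hk1 : leN K k by rewrite /k; nlra.
have hk2 : leN k0 k by rewrite /k; nlra.
have [h1 h2] := hK k hk1; have h3 := ulp_mono hk2; rewrite axz in h1 h2.
have /T1 := hg k; apply; rewrite (has_len_inj (lenP _) (hlen k)).
exists n; split; first by rewrite /k; nlra.
exists k; split; first by nlra.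
by rewrite -/(u k); split; lra.
Qed.

Lemma WKL_SLIN_HBU : WKLs M -> SLIN M -> HBUs M.
Proof.
move=> wkl hS Ψ hΨ; have [y [hy hcov]] := hS Ψ hΨ.
have [|L hL] := WKL_finite_cover wkl hΨ hy.
  by move=> x /unitPE [hx _ _]; exact: hcov.
exists (L + 1), y; split=> [i _|x hx]; first exact: hy.
exact: finite_cover_covers hx.
Qed.

End HeineBorel.

(** * Selecting centres under (∃²) *)

Section Choice.
Variable M : wmodel.
Notation N := (NN M).
Notation Q := (QQ M).
Local Notation ι := (@qnat M).

Hypothesis qf_ac01 : models M (QF_AC tN t1).
Variable φ : dom M t2.
Hypothesis hφ : E2_at φ.

(** The characteristic functional enters as a parameter, which turns a decidable matrix into an
    equation. *)
Lemma dec_choice01 Γ (P : env M (t1 :: tN :: Γ) -> Prop) (ρ : env M Γ) : dec P ->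
  (forall n : N, exists x, P (x, (n : dom M tN, ρ))) ->
  exists Y : dom M (tN ⟶ t1), forall n : N, P (app Y n, (n : dom M tN, ρ)).
Proof.
move=> hP hex; have [h hh] := dec_fun2 ρ hP.
pose A : form [:: t1; tN; (tN ⟶ t1 ⟶ tN)%ty] :=
  (Var (vs _ (vs _ vz)) · Var (vs _ vz) · Var vz ≐ Zero)%fm.
have hA : qfree A by [].
have hc := iffLR (@sat_choice M _ _ _ A ((h, tt) : env M [:: (tN ⟶ t1 ⟶ tN)%ty])) (qf_ac01 (ax_QF_AC hA) _).
have [|Y hY] := hc.
  by move=> n; have [x /hh hx] := hex n; exists x.
by exists Y => n; apply/hh; exact: hY.
Qed.

Lemma dec_all Γ (P : env M (tN :: Γ) -> Prop) : dec P ->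
  dec (fun ρ => forall x : N, P (x : dom M tN, ρ)).
Proof.
move=> hP; apply: dec_ext (dec_not (dec_ex hφ (dec_not hP))) => ρ.
split=> [h x|h [x]]; last by apply; exact: h.
by apply: contrapT => h'; apply: h; exists x.
Qed.

Lemma dec_realP Γ (X : env M Γ -> dom M t1) : def X -> dec (fun ρ => realP (X ρ)).
Proof.
move=> hX.
have hd : dec (fun ρ : env M [:: t1] => sat (is_real (Var vz)) ρ).
  by apply: (dec_numerical hφ); repeat split.
have [h hh] := @dec_fun1 M nil t1 _ tt hd.
apply: (dec_ext (P := fun ρ => app h (X ρ) = (0 : N))); last by apply: dec_eq; defn.
by move=> ρ; rewrite -hh.
Qed.

(* A chosen centre is only required to cover the rationals of its interval,
   which makes the matrix of the choice arithmetical. *)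
Lemma E2_LIN_SLIN : LINs M -> SLIN M.
Proof.
move=> lin Ψ hΨ; have [hΨ1 _] := (posPE Ψ).1 hΨ.
have [a [b [hab [hcov hball]]]] := lin Ψ hΨ.
pose A0 : form [:: t1; tN; (tN ⟶ t1)%ty; (tN ⟶ t1)%ty; (t1 ⟶ t1)%ty; (tN ⟶ t1)%ty] :=
  And (is_real (Var vz)) (All (τ := tN)
   (Imp (in_interval (Var (vs _ (vs _ (vs _ (vs _ (vs _ (vs _ vz)))))) · Var vz)%fm
           (RVar (Var (vs _ (vs _ (vs _ vz))) · Var (vs _ (vs _ vz))))%fm
           (RVar (Var (vs _ (vs _ (vs _ (vs _ vz)))) · Var (vs _ (vs _ vz))))%fm)
        (in_ball (Var (vs _ (vs _ (vs _ (vs _ (vs _ vz)))))) (Var (vs _ vz))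
           (Var (vs _ (vs _ (vs _ (vs _ (vs _ (vs _ vz)))))) · Var vz)%fm))).
pose ρ : env M [:: (tN ⟶ t1)%ty; (tN ⟶ t1)%ty; (t1 ⟶ t1)%ty; (tN ⟶ t1)%ty] :=
  (a, (b, (Ψ, (ratc M, tt)))).
have satA x n : sat A0 (x, (n, ρ)) <->
    realP x /\ forall j, inP (app a n) (app b n) (app (ratc M) j) -> ballP Ψ x (app (ratc M) j).
  exact: iff_refl.
have hA : numerical A0 by repeat split.
have hd := dec_numerical hφ hA.
have [|y hy] := dec_choice01 (ρ := ρ) hd.
  move=> n; have [x [hx h]] := hball n; exists x; apply/satA; split=> // j.
  exact: (iffLR (h _ (ratc_real j))).
exists y; split; first by move=> n; have /satA [] := hy n.
move=> x hx; have [n hn] := hcov x hx; exists n.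
have /satA [hyn hj] := hy n; have [ha hb] := hab n.
have [δ hδ [K hK]] := inP_gap ha hb hx hn.
have [k0 hk0] : exists k : N, ulp k < δ / 8 by apply: ulp_small; lra.
have [k [hk1 hk2]] := above2 K k0.
have hek := ulp_mono hk2.
have inj q : ax x k - δ / 2 <= q -> q <= ax x k + δ / 2 -> exists2 j,
    (forall l, ax (app (ratc M) j) l = q) & ballP Ψ (app y n) (app (ratc M) j).
  move=> hq1 hq2; have [j hjq] := ratc_surj q; exists j => //; apply: hj.
  apply: (@gap_inP M _ _ _ (δ / 4) k); first by lra.
  move=> l hl; have hKl : leN K l by nlra.
  have [h1 h2] := hK l hKl; have [h3 h4] := real_close hx hl.
  by rewrite hjq; split; lra.
(* Two rationals at distance δ/4 on either side of the approximation lie in the interval, hence in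
   the chosen ball. As x lies between them with δ/8 to spare, convexity puts x in the ball. *)
have [j1 hj1 hb1] : exists2 j, (forall l, ax (app (ratc M) j) l = ax x k - δ / 4)
  & ballP Ψ (app y n) (app (ratc M) j) by apply: inj; lra.
have [j2 hj2 hb2] : exists2 j, (forall l, ax (app (ratc M) j) l = ax x k + δ / 4)
  & ballP Ψ (app y n) (app (ratc M) j) by apply: inj; lra.
have hψ := (hΨ1 _ hyn).1.
have [δ1 hδ1 [K1 hK1]] := ballP_gap hyn hψ (ratc_real j1) hb1.
have [δ2 hδ2 [K2 hK2]] := ballP_gap hyn hψ (ratc_real j2) hb2.
have [L' [hL1 hL2]] := above2 K1 K2; have [L [hL3 hL4]] := above2 L' k.
apply: (@gap_ballP M Ψ (app y n) x (δ / 8) L hyn hψ); first by lra.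
move=> l hl; have hl1 : leN K1 l by nlra.
have hl2 : leN K2 l by nlra.
have hl3 : leN k l by nlra.
have [h1 _] := hK1 l hl1; have [_ h2] := hK2 l hl2; have [h3 h4] := real_close hx hl3.
by rewrite hj1 in h1; rewrite hj2 in h2; split; lra.
Qed.

Definition zc (c : N) : Q := ι (app (fstM M) c) - ι (app (sndM M) c).

(** Translation by the integer coded by c, performed on the numerators of the code, so that every
    approximation shifts exactly. *)
Definition shiftM : dom M (tN ⟶ t1 ⟶ t1) := lam (fun c : N => lam (fun x : dom M t1 =>
  tri (fun k => (app x (three k) : N) + (app (fstM M) c : N) * ((app x (three k + (1 + 1) : N) : N) + 1))
      (fun k => (app x (three k + 1 : N) : N) + (app (sndM M) c : N) * ((app x (three k + (1 + 1) : N) : N) + 1))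
      (fun k => app x (three k + (1 + 1) : N)))).

Lemma ax_shift (c : N) x k : ax (app (app shiftM c) x) k = ax x k + zc c.
Proof.
rewrite /shiftM lamE; last first.
  apply: (@def_lam M [:: tN] t1 t1 (fun x ρ => tri
    (fun k => (app x (three k) : N) + (app (fstM M) (fst ρ) : N) * ((app x (three k + (1 + 1) : N) : N) + 1))
    (fun k => (app x (three k + 1 : N) : N) + (app (sndM M) (fst ρ) : N) * ((app x (three k + (1 + 1) : N) : N) + 1))
    (fun k => app x (three k + (1 + 1) : N)))).
  apply: (@def_tri M [:: t1; tN]
    (fun k ρ => (app (fst ρ) (three k) : N) + (app (fstM M) (fst (snd ρ)) : N) * ((app (fst ρ) (three k + (1 + 1) : N) : N) + 1))
    (fun k ρ => (app (fst ρ) (three k + 1 : N) : N) + (app (sndM M) (fst (snd ρ)) : N) * ((app (fst ρ) (three k + (1 + 1) : N) : N) + 1))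
    (fun k ρ => app (fst ρ) (three k + (1 + 1) : N))); rewrite /three; defn.
rewrite lamE; last first.
  apply: (@def_tri M [:: t1]
    (fun k ρ => (app (fst ρ) (three k) : N) + (app (fstM M) c : N) * ((app (fst ρ) (three k + (1 + 1) : N) : N) + 1))
    (fun k ρ => (app (fst ρ) (three k + 1 : N) : N) + (app (sndM M) c : N) * ((app (fst ρ) (three k + (1 + 1) : N) : N) + 1))
    (fun k ρ => app (fst ρ) (three k + (1 + 1) : N))); rewrite /three; defn.
rewrite ax_tri; try by rewrite /three; defn.
rewrite axE !fracE /zc; have /qnat_gt0 := den_gt0 (app x (three k + (1 + 1) : N) : N).
rewrite !(qnatD (_ : N) (_ * _)) !qnatM; move: (ι (_ + 1)) => d hd.
have hd' : d != 0 by rewrite gt_eqF.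
have h (F : fieldType) (p m i j u : F) : u != 0 -> (p + i * u - (m + j * u)) / u = (p - m) / u + (i - j).
  by move=> hu; field.
exact: h.
Qed.

Lemma shift_real (c : N) x : realP x -> realP (app (app shiftM c) x).
Proof.
move=> /realPE hx; apply/realPE => n i; rewrite !ax_shift.
by have [h1 h2] := hx n i; split; lra.
Qed.

(** If f is the integer part of the approximation of index 0, then x lies between f - 1 and f + 2.
    Which of the three unit intervals to use is settled by asking whether some later approximation
    proves x below f or above f + 1. *)
Lemma integer_part x : realP x -> exists c c' : N,
  zc c' = - zc c /\ unitP (app (app shiftM c') x).
Proof.
move=> hx.
have key (i j : N) : (forall k, 0 <= ax x k - (ι i - ι j) + 2 * ulp k) ->
    (forall k, ax x k - (ι i - ι j) <= 1 + 2 * ulp k) ->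
    exists c c' : N, zc c' = - zc c /\ unitP (app (app shiftM c') x).
  move=> h1 h2; exists (pairN i j), (pairN j i).
  rewrite /zc !(fst_pair, snd_pair); split; first by ring.
  apply/unitPE; split; first exact: shift_real.
    by move=> k; rewrite ax_shift /zc fst_pair snd_pair; have := h1 k; lra.
  by move=> k; rewrite ax_shift /zc fst_pair snd_pair; have := h2 k; lra.
have [i [j [hf1 hf2]]] := floor_int (ax x 0).
have h0 k : ax x 0 - ax x k < 1 /\ ax x k - ax x 0 < 1.
  by rewrite -(@ulp0 M); apply: real_close; [|exact: leN_0].
case: (pselect (forall k, 0 <= ax x k - (ι i - ι j) + 2 * ulp k)) => hl; last first.
  move/existsNP: hl => [n /negP]; rewrite -ltNge => hn.
  apply: (key i (j + 1)); rewrite qnatD qnat1 => k.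
    by have [h1 h2] := h0 k; have := ulp_gt0 k; lra.
  by have h1 := real_near k n hx; have := ulp_gt0 n; have := ulp_gt0 k; lra.
case: (pselect (forall k, ax x k - (ι i - ι j) <= 1 + 2 * ulp k)) => hu; first exact: (key i j).
move/existsNP: hu => [n /negP]; rewrite -ltNge => hn.
apply: (key (i + 1) j); rewrite qnatD qnat1 => k.
  by have h1 := real_near n k hx; have := ulp_gt0 n; have := ulp_gt0 k; lra.
by have [h1 h2] := h0 k; have := ulp_gt0 k; lra.
Qed.

(** Reads one object of type 1 as a sequence of reals, so that QF-AC^{0,1} can select entire
    sequences of centres. *)
Definition dcd : dom M (t1 ⟶ tN ⟶ t1) := lam (fun w : dom M t1 => lam (fun i : N =>
  lam (fun p : N => app w (pairN i p)))).

Lemma dcdE w (i p : N) : app (app (app dcd w) i) p = app w (pairN i p).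
Proof. by rewrite /dcd /pairN lamE ?lamE ?lamE //; defn. Qed.

Lemma dcd_surj (y : dom M (tN ⟶ t1)) : exists w, app dcd w = y.
Proof.
exists (lam (fun s : N => app (app y (app (fstM M) s)) (app (sndM M) s))).
apply: app_ext => i; apply: app_ext => p.
by rewrite dcdE lamE ?fst_pair ?snd_pair //; defn.
Qed.

(** HBU speaks of [0,1] only, so it is applied to the translate of Ψ by each integer. Choice selects
    a coded finite cover for every integer, and the centres of the cover of the line are indexed by
    pairs of an integer and a position. *)
Lemma E2_HBU_SLIN : WKLs M -> HBUs M -> SLIN M.
Proof.
move=> wkl hbu Ψ hΨ; have [hΨ1 hΨ2] := (posPE Ψ).1 hΨ.
pose ΨM : dom M (tN ⟶ t1 ⟶ t1) := lam (fun c : N => lam (fun x : dom M t1 =>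
  app Ψ (app (app shiftM c) x))).
have ΨE (c : N) x : app (app ΨM c) x = app Ψ (app (app shiftM c) x).
  by rewrite /ΨM (lam2E (F := fun (c : dom M tN) x => app Ψ (app (app shiftM c) x))) //; defn.
have posΨ (c : N) : posP (app ΨM c).
  apply/posPE; split=> [x hx|x y hx hy hxy]; rewrite !ΨE.
    exact: hΨ1 (shift_real c hx).
  apply: hΨ2; try exact: shift_real.
  by move=> n; rewrite !ax_shift; have [h1 h2] := hxy n; split; lra.
(* [finite_cover] keeps the selected property arithmetical; φ absorbs the quantifiers over i, over L
   and inside [realP]. *)
have hdec : dec (fun ρ : env M [:: t1; tN] =>
    (forall i : N, realP (app (app dcd (fst ρ)) i)) /\
    exists L : N, finite_cover (app ΨM (fst (snd ρ))) (app dcd (fst ρ)) L).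
  apply: dec_and.
    by apply: (dec_all (P := fun ρ : env M [:: tN; t1; tN] => realP (app (app dcd (fst (snd ρ))) (fst ρ))));
      apply: dec_realP; defn.
  apply: (dec_ex hφ (P := fun ρ : env M [:: tN; t1; tN] =>
    finite_cover (app ΨM (fst (snd (snd ρ)))) (app dcd (fst (snd ρ))) (fst ρ))).
  apply: dec_ball; last by rewrite /pw; defn.
  apply: dec_imp; first by rewrite /pw; decn.
  by apply: dec_seen; defn.
have [|W hW] := @dec_choice01 nil _ tt hdec.
  move=> c; have [k [y [hy hcov]]] := hbu _ (posΨ c).
  (* The point 0 has to be covered, so k is positive and the centre of index 0 is a real. *)
  have [j0 hj0] := ratc_surj (0 : Q).
  have [|i0 [hi0 _]] := hcov (app (ratc M) j0).
    apply/unitPE; split=> [|n|n]; first exact: ratc_real.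
      by rewrite hj0; have := ulp_gt0 n; lra.
    by rewrite hj0; have := ulp_gt0 n; lra.
  (* From k on the first centre is repeated: HBU vouches for reals below k only, whereas the
     selected sequence must consist of reals. *)
  pose y' : dom M (tN ⟶ t1) := lam (fun i : N => app y (if `[< ltN i k >] then i else 0 : N)).
  have y'E (i : N) : app y' i = app y (if `[< ltN i k >] then i else 0 : N).
    by rewrite /y' lamE //; apply: def_app; [exact: def_const|decn].
  have hy' n : realP (app y' n).
    rewrite y'E; apply: hy; case: asboolP => // _; nlra.
  have [w hw] := dcd_surj y'; exists w => /=; rewrite hw; split=> //.
  (* WKL converts covering every real of [0,1] into the arithmetical condition. *)
  apply: WKL_finite_cover => // x hx.
  have [i [hi hb]] := hcov x hx; exists i.
  by rewrite y'E; case: asboolP.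
pose y : dom M (tN ⟶ t1) := lam (fun s : N =>
  app (app shiftM (app (fstM M) s)) (app (app dcd (app W (app (fstM M) s))) (app (sndM M) s))).
have yE (s : N) : app y s =
  app (app shiftM (app (fstM M) s)) (app (app dcd (app W (app (fstM M) s))) (app (sndM M) s)).
  by rewrite /y lamE //; defn.
exists y; split.
  by move=> s; rewrite yE; apply: shift_real; have /= [h _] := hW (app (fstM M) s); exact: h.
move=> x hx; have [c [c' [hc hu]]] := integer_part hx.
have /= [hr [L hL]] := hW c.
have [n [_ hn]] := finite_cover_covers (posΨ c) hr hL hu.
exists (pairN c n); rewrite yE fst_pair snd_pair.
set d := app (app dcd (app W c)) n in hn *.
have hd : realP d by exact: hr.
have hψ : realP (app (app ΨM c) d) by rewrite ΨE; exact: (hΨ1 _ (shift_real c hd)).1.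
have [δ hδ [K hK]] := ballP_gap hd hψ (shift_real c' hx) hn.
have hψ' := (hΨ1 _ (shift_real c hd)).1.
apply: (@gap_ballP M Ψ _ x δ K (shift_real c hd) hψ' hδ) => k hk.
have [h1 h2] := hK k hk; rewrite ΨE ax_shift hc in h1 h2; rewrite ax_shift.
by split; lra.
Qed.

End Choice.

(** * Transfer from second-order provability and the final equivalences *)

Section Main.
Variable M : wmodel.

Lemma E2_ACA0 : sat (M := M) E2 tt -> forall A, proves2 ACA0 nil A -> sat (M := M) A tt.
Proof.
move=> [φ [_ hφ]] A hA; apply: (soundness _ hA) => // Γ B _ [hB|hB].
  exact: RCA0_holds.
exact: arith_CA_holds hφ _ _ hB.
Qed.

Lemma RCA0_transfer X A : proves2 RCA0 (cons X nil) A -> sat (M := M) X tt -> sat (M := M) A tt.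
Proof.
move=> hA hX; apply: (soundness _ hA) => [Γ B _ hB|B /= [<-|//]]; last exact: hX.
exact: RCA0_holds.
Qed.

Lemma not_E2_SLIN : ~ sat (M := M) E2 tt -> SLIN M.
Proof. exact: E2_or_SLIN. Qed.

End Main.

(** One case distinction on (∃²) in an arbitrary model serves both disjunctions of part (b): A is
    taken to be Y, and then (∃²) itself. *)
Lemma proves_or_LIN (A : sentence) : (forall M : wmodel, sat (M := M) E2 tt -> sat (M := M) A tt) ->
  proves RCA0omega (A ∨ LIN)%fm.
Proof.
move=> h; apply: completeness => // M hM; pose W := WModel hM.
case: (pselect (sat (M := M) E2 tt)) => hE; first by left; exact: (h W).
by right; apply: (@SLIN_LIN W); apply: not_E2_SLIN.
Qed.

Local Open Scope fm_scope.

Theorem theorem3p18 :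
  (forall X : sentence,
      L2_fm X ->
      proves2 ACA0 nil X ->
      proves2 RCA0 (cons X nil) WKL ->
      proves (union RCA0omega (QF_AC tN t1))
        ((LIN ⇔ (HBU ∨ ¬ WKL)) ∧ ((HBU ∨ ¬ WKL) ⇔ (HBU ∨ ¬ X))))
  /\
  (forall Y : sentence,
      L2_fm Y ->
      proves2 ACA0 nil Y ->
      ~ proves2 RCA0 nil Y ->
      proves RCA0omega (Y ∨ LIN) /\
      (forall (Γ : ctx) (A : form (cons tN Γ)),
          Pi11 A ->
          proves RCA0omega (closure (comprehension A) ∨ E2 ∨ LIN))).
Proof.
split=> [X _ hX hWKL|Y _ hY _].
  apply: completeness => [Γ A hA|M hM]; first by left.
  have hR : models M RCA0omega by move=> Γ A hA; apply: hM; left.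
  have hAC : models M (QF_AC tN t1) by move=> Γ A hA; apply: hM; right.
  pose W := WModel hR.
  have XW : sat (M := M) X tt -> sat (M := M) WKL tt by exact: (@RCA0_transfer W).
  have EX : sat (M := M) E2 tt -> sat (M := M) X tt by move=> hE; exact: (@E2_ACA0 W).
  have nES : ~ sat (M := M) E2 tt -> SLIN W by exact: (@not_E2_SLIN W).
  have LS : sat (M := M) LIN tt -> SLIN W.
    move=> hL; case: (pselect (sat (M := M) E2 tt)) => [[φ [_ hφ]]|/nES//].
    exact: (@E2_LIN_SLIN W hAC φ hφ).
  have SH : sat (M := M) WKL tt -> SLIN W -> sat (M := M) HBU tt by exact: (@WKL_SLIN_HBU W).
  have SL : SLIN W -> sat (M := M) LIN tt by exact: (@SLIN_LIN W).
  have HL : sat (M := M) HBU tt -> sat (M := M) LIN tt.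
    move=> hH; case: (pselect (sat (M := M) E2 tt)) => [hE|/nES/SL//].
    have hK := XW (EX hE); case: hE => φ [_ hφ]; apply: SL.
    exact: (@E2_HBU_SLIN W hAC φ hφ).
  have main1 : sat (M := M) LIN tt <-> sat (M := M) HBU tt \/ ~ sat (M := M) WKL tt.
    split=> [/LS hS|[//|hK]].
      by case: (pselect (sat (M := M) WKL tt)) => hK; [left; exact: SH|right].
    (* Failure of WKL refutes (∃²), since (∃²) gives X and X gives WKL; the centres then come from
       the failure of (∃²). *)
    by apply/SL/nES => /EX/XW.
  have main2 : (sat (M := M) HBU tt \/ ~ sat (M := M) WKL tt) <->
      (sat (M := M) HBU tt \/ ~ sat (M := M) X tt).
    split=> -[hH|hn]; [by left|by right => /XW|by left|].
    (* Failure of X likewise refutes (∃²), and a case distinction on WKL yields the left-hand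
       side. *)
    have hS : SLIN W by apply: nES => /EX.
    by case: (pselect (sat (M := M) WKL tt)) => hK; [left; exact: SH|right].
  by split; [exact: main1|exact: main2].
split; first by apply: proves_or_LIN => M hE; exact: E2_ACA0.
move=> Γ A _; apply: completeness => // M hM; right.
have := proves_or_LIN (A := E2) (fun _ h => h) => hp.
exact: (soundness (fun Γ A _ hA => hM Γ A hA) hp).
Qed.
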